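(* Consider the multi-type TASEP $(\eta_t)_{t\ge 0}$ on $\mathbb{Z}$ with initial configuration $\eta_0(x)=-x$ for $x\le 0$ and $\eta_0(x)=-\infty$ for $x>0$. The leader at time $t$ is the right-most particle at time $t$. Let $\mathcal{S}(t)$ be the number of changes of the leader's type up to time $t$, i.e. the number of moments in $[0,t]$ at which the type of the right-most particle changes. Then $$\lim_{t\to\infty}\frac{\mathbf{E}\left(\mathcal{S}(t)\right)}{\ln(t)}=\frac{3\sqrt{3}}{4\pi}.$$
   Context: Multi-type TASEP: a continuous-time Markov process whose states are maps $\eta:\mathbb{Z}\to\mathbb{Z}\cup\{-\infty\}$. The value $\eta(x)=c\in\mathbb{Z}$ means that a particle of type $c$ is at position $x$; $\eta(x)=-\infty$ means that $x$ is empty (a hole). Each pair of neighboring sites $(x,x+1)$ carries an independent exponential clock of rate $1$. When the clock of $(x,x+1)$ rings, the values at $x$ and $x+1$ are swapped if $\eta(x)>\eta(x+1)$, and nothing happens otherwise. (The process is well defined by the standard graphical construction.) *)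

(* Defs.v *)
From HB Require Import structures.
From mathcomp Require Import all_boot all_order all_algebra.
From mathcomp Require Import all_classical all_reals all_analysis.

Set Implicit Arguments.
Unset Strict Implicit.
Unset Printing Implicit Defensive.

Import Order.TTheory GRing.Theory Num.Theory.
Import numFieldNormedType.Exports.

Local Open Scope classical_set_scope.
Local Open Scope ring_scope.

(* [Some c] is a particle of type [c]; [None] is the value -oo, i.e. a hole. *)
Definition config := int -> option int.

(* The order > on Z u {-oo}. *)
Definition gt_type (a b : option int) : bool :=
  match a, b with
  | Some i, Some j => j < i
  | Some _, None => true
  | None, _ => false
  end.

Definition swap_edge (x : int) (e : config) : config := fun y =>
  if gt_type (e x) (e (x + 1)) then
    if y == x then e (x + 1) else if y == x + 1 then e x else e y
  else e y.

Definition init_config : config := fun x => if x <= 0 then Some (- x) else None.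

Definition mutually_independent {d : measure_display} {T : measurableType d}
    {R : realType} {P : probability T R} {I : eqType}
    (X : I -> {RV P >-> R}) : Prop :=
  forall (s : seq I) (A : I -> set R), uniq s ->
    (forall i, measurable (A i)) ->
    P [set w | forall i, i \in s -> A i (X i w)] =
      (\prod_(i <- s) P (X i @^-1` A i))%E.

(* [xi (x, n)] is the waiting time of the clock of the edge (x, x + 1) between
   its n-th and (n + 1)-st rings (the 0-th ring being time 0). *)
Definition exponential_clocks {d : measure_display} {T : measurableType d}
    {R : realType} {P : probability T R}
    (xi : int * nat -> {RV P >-> R}) : Prop :=
  mutually_independent xi /\
  forall i (A : set R), measurable A ->
    distribution P (xi i) A = exponential_prob 1 A.

Definition rings {d : measure_display} {T : measurableType d}
    {R : realType} {P : probability T R}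
    (xi : int * nat -> {RV P >-> R}) (w : T) (x : int) (t : R) : Prop :=
  exists n : nat, t = \sum_(k < n.+1) xi (x, k : nat) w.

(* A trajectory of the graphical construction: sitewise right-continuous with
   left limits for the discrete topology on types, changing only when a clock
   rings.  Almost surely no two clocks ring simultaneously, so that the swap
   describes the whole configuration at a ringing time; and almost surely, for
   every horizon, there are edges arbitrarily far to the left and to the right
   which have not rung, so that the trajectory is determined by the clocks. *)
Definition tasep_trajectory {R : realType} (e0 : config)
    (ring : int -> R -> Prop) (e : R -> config) : Prop :=
  [/\ e 0 = e0,
      forall t x, 0 <= t -> \forall s \near t^'+, e s x = e t x &
      forall t, 0 < t -> exists e_ : config,
        [/\ forall x, \forall s \near t^'-, e s x = e_ x,
            forall x, ring x t -> e t = swap_edge x e_ &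
            (forall x, ~ ring x t) -> e t = e_]].

Definition multitype_tasep {d : measure_display} {T : measurableType d}
    {R : realType} {P : probability T R}
    (e0 : config) (xi : int * nat -> {RV P >-> R}) (eta : R -> T -> config) : Prop :=
  [/\ exponential_clocks xi,
      forall t x c, 0 <= t -> measurable [set w | eta t w x = c] &
      {ae P, forall w, tasep_trajectory e0 (rings xi w) (fun t => eta t w)}].

Definition leader_type (e : config) (c : int) : Prop :=
  exists x : int, e x = Some c /\ forall y, x < y -> e y = None.

Definition leader_change {R : realType} (e : R -> config) (s : R) : Prop :=
  exists c c' : int, [/\ c != c',
    \forall u \near s^'-, leader_type (e u) c & leader_type (e s) c'].

(* Extended-real valued: +oo if there are infinitely many changes. *)
Definition num_leader_changes {R : realType} (e : R -> config) (t : R) :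
    \bar R :=
  counting [set s : R | 0 < s <= t /\ leader_change e s].

(* Main.v *)
(* The rightmost site of type at least k moves right exactly when its edge rings.
   A particle of type c becomes the leader when, of the three walkers attached
   in this way to the types c + 1, c and 0, started at - c - 1, - c and 0, the
   middle one meets the front one before the rear one meets the middle one; this
   happens at most once.  A word w in the jumps of the walkers, as long as it
   keeps them apart, is realised at a time sigma_w with
   E exp(- mu sigma_w) = (3 + mu)^(- |w|).  Let L(mu) be the sum over c of the
   probability that the walk of the two gaps between the walkers, started at
   (1, c) and killed at rate mu, ends with the middle and front walkers meeting.
   Then the expected number N(t) of changes of leader satisfies
     N(t) <= exp(mu t) L(mu)  and  L(mu) <= N(t) + exp(- (mu - nu) t) L(nu).
   The gaps walk on the triangular lattice in a wedge of angle pi/3; without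
   killing the probability is, up to a summable error, 3/pi times the angle of
   the point (1, c), that is 3 sqrt 3 / (2 pi c).  The killing acts as a cut-off
   at c of order mu^(-1/2), so that L(mu) grows like
   3 sqrt 3 / (4 pi) ln(1/mu); take mu = t^(-1 + o(1)). *)

Require Import Defs.
From HB Require Import structures.
From mathcomp Require Import all_boot all_order all_algebra.
From mathcomp Require Import all_classical all_reals all_analysis.
From mathcomp Require Import measurable_realfun ring lra zify.

Set Implicit Arguments.
Unset Strict Implicit.
Unset Printing Implicit Defensive.

Import Order.TTheory GRing.Theory Num.Theory.
Import numFieldNormedType.Exports.
Local Open Scope classical_set_scope.
Local Open Scope ring_scope.

(** * The harmonic angle of a wedge *)

(** Two exact computations are avoided. No discrete harmonic function is built: the angle is
    superharmonic for the walk, with a defect of order |z|^-3, and subtracting a multiple of a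
    function of order 1/|z| makes it subharmonic. That function is O(c^-2) at the start (1, c),
    hence the summable error. Nor is the law of sigma_w inverted from its Laplace transform: a
    logarithm varies so slowly that transforms at two rates of the form t^(-1 + o(1)) enclose the
    mean.

    The clocks are given by their waiting times, with no filtration and no Markov property at hand.
    Lack of memory is therefore used one waiting time at a time: later rings of one edge are erased,
    the waiting time under way is integrated with all the others fixed, and the transforms come out
    as the solution of a linear system.

    The configuration is infinite. Statements on the rightmost site of a kind are reduced to a
    finite window closed on the right by an edge that has not rung, and there they follow by
    continuous induction in time. *)

Ltac ge0_tac := repeat match goal with
  | h : is_true (0 <= ?x) |- is_true (0 <= ?x) => exact: h
  | |- is_true (0 <= _ + _) => apply: addr_ge0
  | |- is_true (0 <= _ * _) => apply: mulr_ge0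
  | |- is_true (0 <= _ ^+ _) => apply: sqr_ge0
  end; by [assumption | exact: ler0n | exact: ler01].

Section angle.
Variable R : realType.
Implicit Types a b c p x : R.

Let r3 : R := Num.sqrt 3.
Let r3_sq : r3 * r3 = 3.
Proof. by rewrite -expr2 sqr_sqrtr. Qed.
Let r3_gt0 : 0 < r3. Proof. by rewrite sqrtr_gt0. Qed.

(** The condition makes [cos (atan x + atan y)], which is [cos (atan x) * cos (atan y) * (1 - x *
    y)], positive, so that the sum stays in the interval where [atan] inverts [tan]. *)
Lemma atanD x y : x * y < 1 -> atan x + atan y = atan ((x + y) / (1 - x * y)).
Proof.
move=> xy1.
have cx : 0 < cos (atan x) by rewrite cos_gt0_pihalf// atan_gtNpi2 atan_ltpi2.
have cy : 0 < cos (atan y) by rewrite cos_gt0_pihalf// atan_gtNpi2 atan_ltpi2.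
have cxy : 0 < cos (atan x + atan y).
  have -> : cos (atan x + atan y) = cos (atan x) * cos (atan y) * (1 - x * y).
    rewrite cosD -{4}(atanK x) -{4}(atanK y) /tan.
    by field; rewrite !gt_eqF.
  by rewrite !mulr_gt0// subr_gt0.
have := atan_gtNpi2 x; have := atan_gtNpi2 y.
have := atan_ltpi2 x; have := atan_ltpi2 y => hy hx hy' hx'.
rewrite -[RHS](_ : atan (tan (atan x + atan y)) = _).
  rewrite tanK// in_itv/=; apply/andP; split; rewrite ltNge; apply/negP => h.
    suff : 0 <= - cos (atan x + atan y) by rewrite oppr_ge0 leNgt cxy.
    rewrite -cosDpi -cosN.
    have -> : - (atan x + atan y + pi) = - (atan x + atan y) - pi by ring.
    by rewrite cos_ge0_pihalf//; apply/andP; split; lra.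
  suff : 0 <= - cos (atan x + atan y) by rewrite oppr_ge0 leNgt cxy.
  rewrite -cosDpi -(cosN (_ + pi)) -cosD2pi mulr2n.
  have -> : - (atan x + atan y + pi) + (pi + pi) = pi - (atan x + atan y) by ring.
  by rewrite cos_ge0_pihalf//; apply/andP; split; lra.
by rewrite tanD ?gt_eqF// !atanK.
Qed.

(** Arguments add when [c + p sqrt(-3)] and [c' + p' sqrt(-3)] are multiplied. The positive factor
    [k] is dropped from the product, which leaves [d + q sqrt(-3)]. *)
Lemma atan_sqrt3D k p p' q c c' d : 0 < c -> 0 < c' -> 0 < d -> 0 < k ->
  p * c' + p' * c = k * q -> c * c' - 3 * p * p' = k * d ->
  atan (r3 * p / c) + atan (r3 * p' / c') = atan (r3 * q / d).
Proof.
move=> c0 c'0 d0 k0 hq hd.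
have kd0 : 0 < k * d by rewrite mulr_gt0.
have E : (r3 * p / c) * (r3 * p' / c') = 3 * p * p' / (c * c').
  by rewrite -r3_sq; field; rewrite !gt_eqF.
rewrite atanD E; last by rewrite ltr_pdivrMr ?mulr_gt0// mul1r; lra.
congr atan; apply: (@etrans _ _ (r3 * (k * q) / (k * d))).
  by rewrite -hq -hd; field; rewrite -?hd !gt_eqF//= hd.
by field; rewrite !gt_eqF.
Qed.

(** The argument of z = b + a e^(i pi/3), the point of the triangular lattice that represents the
    gaps (a, b); it is 0 on the side a = 0 and pi/3 on the side b = 0. *)
Definition wedge_angle a b : R := atan (r3 * a / (a + 2 * b)).

(* In terms of a - 1 and b - 1 almost all coefficients are nonnegative. *)
Lemma wedge_cube_bounds a b : 1 <= a -> 1 <= b ->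
  let N := a ^+ 2 + a * b + b ^+ 2 in
  let x := 2 * b ^+ 3 + 3 * a * b ^+ 2 - 3 * a ^+ 2 * b - 2 * a ^+ 3 in
  [/\ - N ^+ 3 <= x, x <= N ^+ 3 &
      N ^+ 3 <= 8 * (2 * N ^+ 3 + (4 * N - 1) * x + 7 * N - 4)].
Proof.
move=> a1 b1.
have [p [q [-> -> p0 q0]]] : exists p q : R, [/\ a = 1 + p, b = 1 + q, 0 <= p & 0 <= q].
  by exists (a - 1), (b - 1); split; [ring|ring|lra|lra].
(* For z = b + a e^(i pi/3), [N] is |z|^2 and [x] is 2 Re z^3. *)
move=> N x; split; rewrite -subr_ge0.
- rewrite [leRHS](_ : _ = ((27 + q * (90 + q * (117 + q * (83 + q * (36 +
      q * (9 + q * 1)))))) + p * ((72 + q * (189 + q * (192 + q * (99 +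
      q * (27 + q * 3))))) + p * ((99 + q * (186 + q * (135 + q * (45 + q * 6)))) +
      p * ((79 + q * (99 + q * (45 + q * 7))) + p * ((36 + q * (27 + q * 6)) +
      p * ((9 + q * 3) + p * 1)))))));
    last by rewrite /N /x; ring.
  ge0_tac.
- rewrite [leRHS](_ : _ = ((27 + q * (72 + q * (99 + q * (79 + q * (36 +
      q * (9 + q * 1)))))) + p * ((90 + q * (189 + q * (186 + q * (99 +
      q * (27 + q * 3))))) + p * ((117 + q * (192 + q * (135 + q * (45 + q * 6)))) +
      p * ((83 + q * (99 + q * (45 + q * 7))) + p * ((36 + q * (27 + q * 6)) +
      p * ((9 + q * 3) + p * 1)))))));
    last by rewrite /N /x; ring.
  ge0_tac.
rewrite [leRHS](_ : _ = ((541 + q * (2175 + q * (3332 + q * (2543 + q * (1020 +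
    q * (199 + q * 15)))))) + p * ((60 * p * (p - 1) ^+ 2 + (7 * p ^+ 2 - 40 * p + 591) +
    q * (2891 + q * (3963 + q * (2253 + q * (565 + q * 45))))) +
    p * (q * (1707 + q * (2025 + q * (739 + q * 90))) +
    p * (q * (717 + q * (611 + q * 105)) + p * (q * (245 + q * 90) +
    p * ((71 + q * 45) + p * 15)))))));
  last by rewrite /N /x; ring.
(* The only negative coefficient of the expansion is that of p^3. It is absorbed by the square in
   [60 * p * (p - 1) ^+ 2], at the price of this quadratic, whose discriminant is negative. *)
have h : 0 <= 7 * p ^+ 2 - 40 * p + 591 by nra.
ge0_tac.
Qed.

(* With z = b + a e^(i pi/3), the angle is arg z and the three steps add the
   cube roots of unity to z, so that the increments of the angle sum to
   arg (prod_(w^3 = 1) (z + w) / z^3) = arg (1 + z^-3). *)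
Lemma wedge_angle_defect a b : 1 <= a -> 1 <= b ->
  wedge_angle (a - 1) b + wedge_angle (a + 1) (b - 1) + wedge_angle a (b + 1) =
  3 * wedge_angle a b
  - atan (r3 * (3 * (a * b * (a + b))) /
      (2 * (a ^+ 2 + a * b + b ^+ 2) ^+ 3 +
       (2 * b ^+ 3 + 3 * a * b ^+ 2 - 3 * a ^+ 2 * b - 2 * a ^+ 3))).
Proof.
move=> a1 b1; rewrite /wedge_angle.
set N := a ^+ 2 + a * b + b ^+ 2; set x2 := 2 * b ^+ 3 + _ - _ - _.
have Na : a * 2 + 1 <= N by rewrite /N; nra.
have Nb : b * 2 + 1 <= N by rewrite /N; nra.
(* The increment of the angle from z to a neighbour z' is the argument of 2 z' conj(z), and [2 * N]
   is the factor 2 |z|^2 that appears on multiplying by z again. *)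
have e0 : atan (r3 * (a - 1) / (a - 1 + 2 * b)) =
    atan (r3 * a / (a + 2 * b)) + atan (r3 * (- b) / (2 * N - 2 * a - b)).
  by rewrite (@atan_sqrt3D (2 * N) a (- b) (a - 1) _ _ (a - 1 + 2 * b));
    [|lra|lra|lra|lra|rewrite /N; ring|rewrite /N; ring].
have e1 : atan (r3 * (a + 1) / (a + 1 + 2 * (b - 1))) =
    atan (r3 * a / (a + 2 * b)) + atan (r3 * (a + b) / (2 * N + a - b)).
  by rewrite (@atan_sqrt3D (2 * N) a (a + b) (a + 1) _ _ (a + 1 + 2 * (b - 1)));
    [|lra|lra|lra|lra|rewrite /N; ring|rewrite /N; ring].
have e2 : atan (r3 * a / (a + 2 * (b + 1))) =
    atan (r3 * a / (a + 2 * b)) + atan (r3 * (- a) / (2 * N + a + 2 * b)).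
  by rewrite (@atan_sqrt3D (2 * N) a (- a) a _ _ (a + 2 * (b + 1)));
    [|lra|lra|lra|lra|rewrite /N; ring|rewrite /N; ring].
have d02 : 0 < (2 * N - 2 * a - b) * (2 * N + a + 2 * b) - 3 * (- b) * (- a).
  rewrite /N.
  have [p [q [-> -> p0 q0]]] : exists p q : R, [/\ a = 1 + p, b = 1 + q, 0 <= p & 0 <= q].
    by exists (a - 1), (b - 1); split; [ring|ring|lra|lra].
  rewrite [ltRHS](_ : _ = ((24 + q * (66 + q * (64 + q * (26 + q * 4)))) +
      p * ((54 + q * (88 + q * (48 + q * 8))) + p * ((52 + q * (48 + q * 12)) +
      p * ((22 + q * 8) + p * 4)))));
    last by ring.
  by apply: ltr_wpDr; [ge0_tac|apply: ltr_wpDr; [ge0_tac|rewrite ltr0n]].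
have d3 : 0 < 2 * N ^+ 3 + x2.
  have [h _ _] := wedge_cube_bounds a1 b1.
  have : 0 < N ^+ 3 by rewrite exprn_gt0//; lra.
  by move: h; rewrite -/N -/x2; lra.
rewrite e0 e1 e2.
(* The two negative increments are added first: by [d02] their product has positive real part, and
   by [d3] so has the product of all three, so that no addition leaves the principal branch. *)
have -> : forall t u v w : R, t + u + (t + v) + (t + w) = 3 * t + (u + w + v).
  by move=> *; ring.
congr (_ + _).
transitivity (atan (r3 * - (3 * (a * b * (a + b))) / (2 * N ^+ 3 + x2))); last first.
  by rewrite mulrN mulNr atanN.
rewrite (@atan_sqrt3D 1 _ _ (- b * (2 * N + a + 2 * b) + - a * (2 * N - 2 * a - b))
   _ _ ((2 * N - 2 * a - b) * (2 * N + a + 2 * b) - 3 * (- b) * (- a)));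
  [|lra|lra|lra|lra|ring|ring].
rewrite (@atan_sqrt3D 4 _ _ (- (3 * (a * b * (a + b))))
   _ _ (2 * N ^+ 3 + x2)); [by []|lra|lra|lra|lra| |].
  by rewrite /N; ring.
by rewrite /N /x2; ring.
Qed.

Lemma wedge_angle_superharmonic a b : 1 <= a -> 1 <= b ->
  wedge_angle (a - 1) b + wedge_angle (a + 1) (b - 1) + wedge_angle a (b + 1)
  <= 3 * wedge_angle a b.
Proof.
move=> a1 b1; rewrite wedge_angle_defect// gerBl -atan0 le_atan//.
have [h _ _] := wedge_cube_bounds a1 b1.
have : 0 < (a ^+ 2 + a * b + b ^+ 2) ^+ 3 by rewrite exprn_gt0//; nra.
move=> ?; apply: divr_ge0; last by lra.
by rewrite mulr_ge0 ?(ltW r3_gt0)// !mulr_ge0//; lra.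
Qed.

Lemma atan_bounds x : 0 <= x -> x / (1 + x ^+ 2) <= atan x <= x.
Proof.
move=> x0.
have datan z : z \in `]0, x[ -> is_derive z 1 atan (1 + z ^+ 2)^-1.
  by move=> _; exact: is_derive1_atan.
have catan : {within `[0, x], continuous atan}.
  by apply: derivable_within_continuous => z _; exact: ex_derive.
have [c] := MVT_segment x0 datan catan.
rewrite in_itv/= atan0 !subr0 => /andP[c0 cx] ->.
have c21 : 1 <= 1 + c ^+ 2 by rewrite lerDl sqr_ge0.
apply/andP; split.
  rewrite mulrC ler_wpM2r// lef_pV2 ?posrE ?ltr_wpDr ?sqr_ge0//.
  by rewrite lerD2l lerXn2r// nnegrE.
by rewrite ler_piMl// invf_le1// (lt_le_trans ltr01).
Qed.

(** For u = atan (1 / sqrt 3), doubling gives atan (sqrt 3) = 2 u and complementing gives atan (sqrt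
    3) = pi/2 - u. *)
Lemma atan_sqrt3 : atan r3 = pi / 3.
Proof.
have E : atan (r3 / 3) + atan (r3 / 3) = atan r3.
  have := @atan_sqrt3D 6 1 1 1 3 3 1; rewrite !mulr1 divr1.
  by apply; rewrite ?ltr0n//; ring.
set u := atan (r3 / 3) in E.
have u0 : 0 < u by rewrite /u -(@atan0 R) lt_atan// divr_gt0.
have u1 : u < pi / 2 by exact: atan_ltpi2.
have : atan r3 = pi / 2 - u.
  rewrite -[RHS](@tanK R); last by rewrite in_itv/=; apply/andP; split; lra.
  congr atan; rewrite /tan -opprB sinN cosN sinBpihalf cosBpihalf opprK.
  have -> : cos u / sin u = (tan u)^-1 by rewrite /tan invf_div.
  rewrite /u atanK invf_div -r3_sq mulfK// gt_eqF//.
have := pi_gt0 R; lra.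
Qed.

Lemma wedge_angle0r a : 0 < a -> wedge_angle a 0 = pi / 3.
Proof.
by move=> a0; rewrite /wedge_angle mulr0 addr0 mulfK ?gt_eqF// atan_sqrt3.
Qed.

Lemma wedge_angle0l b : wedge_angle 0 b = 0.
Proof. by rewrite /wedge_angle mulr0 mul0r atan0. Qed.

(** The walk of the gaps starts at (1, c). The main term sums to a logarithm, and the two bounds
    differ by a summable amount. *)
Lemma wedge_angle1_bounds b : 1 <= b ->
  r3 / (2 * b) - r3 / (2 * b ^+ 2) <= wedge_angle 1 b <= r3 / (2 * b).
Proof.
move=> b1; rewrite /wedge_angle mulr1.
have u0 : 0 <= r3 / (1 + 2 * b) by rewrite divr_ge0// ?(ltW r3_gt0)//; lra.
have /andP[lo hi] := atan_bounds u0; apply/andP; split.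
  apply: le_trans lo.
  have -> : r3 / (1 + 2 * b) / (1 + (r3 / (1 + 2 * b)) ^+ 2) =
      r3 * ((1 + 2 * b) / ((1 + 2 * b) ^+ 2 + 3)).
    rewrite -r3_sq; field; do ?[apply/andP; split]; rewrite gt_eqF//; nra.
  have -> : r3 / (2 * b) - r3 / (2 * b ^+ 2) = r3 * ((b - 1) / (2 * b ^+ 2)).
    by field; lra.
  rewrite ler_wpM2l// ?(ltW r3_gt0)// ler_pdivrMr; last nra.
  by rewrite mulrAC ler_pdivlMr; nra.
apply: (le_trans hi); rewrite ler_wpM2l ?(ltW r3_gt0)// lef_pV2 ?posrE; lra.
Qed.

(** A multiple of Im z^3 / |z|^4, that is of sin(3 theta) / r. It vanishes on both sides of the
    wedge, and its planar Laplacian is negative and proportional to sin(3 theta) / r^3, which is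
    also the leading shape of the defect of the angle. *)
Definition wedge_bump a b : R := a * b * (a + b) / (a ^+ 2 + a * b + b ^+ 2) ^+ 2.

Lemma wedge_bump_superharmonic a b : 1 <= a -> 1 <= b ->
  a * b * (a + b) / (a ^+ 2 + a * b + b ^+ 2) ^+ 3 <=
  24 * (3 * wedge_bump a b -
    (wedge_bump (a - 1) b + wedge_bump (a + 1) (b - 1) + wedge_bump a (b + 1))).
Proof.
move=> a1 b1; have [] := wedge_cube_bounds a1 b1; rewrite /wedge_bump.
set N := a ^+ 2 + a * b + b ^+ 2; set x := 2 * b ^+ 3 + _ - _ - _ => xN Nx B.
have N3 : 3 <= N by rewrite /N; nra.
have Ngt0 : 0 < N by lra.
set h := a * b * (a + b).
have h0 : 0 < h by rewrite !mulr_gt0; lra.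
set N0 := (a - 1) ^+ 2 + _ + _; set N1 := (a + 1) ^+ 2 + _ + _.
set N2 := a ^+ 2 + a * (b + 1) + _.
have N00 : 0 < N0 by rewrite /N0; nra.
have N10 : 0 < N1 by rewrite /N1; nra.
have N20 : 0 < N2 by rewrite /N2; nra.
(* The neighbours of z are the points z + w with w^3 = 1, so the product of their squared moduli is
   |z^3 + 1|^2. *)
pose M := N ^+ 3 + x + 1.
have ME : M = N0 * N1 * N2 by rewrite /M /N0 /N1 /N2 /N /x; ring.
have M0 : 0 < M by rewrite ME !mulr_gt0.
pose B2 := 2 * N ^+ 5 + (4 * N - 1) * N ^+ 2 * x + N ^+ 2 * (8 * N - 4) + x ^+ 2 - N ^+ 3
  + 2 * x + 1.
rewrite [X in _ <= 24 * X](_ : _ = 3 * h * B2 / (N ^+ 2 * M ^+ 2)); last first.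
  rewrite [X in _ - X](_ : _ = ((a - 1) * b * (a - 1 + b) * (N1 * N2) ^+ 2 +
     (a + 1) * (b - 1) * (a + 1 + (b - 1)) * (N0 * N2) ^+ 2 +
     a * (b + 1) * (a + (b + 1)) * (N0 * N1) ^+ 2) / M ^+ 2); last first.
    by rewrite ME; field; rewrite !gt_eqF.
  rewrite mulrA -mulNr addf_div ?expf_neq0 ?gt_eqF//.
  congr (_ / _).
  by rewrite /B2 /M /h /x /N0 /N1 /N2 /N; ring.
have B2N : N ^+ 5 <= 8 * B2.
  have -> : 8 * B2 = N ^+ 2 * (8 * (2 * N ^+ 3 + (4 * N - 1) * x + 7 * N - 4)) + 8 * (x + 1) ^+ 2.
    by rewrite /B2; ring.
  rewrite -[leLHS]addr0; apply: lerD; last by apply: mulr_ge0; rewrite ?sqr_ge0.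
  by rewrite (_ : N ^+ 5 = N ^+ 2 * N ^+ 3) ?ler_wpM2l ?sqr_ge0// -exprD.
have MN : M ^+ 2 <= 9 * N ^+ 6.
  rewrite (_ : 9 * N ^+ 6 = (3 * N ^+ 3) ^+ 2); last by ring.
  have N31 : 1 <= N ^+ 3 by rewrite exprn_ege1//; lra.
  by apply: lerXn2r; rewrite ?nnegrE ?(ltW M0)// /M; lra.
have Np k : 0 < N ^+ k by rewrite exprn_gt0//; lra.
rewrite mulrA ler_pdivrMr// mulrAC ler_pdivlMr ?mulr_gt0 ?exprn_gt0//.
have -> : 24 * (3 * h * B2) * N ^+ 3 = h * (N ^+ 3 * 9 * (8 * B2)) by ring.
rewrite ler_wpM2l//; first lra.
apply: (@le_trans _ _ (N ^+ 3 * 9 * N ^+ 5)); last first.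
  by rewrite ler_wpM2l// mulr_ge0// ltW.
rewrite (_ : N ^+ 3 * 9 * N ^+ 5 = N ^+ 2 * (9 * N ^+ 6)); last by ring.
by rewrite ler_wpM2l// ltW.
Qed.

Lemma wedge_bump_ge0 a b : 0 <= a -> 0 <= b -> 0 <= wedge_bump a b.
Proof.
by move=> a0 b0; rewrite /wedge_bump divr_ge0 ?sqr_ge0// !mulr_ge0// addr_ge0.
Qed.

Lemma wedge_bump1_le b : 1 <= b -> wedge_bump 1 b <= (b ^+ 2)^-1.
Proof.
move=> b1; rewrite /wedge_bump -[leRHS]div1r ler_pdivrMr; last by rewrite exprn_gt0//; nra.
rewrite [leRHS]mulrAC ler_pdivlMr; last by nra.
rewrite (_ : 1 * b * (1 + b) * b ^+ 2 = b ^+ 3 + b ^+ 4); last by ring.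
rewrite -subr_ge0 (_ : _ - _ = 1 + 2 * b + 3 * b ^+ 2 + b ^+ 3); last by ring.
by rewrite !addr_ge0 ?mulr_ge0 ?exprn_ge0//; lra.
Qed.

(* The bump compensates the defect, at a cost summable along a = 1. *)
Lemma wedge_angle_bump_subharmonic a b : 1 <= a -> 1 <= b ->
  let f a b := wedge_angle a b - 72 * r3 * wedge_bump a b in
  3 * f a b <= f (a - 1) b + f (a + 1) (b - 1) + f a (b + 1).
Proof.
move=> a1 b1; rewrite /=.
have E := wedge_angle_defect a1 b1.
have B := wedge_bump_superharmonic a1 b1.
have [xN _ _] := wedge_cube_bounds a1 b1.
move: E B xN; set N := a ^+ 2 + a * b + b ^+ 2; set x := 2 * b ^+ 3 + _ - _ - _.
have N0 : 0 < N ^+ 3 by rewrite exprn_gt0// /N; nra.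
set h := a * b * (a + b).
have h0 : 0 <= h by rewrite /h !mulr_ge0//; lra.
move=> E B xN.
have d0 : 0 <= r3 * (3 * h) / (2 * N ^+ 3 + x).
  by apply: divr_ge0; [apply: mulr_ge0; [exact: ltW|exact: mulr_ge0]|lra].
have /andP[_ D] := atan_bounds d0.
(* Since [x] is at least [- N ^+ 3], the denominator is at least [N ^+ 3]. The factor 3 here and the
   24 of [wedge_bump_superharmonic] make up the 72. *)
have D2 : r3 * (3 * h) / (2 * N ^+ 3 + x) <= 3 * r3 * (h / N ^+ 3).
  have -> : 3 * r3 * (h / N ^+ 3) = r3 * (3 * h) / N ^+ 3.
    by rewrite mulrA; congr (_ / _); ring.
  apply: ler_wpM2l; first by apply: mulr_ge0; [exact: ltW|exact: mulr_ge0].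
  rewrite lef_pV2 ?posrE; lra.
have D3 : 3 * r3 * (h / N ^+ 3) <= 3 * r3 * (24 * (3 * wedge_bump a b -
    (wedge_bump (a - 1) b + wedge_bump (a + 1) (b - 1) + wedge_bump a (b + 1)))).
  by apply: ler_wpM2l => //; apply: mulr_ge0 => //; exact: ltW.
move: E D D2 D3; lra.
Qed.

End angle.

(** * Three walkers *)

Inductive walker := Rear | Mid | Front.

Definition walker_eqb i j :=
  match i, j with Rear, Rear | Mid, Mid | Front, Front => true | _, _ => false end.
Lemma walker_eqbP : Equality.axiom walker_eqb.
Proof. by case; case; constructor. Qed.
HB.instance Definition _ := hasDecEq.Build walker walker_eqbP.

(* A word lists the walkers that jumped, the latest jump first. *)
Fixpoint position (c : nat) (w : seq walker) (i : walker) : int :=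
  match w with
  | [::] => match i with Rear => - c.+1%:Z | Mid => - c%:Z | Front => 0 end
  | j :: w' => position c w' i + (i == j)%:Z
  end.

Definition rear_gap c w : int := position c w Mid - position c w Rear.
Definition front_gap c w : int := position c w Front - position c w Mid.
Definition separated c w := (0 < rear_gap c w) && (0 < front_gap c w).

Definition extensions (s : seq (seq walker)) :=
  [seq i :: w | w <- s, i <- [:: Rear; Mid; Front]].

Fixpoint separated_words c n : seq (seq walker) :=
  if n is n'.+1 then
    [seq w <- extensions (separated_words c n') | separated c w]
  else [:: [::]].

(** Words after which one more jump of [Mid] closes the front gap: the meeting itself is the word
    [Mid :: w], of length [n.+1], which is the exponent in [meeting_weight]. *)
Definition meeting_words c n :=
  [seq w <- separated_words c n | front_gap c w == 1].

Lemma rear_gap_cons c i w : rear_gap c (i :: w) = rear_gap c w +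
  match i with Rear => -1 | Mid => 1 | Front => 0 end.
Proof. by rewrite /rear_gap; case: i; rewrite /= /eq_op /=; ring. Qed.

Lemma front_gap_cons c i w : front_gap c (i :: w) = front_gap c w +
  match i with Rear => 0 | Mid => -1 | Front => 1 end.
Proof. by rewrite /front_gap; case: i; rewrite /= /eq_op /=; ring. Qed.

Lemma gaps_nil c : (rear_gap c [::] = 1) * (front_gap c [::] = c%:Z).
Proof.
rewrite /rear_gap /front_gap /=; split; last by rewrite sub0r opprK.
by rewrite opprK intS addrCA addNr addr0.
Qed.

Lemma separated_words_separated c n w : (0 < c)%N ->
  w \in separated_words c n -> separated c w.
Proof.
move=> c0; case: n => [|n]; last by rewrite mem_filter => /andP[].
by rewrite inE => /eqP->; rewrite /separated !gaps_nil.
Qed.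

Lemma size_separated_words c n : (size (separated_words c n) <= 3 ^ n)%N.
Proof.
elim: n => [//|n ih] /=; rewrite size_filter (leq_trans (count_size _ _))//.
by rewrite size_allpairs/= mulnC expnS leq_mul2l.
Qed.

Lemma sum_separated_wordsS (R : realType) c n (F : seq walker -> R) :
  \sum_(w <- separated_words c n.+1) F w = \sum_(w <- separated_words c n)
    ((if separated c (Rear :: w) then F (Rear :: w) else 0) +
     (if separated c (Mid :: w) then F (Mid :: w) else 0) +
     (if separated c (Front :: w) then F (Front :: w) else 0)).
Proof.
rewrite /= big_filter big_mkcond big_allpairs_dep; apply: eq_bigr => w _.
by rewrite !big_cons big_nil /= addr0 addrA.
Qed.

(** * Sub- and superharmonic functions of the killed walk of the gaps *)

Section potential.
Variables (R : realType) (c : nat) (rho : R) (phi : R -> R -> R).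
Hypotheses (c0 : (0 < c)%N) (rho0 : 0 < rho).

Let phi_word w := phi (rear_gap c w)%:~R (front_gap c w)%:~R.
Let mass n := rho ^+ n * \sum_(w <- separated_words c n) phi_word w.

Definition meeting_weight n : R := rho ^+ n.+1 * (size (meeting_words c n))%:R.

Let separated_ge1 w : separated c w ->
  (1 <= (rear_gap c w)%:~R :> R) && (1 <= (front_gap c w)%:~R :> R).
Proof. by rewrite !ler1z -!gtz0_ge1. Qed.

Let meeting_weightE n : meeting_weight n = rho ^+ n *
  \sum_(w <- separated_words c n) (if front_gap c w == 1 then rho else 0).
Proof.
rewrite /meeting_weight exprSr -mulrA -big_mkcond/= -big_filter; congr (_ * _).
by rewrite big_const_seq count_predT iter_addr_0 mulr_natr.
Qed.

Let cons_word w : (phi_word (Rear :: w) =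
    phi ((rear_gap c w)%:~R - 1) (front_gap c w)%:~R) *
  (phi_word (Mid :: w) =
    phi ((rear_gap c w)%:~R + 1) ((front_gap c w)%:~R - 1)) *
  (phi_word (Front :: w) = phi (rear_gap c w)%:~R ((front_gap c w)%:~R + 1)).
Proof.
by rewrite /phi_word !rear_gap_cons !front_gap_cons !addr0 !intrD !mulrN1z.
Qed.

Let separated_cons w : separated c w ->
  (separated c (Rear :: w) = (rear_gap c w != 1)) *
  (separated c (Mid :: w) = (front_gap c w != 1)) *
  (separated c (Front :: w) = true).
Proof.
rewrite /separated !rear_gap_cons !front_gap_cons !addr0 => /andP[a0 b0].
have gt1 (k : int) : 0 < k -> (0 < k - 1) = (k != 1).
  by move=> k0; rewrite subr_gt0 lt_neqAle eq_sym -gtz0_ge1 k0 andbT.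
by split; [split|]; rewrite ?gt1 ?b0 ?a0 ?andbT ?(addr_gt0 a0) ?(addr_gt0 b0).
Qed.

(* Optional stopping for the walk of the gaps, with weight [rho] per step: it
   stops with value at least 1 when Mid meets Front, and at least 0 when Rear
   meets Mid. *)
Lemma meeting_weight_le n :
  (forall a b, 1 <= a -> 1 <= b -> 0 <= phi a b) ->
  (forall a, 1 <= a -> 1 <= phi a 0) ->
  (forall b, 1 <= b -> 0 <= phi 0 b) ->
  (forall a b, 1 <= a -> 1 <= b ->
    rho * (phi (a - 1) b + phi (a + 1) (b - 1) + phi a (b + 1)) <= phi a b) ->
  \sum_(k < n) meeting_weight k <= phi 1 c%:R.
Proof.
move=> phi_ge0 phi_r0 phi_0l super.
suff : \sum_(k < n) meeting_weight k + mass n <= phi 1 c%:R.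
  apply: le_trans; rewrite lerDl mulr_ge0 ?exprn_ge0 ?(ltW rho0)//.
  rewrite big_seq sumr_ge0// => w /(separated_words_separated c0)/separated_ge1.
  by case/andP; exact: phi_ge0.
elim: n => [|n ih].
  rewrite big_ord0 add0r /mass expr0 mul1r big_seq1 /phi_word !gaps_nil.
  by rewrite mulr1z pmulrn.
rewrite big_ord_recr/= -addrA (le_trans _ ih)// lerD2l.
rewrite meeting_weightE /mass exprSr -mulrA -mulrDr.
rewrite ler_wpM2l ?exprn_ge0 ?(ltW rho0)// sum_separated_wordsS.
rewrite mulr_sumr -big_split/= 2!big_seq ler_sum// => w.
move=> /(separated_words_separated c0) sw.
have /andP[a1 b1] := separated_ge1 sw.
apply: le_trans (super _ _ a1 b1); rewrite !cons_word !(separated_cons sw).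
(* Four cases: the jump of [Rear] is discarded when the rear gap is 1, and the jump of [Mid] counts
   as a meeting, of value 1, when the front gap is 1. *)
have [->|_] /= := eqVneq (rear_gap c w) 1; have [->|_] /= := eqVneq (front_gap c w) 1;
  rewrite ?mulr1z ?subrr ?add0r ?addr0.
- have -> : rho + rho * phi 1 (1 + 1) = rho * (0 + 1 + phi 1 (1 + 1)) by ring.
  by rewrite ler_wpM2l ?(ltW rho0)// !lerD ?phi_0l ?phi_r0// lerDl.
- rewrite -addrA ler_wpM2l ?(ltW rho0)// lerDr.
  by rewrite phi_0l.
- rewrite [X in _ <= rho * (_ + X + _)](_ : _ = phi ((rear_gap c w)%:~R + 1) 0)//.
  rewrite -[X in X + _]mulr1 -mulrDr ler_wpM2l ?(ltW rho0)// addrA lerD2r.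
  by rewrite addrC lerD2l phi_r0// lerDr (le_trans _ a1).
- by [].
Qed.

(** The dual of [meeting_weight_le]. The words still running after [n] steps number at most 3^n and
    have potential at most 1, hence the remainder [(3 * rho) ^+ n]. *)
Lemma meeting_weight_ge n :
  (forall a b, 1 <= a -> 1 <= b -> phi a b <= 1) ->
  (forall a, 1 <= a -> phi a 0 <= 1) ->
  (forall b, 1 <= b -> phi 0 b <= 0) ->
  (forall a b, 1 <= a -> 1 <= b ->
    phi a b <= rho * (phi (a - 1) b + phi (a + 1) (b - 1) + phi a (b + 1))) ->
  phi 1 c%:R <= \sum_(k < n) meeting_weight k + (3 * rho) ^+ n.
Proof.
move=> phi_le1 phi_r0 phi_0l sub.
suff : phi 1 c%:R <= \sum_(k < n) meeting_weight k + mass n.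
  move=> /le_trans; apply; rewrite lerD2l exprMn mulrC ler_wpM2l ?exprn_ge0 ?(ltW rho0)//.
  apply: (@le_trans _ _ (\sum_(w <- separated_words c n) 1)).
    rewrite big_seq [leRHS]big_seq ler_sum// => w.
    move=> /(separated_words_separated c0)/separated_ge1/andP[a1 b1].
    exact: phi_le1.
  rewrite big_const_seq count_predT iter_addr_0 -natrX ler_nat.
  exact: size_separated_words.
elim: n => [|n ih].
  rewrite big_ord0 add0r /mass expr0 mul1r big_seq1 /phi_word !gaps_nil.
  by rewrite mulr1z pmulrn.
rewrite big_ord_recr/= -addrA (le_trans ih)// lerD2l.
rewrite meeting_weightE /mass exprSr -mulrA -mulrDr.
rewrite ler_wpM2l ?exprn_ge0 ?(ltW rho0)// sum_separated_wordsS.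
rewrite mulr_sumr -big_split/= 2!big_seq ler_sum// => w.
move=> /(separated_words_separated c0) sw.
have /andP[a1 b1] := separated_ge1 sw.
apply: le_trans (sub _ _ a1 b1) _; rewrite !cons_word !(separated_cons sw).
have [->|_] /= := eqVneq (rear_gap c w) 1; have [->|_] /= := eqVneq (front_gap c w) 1;
  rewrite ?mulr1z ?subrr ?add0r ?addr0.
- have -> : rho + rho * phi 1 (1 + 1) = rho * (0 + 1 + phi 1 (1 + 1)) by ring.
  by rewrite ler_wpM2l ?(ltW rho0)// !lerD ?phi_0l ?phi_r0// lerDl.
- rewrite -addrA ler_wpM2l ?(ltW rho0)// gerDr.
  by rewrite phi_0l.
- rewrite -[X in _ <= X + _]mulr1 -mulrDr ler_wpM2l ?(ltW rho0)// addrA lerD2r.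
  by rewrite [leRHS]addrC lerD2l phi_r0// lerDr (le_trans _ a1).
- by [].
Qed.
End potential.

(** * Explicit potentials for the killing rate s^2 *)

Section meeting_bounds.
Variables (R : realType) (s : R).
Hypotheses (s0 : 0 < s) (s1 : s < 1).

Let rho : R := (3 + s ^+ 2)^-1.
Let rho_gt0 : 0 < rho. Proof. by rewrite invr_gt0 ltr_wpDr ?sqr_ge0. Qed.
Let rho3 : 3 * rho < 1.
Proof. by rewrite /rho ltr_pdivrMr ?mul1r ?ltrDl ?exprn_gt0// ltr_wpDr ?sqr_ge0. Qed.

(** The coefficient of 1/c in 3/pi times the angle of (1, c). The limit of the theorem is half of
    it, because the cut-off in c is of the order of the square root of time. *)
Definition leader_rate : R := 3 * Num.sqrt 3 / (2 * pi).

Let pi0 : 0 < (pi : R). Proof. exact: pi_gt0. Qed.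

Let wedge_angle_ge0 (a b : R) : 0 <= a -> 0 <= b -> 0 <= wedge_angle a b.
Proof.
move=> a0 b0; rewrite /wedge_angle -(@atan0 R) le_atan// divr_ge0 ?mulr_ge0//.
by rewrite addr_ge0// mulr_ge0.
Qed.

Let kpi : 3 / pi * (pi / 3) = 1 :> R.
Proof. by rewrite mulrA divfK ?divff ?gt_eqF. Qed.

Lemma meeting_sum_le_rate c n : (0 < c)%N ->
  \sum_(k < n) meeting_weight c rho k <= leader_rate / c%:R.
Proof.
move=> c0; have c1 : 1 <= c%:R :> R by rewrite ler1n.
have k0 : 0 <= 3 / pi :> R by rewrite divr_ge0// ltW.
apply: le_trans (meeting_weight_le (phi := fun a b => 3 / pi * wedge_angle a b)
  c0 rho_gt0 n _ _ _ _) _.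
- by move=> a b a1 b1; rewrite mulr_ge0// wedge_angle_ge0//; lra.
- move=> a a1; rewrite wedge_angle0r; last lra.
  by rewrite kpi.
- by move=> b b1; rewrite mulr_ge0// wedge_angle_ge0//; lra.
- move=> a b a1 b1; rewrite -!mulrDr mulrCA ler_wpM2l//.
  apply: (@le_trans _ _ (rho * (3 * wedge_angle a b))).
    by rewrite ler_wpM2l ?(ltW rho_gt0)// wedge_angle_superharmonic.
  rewrite mulrA [rho * 3]mulrC ler_piMl ?(ltW rho3)// wedge_angle_ge0//; lra.
have /andP[_ h] := wedge_angle1_bounds c1.
apply: le_trans (ler_wpM2l k0 h) _; rewrite /leader_rate le_eqVlt; apply/orP; left.
by apply/eqP; move: (pi : R) pi0 => p p0; field; rewrite !gt_eqF//; lra.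
Qed.

(** The potential q^b depends on the front gap only. For q = 1 - s/2 one has (1 - q)^2 / q <= s^2,
    that is 1 + q + 1/q <= 3 + s^2, so it is superharmonic for the killed walk. This is the cut-off
    at c of order 1/s. *)
Lemma meeting_sum_le_geometric c n : (0 < c)%N ->
  \sum_(k < n) meeting_weight c rho k <= (1 - s / 2) ^+ c.
Proof.
move=> c0; pose q : R := 1 - s / 2; rewrite -/q.
have q0 : 0 < q by move: s1; rewrite /q; lra.
pose g (b : R) := expR (b * ln q).
have gS b : g (b + 1) = g b * q by rewrite /g mulrDl mul1r expRD lnK.
have gB b : g (b - 1) = g b / q.
  by rewrite /g mulrBl mul1r expRB lnK.
have g0 b : 0 < g b by exact: expR_gt0.
apply: le_trans (meeting_weight_le (phi := fun a b => g b) c0 rho_gt0 n _ _ _ _) _.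
- by move=> a b _ _; exact: ltW.
- by move=> a _; rewrite /g mul0r expR0.
- by move=> b _; exact: ltW.
- move=> a b _ _; rewrite gS gB mulrC ler_pdivrMr; last by rewrite ltr_wpDr ?sqr_ge0.
  have -> : g b + g b / q + g b * q = g b * (1 + q^-1 + q).
    by field; rewrite gt_eqF.
  rewrite ler_wpM2l ?(ltW (g0 b))//.
  have : q^-1 <= 2 - q + s ^+ 2.
    by move: s0 s1; rewrite -div1r ler_pdivrMr// /q; nra.
  lra.
by rewrite /g -[in leRHS](@lnK _ q)// -expRM_natl.
Qed.

(** Killing costs [s ^+ 2] times a potential that is at most 1. Subtracting 1 - q^a with q = 1 - s
    pays for it, since now (1 - q)^2 / q >= s^2; this correction vanishes on the side a = 0 and
    equals s at the start. In the error term, 73 bounds 72 + 1/2, from the bump and from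
    [wedge_angle1_bounds]. *)
Lemma meeting_sum_ge c n : (0 < c)%N ->
  leader_rate / c%:R - 3 / pi * (73 * Num.sqrt 3) / c%:R ^+ 2 - s <=
  \sum_(k < n) meeting_weight c rho k + (3 * rho) ^+ n.
Proof.
move=> c0; have c1 : 1 <= c%:R :> R by rewrite ler1n.
have k0 : 0 <= 3 / pi :> R by rewrite divr_ge0// ltW.
pose q : R := 1 - s.
have q0 : 0 < q by move: s1; rewrite /q; lra.
pose g (b : R) := expR (b * ln q).
have gS b : g (b + 1) = g b * q by rewrite /g mulrDl mul1r expRD lnK.
have gB b : g (b - 1) = g b / q.
  by rewrite /g mulrBl mul1r expRB lnK.
have g0 b : 0 < g b by exact: expR_gt0.
have g1 b : 0 <= b -> g b <= 1.
  move=> b0; rewrite /g expR_le1 mulr_ge0_le0//.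
  by rewrite ln_le0//; move: s0; rewrite /q; lra.
pose f (a b : R) := wedge_angle a b - 72 * Num.sqrt 3 * wedge_bump a b.
have fle a b : 0 < a -> 0 <= b -> 3 / pi * f a b <= 1.
  move=> a0 b0; rewrite -[leRHS]kpi ler_wpM2l//.
  apply: (@le_trans _ _ (wedge_angle a b)).
    rewrite gerBl; apply: mulr_ge0; first exact: mulr_ge0.
    by rewrite wedge_bump_ge0// ltW.
  rewrite -(wedge_angle0r a0) /wedge_angle le_atan// mulr0 addr0.
  rewrite ler_wpM2l ?mulr_ge0 ?(ltW a0)// lef_pV2 ?posrE; lra.
apply: le_trans (meeting_weight_ge
  (phi := fun a b => 3 / pi * f a b - (1 - g a)) c0 rho_gt0 n _ _ _ _).
- have -> : 1 - g 1 = s by rewrite /g mul1r lnK// /q; ring.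
  rewrite lerD2r.
  have /andP[h _] := wedge_angle1_bounds c1.
  have h2 := wedge_bump1_le c1.
  have h3 : 72 * Num.sqrt 3 * wedge_bump 1 c%:R <= 72 * Num.sqrt 3 * (c%:R ^+ 2)^-1 :> R.
    by rewrite ler_wpM2l// mulr_ge0.
  have h4 : 0 <= Num.sqrt 3 / (2 * c%:R ^+ 2) :> R by rewrite divr_ge0// mulr_ge0// sqr_ge0.
  apply: le_trans (ler_wpM2l k0 (lerB h h3)).
  have -> : leader_rate / c%:R = 3 / pi * (Num.sqrt 3 / (2 * c%:R)).
    rewrite /leader_rate; move: (pi : R) pi0 => p p0.
    by field; rewrite !gt_eqF//; lra.
  rewrite -[X in _ - X]mulrA -mulrBr ler_wpM2l// -addrA lerD2l -opprD lerN2.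
  have -> : Num.sqrt 3 / (2 * c%:R ^+ 2) = Num.sqrt 3 / c%:R ^+ 2 / 2 :> R.
    by field; lra.
  have : 0 <= Num.sqrt 3 / c%:R ^+ 2 :> R by rewrite divr_ge0 ?sqr_ge0.
  lra.
- move=> a b a1 b1; have := fle a b; have := g1 a; lra.
- move=> a a1; have := fle a 0; have := g1 a; lra.
- move=> b b1; rewrite /f wedge_angle0l /wedge_bump /g !mul0r expR0.
  by rewrite mulr0 subrr mulr0 subrr.
- move=> a b a1 b1; rewrite [leRHS]mulrC /rho ler_pdivlMr; last by rewrite ltr_wpDr ?sqr_ge0.
  have : 3 * f a b <= f (a - 1) b + f (a + 1) (b - 1) + f a (b + 1).
    exact: wedge_angle_bump_subharmonic.
  rewrite gS gB => /(ler_wpM2l k0) h.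
  have fl : 3 / pi * f a b <= 1 by apply: fle; lra.
  have qq : 2 - q + s ^+ 2 <= q^-1.
    by move: s0 s1; rewrite -[leRHS]div1r ler_pdivlMr// /q; nra.
  have gq : g a * (2 + s ^+ 2) <= g a / q + g a * q.
    rewrite -mulrDr ler_wpM2l ?(ltW (g0 a))//; lra.
  have s2 : s ^+ 2 * (3 / pi * f a b) <= s ^+ 2 by rewrite ler_piMr ?sqr_ge0.
  move: h gq s2; lra.
Qed.

End meeting_bounds.

(** * Logarithmic growth *)

Lemma harmonic_sum_le_ln (R : realType) (m : nat) :
  \sum_(k < m.+1) k.+1%:R^-1 <= 1 + ln m.+1%:R :> R.
Proof.
elim: m => [|m ih]; first by rewrite big_ord1 ln1 addr0 invr1.
rewrite big_ord_recr/= (le_trans (lerD ih (lexx _)))// -addrA lerD2l.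
have h0 : 0 < m.+1%:R / m.+2%:R :> R by rewrite divr_gt0.
have -> : ln m.+1%:R = ln m.+2%:R + ln (m.+1%:R / m.+2%:R) :> R.
  by rewrite ln_div ?posrE// addrC subrK.
rewrite -addrA gerDl -lerBDr sub0r.
have -> : m.+1%:R / m.+2%:R = 1 - m.+2%:R^-1 :> R.
  by rewrite -[m.+2]addn1 natrD; field; rewrite gt_eqF// ltr_wpDr.
rewrite le_ln1Dx// ltrN2 invf_lt1 ?ltr1n//.
Qed.

Lemma ln_le_harmonic_sum (R : realType) (m : nat) :
  ln m.+1%:R <= \sum_(k < m) k.+1%:R^-1 :> R.
Proof.
elim: m => [|m ih]; first by rewrite big_ord0 ln1.
rewrite big_ord_recr/= (le_trans _ (lerD ih (lexx _)))//.
have -> : ln m.+2%:R = ln m.+1%:R + ln (m.+2%:R / m.+1%:R) :> R.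
  by rewrite ln_div ?posrE// addrC subrK.
rewrite lerD2l.
have -> : m.+2%:R / m.+1%:R = 1 + m.+1%:R^-1 :> R.
  by rewrite -[m.+2]addn1 natrD mulrDl divff ?pnatr_eq0// mul1r.
by rewrite le_ln1Dx// (lt_le_trans (ltrN10 R)).
Qed.

Lemma inverse_square_sum_le2 (R : realType) (m : nat) :
  \sum_(k < m) (k.+1%:R ^+ 2)^-1 <= 2 :> R.
Proof.
suff h : \sum_(k < m.+1) (k.+1%:R ^+ 2)^-1 <= 2 - m.+1%:R^-1 :> R.
  move: h; rewrite big_ord_recr/=; set S := \sum_(k < m) _ => h.
  apply: le_trans (le_trans h _); last by rewrite gerBl invr_ge0.
  by rewrite lerDl invr_ge0 sqr_ge0.
elim: m => [|m ih].
  by rewrite big_ord1 expr1n invr1 -addrA subrr addr0.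
rewrite big_ord_recr/= (le_trans (lerD ih (lexx _)))// -addrA lerD2l.
rewrite -[m.+2]addn1 natrD; have : 1 <= m.+1%:R :> R by rewrite ler1n.
set x : R := m.+1%:R => x1.
rewrite addrC -lerBrDr opprK -subr_ge0.
have -> : - (x + 1)^-1 + x^-1 - ((x + 1) ^+ 2)^-1 = (x * (x + 1) ^+ 2)^-1.
  by field; apply/andP; split; rewrite gt_eqF//; lra.
by rewrite invr_ge0 mulr_ge0 ?sqr_ge0//; lra.
Qed.

Section meeting_series.
Variable R : realType.
Implicit Types (s : R) (c m n : nat).
Local Open Scope ereal_scope.

(** The parameter [s] is the square root of the killing rate, so that 1/s is the scale of the
    cut-off in the type. *)
Definition meeting_series c s : \bar R :=
  \sum_(0 <= n <oo) (meeting_weight c (3 + s ^+ 2)^-1 n)%:E.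

(** The sum starts at type 1, since type 0 leads from the beginning. *)
Definition total_meeting_series s : \bar R :=
  \sum_(0 <= c <oo) meeting_series c.+1 s.

Let K : R := 3 / pi * (73 * Num.sqrt 3).

Lemma meeting_weight_ge0 c (rho : R) n : (0 <= rho)%R -> (0 <= meeting_weight c rho n)%R.
Proof. by move=> rho0; rewrite mulr_ge0 ?exprn_ge0. Qed.

Let meeting_term_ge0 c s n : 0 <= (meeting_weight c (3 + s ^+ 2)^-1 n)%:E.
Proof.
by rewrite lee_fin meeting_weight_ge0// invr_ge0 addr_ge0// sqr_ge0.
Qed.

Lemma meeting_series_ge0 c s : 0 <= meeting_series c s.
Proof. by apply: nneseries_ge0 => n _ _. Qed.

Lemma total_meeting_series_ge0 s : 0 <= total_meeting_series s.
Proof. by apply: nneseries_ge0 => n _ _; exact: meeting_series_ge0. Qed.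

Lemma nneseries_le_partial (u : nat -> \bar R) (B : \bar R) : (forall n, 0 <= u n) ->
  (forall n, \sum_(0 <= k < n) u k <= B) -> \sum_(0 <= k <oo) u k <= B.
Proof.
move=> u0 h; apply: lime_le; first by apply: is_cvg_nneseries.
by apply: nearW => n; exact: h.
Qed.

Let meeting_series_le c s (B : R) :
  (forall n, \sum_(k < n) meeting_weight c (3 + s ^+ 2)^-1 k <= B)%R ->
  meeting_series c s <= B%:E.
Proof.
move=> h; apply: nneseries_le_partial => // n.
by rewrite sumEFin lee_fin big_mkord.
Qed.

Lemma meeting_series_ge c s : (0 < c)%N -> (0 < s < 1)%R ->
  (leader_rate R / c%:R - K / c%:R ^+ 2 - s)%:E <= meeting_series c s.
Proof.
move=> c0 /andP[s0 s1].
set a := (_ - _)%R.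
set r : R := (3 * (3 + s ^+ 2)^-1)%R.
have r1 : (`|r| < 1)%R.
  rewrite ger0_norm; last by rewrite mulr_ge0// invr_ge0 addr_ge0// sqr_ge0.
  by rewrite ltr_pdivrMr ?mul1r ?ltrDl ?exprn_gt0// ltr_wpDr ?sqr_ge0.
have lim : (fun n => (a - r ^+ n)%:E) @ \oo --> a%:E.
  apply: cvg_EFin; first exact: nearW.
  rewrite -[X in _ --> X]subr0; apply: cvgB; first exact: cvg_cst.
  exact: cvg_expr.
apply: (cvge_to_le lim); apply: nearW => n.
apply: (@le_trans _ _ (\sum_(0 <= k < n) (meeting_weight c (3 + s ^+ 2)^-1 k)%:E)).
  rewrite sumEFin lee_fin big_mkord lerBlDr.
  exact: meeting_sum_ge.
exact: nneseries_lim_ge.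
Qed.

(** The first [m.+1] types are bounded as if there were no killing, the others by the geometric
    cut-off; 2/s is the sum of the geometric series of ratio 1 - s/2. *)
Lemma total_meeting_series_le s m : (0 < s < 1)%R -> total_meeting_series s <=
  (leader_rate R * (1 + ln m.+1%:R) + (1 - s / 2) ^+ m.+1 * (2 / s))%:E.
Proof.
move=> /andP[s0 s1].
have rate0 : (0 <= leader_rate R)%R.
  by rewrite /leader_rate divr_ge0 ?mulr_ge0 ?sqrtr_ge0// pi_ge0.
set q : R := (1 - s / 2)%R.
have q0 : (0 < q)%R by rewrite /q; lra.
have q1 : (0 < 1 - q)%R by rewrite /q; lra.
rewrite /total_meeting_series (nneseries_split 0 m.+1)/=; last first.
  by move=> k _; exact: meeting_series_ge0.
rewrite add0n EFinD; apply: leeD.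
  apply: (@le_trans _ _ (\sum_(0 <= k < m.+1) (leader_rate R * k.+1%:R^-1)%:E)).
    apply: lee_sum => k _; apply: meeting_series_le => n.
    exact: meeting_sum_le_rate.
  rewrite sumEFin lee_fin big_mkord -mulr_sumr ler_wpM2l//.
  exact: harmonic_sum_le_ln.
rewrite -nneseries_addn; last by move=> k; exact: meeting_series_ge0.
apply: nneseries_le_partial => [n|n]; first exact: meeting_series_ge0.
apply: (@le_trans _ _ (\sum_(0 <= k < n) (q ^+ (k + m.+1))%:E)).
  apply: lee_sum => k _; apply: meeting_series_le => l.
  apply: le_trans (meeting_sum_le_geometric _ _ _ _) _ => //.
  by rewrite -/q exprS ler_piMl ?exprn_ge0 ?(ltW q0)//; lra.
rewrite sumEFin lee_fin big_mkord.
have -> : (2 / s = (1 - q)^-1)%R by rewrite /q; field; rewrite gt_eqF//; lra.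
rewrite ler_pdivlMr// mulrC; under eq_bigr do rewrite addnC exprD.
rewrite -mulr_sumr mulrCA -opprB mulNr -subrX1 opprB.
by rewrite ler_piMr ?exprn_ge0 ?(ltW q0)// gerBl exprn_ge0// ltW.
Qed.

Lemma total_meeting_series_ge s m : (0 < s < 1)%R ->
  (leader_rate R * ln m.+1%:R - 2 * K - m%:R * s)%:E <= total_meeting_series s.
Proof.
move=> s01; have /andP[s0 s1] := s01.
have rate0 : (0 <= leader_rate R)%R.
  by rewrite /leader_rate divr_ge0 ?mulr_ge0 ?sqrtr_ge0// pi_ge0.
have K0 : (0 <= K)%R.
  by rewrite /K !mulr_ge0 ?sqrtr_ge0 ?invr_ge0 ?pi_ge0.
apply: (@le_trans _ _ (\sum_(0 <= k < m) meeting_series k.+1 s)); last first.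
  by apply: nneseries_lim_ge => k _ _; exact: meeting_series_ge0.
apply: (@le_trans _ _ (\sum_(0 <= k < m)
    (leader_rate R / k.+1%:R - K / k.+1%:R ^+ 2 - s)%:E)); last first.
  by apply: lee_sum => k _; exact: meeting_series_ge.
rewrite sumEFin lee_fin big_mkord !sumrB -!mulr_sumr sumr_const card_ord.
rewrite -(mulr_natl s).
apply: lerB => //; apply: lerB.
  by rewrite ler_wpM2l// ln_le_harmonic_sum.
by rewrite [leRHS]mulrC ler_wpM2l// inverse_square_sum_le2.
Qed.

End meeting_series.

(** * From bounds at two killing rates to the logarithmic limit *)

Section growth.
Variable R : realType.
Implicit Types (s t y T : R).

Let C := leader_rate R.
Let K : R := 3 / pi * (73 * Num.sqrt 3).
Let C0 : 0 <= C.
Proof. by rewrite /C /leader_rate divr_ge0 ?mulr_ge0 ?sqrtr_ge0// pi_ge0. Qed.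
Let K0 : 0 <= K.
Proof. by rewrite /K !mulr_ge0 ?sqrtr_ge0 ?invr_ge0 ?pi_ge0. Qed.

Let expR_le1_1Dx (x : R) : 0 <= x -> expR (- x) <= (1 + x)^-1.
Proof.
move=> x0; rewrite expRN lef_pV2 ?posrE ?expR_gt0//; last by rewrite ltr_wpDr.
exact: expR_ge1Dx.
Qed.

Let expR_big y : 14 <= y -> 2 * y ^+ 2 + 2 * y <= expR y.
Proof.
move=> y14; apply: le_trans (expR_ge1Dxn 2 _); last lra.
rewrite (_ : 3`!%:R = 6)//; nra.
Qed.

(** The sum is cut at m of order exp(y^2 + 2 y), past the scale 1/s by a factor of at least exp(y).
    The tail factor is then at most exp(- exp(y) / 2), hence at most s, and it absorbs 2/s. From y =
    14 on, y^3 / 6 exceeds 2 y^2 + 2 y, which is what the tail needs. *)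
Lemma total_meeting_series_le_expR s y : 14 <= y ->
  expR (- (y ^+ 2 + y)) <= s -> s < 1 ->
  (total_meeting_series s <= (C * (y ^+ 2 + 2 * y + 2) + 2)%:E)%E.
Proof.
move=> y14 hs s1.
have s0 : 0 < s by rewrite (lt_le_trans _ hs)// expR_gt0.
pose x := expR (y ^+ 2 + 2 * y).
have x1 : 1 <= x by rewrite /x -[leLHS]expR0 ler_expR; nra.
pose m := Num.truncn x.
have /andP[mx xm] : m%:R <= x < m.+1%:R by rewrite truncn_itv// (le_trans ler01).
have s01 : 0 < s < 1 by rewrite s0 s1.
apply: le_trans (total_meeting_series_le m s01) _; rewrite lee_fin.
apply: lerD.
  rewrite ler_wpM2l//.
  have : ln m.+1%:R <= y ^+ 2 + 2 * y + 1.
    rewrite -[leRHS]expRK ler_ln ?posrE ?expR_gt0//.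
    rewrite -addn1 natrD expRD -/x.
    have : 2 <= expR 1 :> R by have := expR_ge1Dx (1 : R); lra.
    nra.
  lra.
have h1 : (1 - s / 2) ^+ m.+1 <= expR (- (y ^+ 2 + y)).
  apply: (@le_trans _ _ (expR (- (s / 2)) ^+ m.+1)).
    rewrite lerXn2r ?nnegrE ?expR_ge0//; first lra.
    by have := expR_ge1Dx (- (s / 2)).
  rewrite -expRM_natl ler_expR mulrN lerN2.
  have : expR y / 2 <= m.+1%:R * (s / 2).
    rewrite mulrA ler_wpM2r//.
    apply: (@le_trans _ _ (x * expR (- (y ^+ 2 + y)))).
      by rewrite /x -expRD ler_expR; lra.
    by rewrite ler_pM ?expR_ge0// ltW.
  have := expR_big y14; lra.
apply: (@le_trans _ _ (s * (2 / s))).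
  by rewrite ler_wpM2r ?divr_ge0 ?(ltW s0)// (le_trans h1).
by rewrite mulrCA divff ?mulr1// gt_eqF.
Qed.

(** Write T = exp(2 y^2), so that ln T = 2 y^2. Taking s = exp(- y^2 - y) for the upper bound and s
    = exp(- y^2 + y) for the lower one changes C ln(1/s) only by O(y), but multiplies s^2 T by exp(-
    2 y) or exp(2 y), which makes the exponential factors harmless. *)
Lemma log_growth (F : R -> \bar R) :
  (forall T s, 0 <= T -> 0 < s < 1 ->
    (F T <= (expR (s ^+ 2 * T))%:E * total_meeting_series s)%E) ->
  (forall T s t, 0 <= T -> 0 < s < 1 -> 0 < t < s ->
    (total_meeting_series s <=
      F T + (expR (- ((s ^+ 2 - t ^+ 2) * T)))%:E * total_meeting_series t)%E) ->
  (F T / (ln T)%:E)%E @[T --> +oo] --> (C / 2)%:E.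
Proof.
move=> upper lower.
pose A := 13 * C + 2 * K + 13.
have bounds y : 14 <= y ->
    ((C * y ^+ 2 - A * y)%:E <= F (expR (2 * y ^+ 2)) <= (C * y ^+ 2 + A * y)%:E)%E.
  move=> y14; have T0 := expR_ge0 (2 * y ^+ 2).
  have expN1 u : 0 < u -> expR (- u) < 1 by rewrite expR_lt1 oppr_lt0.
  have y2 : 14 * y <= y ^+ 2 by rewrite expr2 ler_wpM2r//; lra.
  pose B := C * (y ^+ 2 + 2 * y + 2) + 2.
  have B0 : 0 <= B by rewrite addr_ge0// mulr_ge0//; nra.
  apply/andP; split.
    (* Here [t ^+ 2] is 1/T and [s ^+ 2] is exp(2 y)/T, so the series at [t], of order y^2, is
       multiplied by exp(1 - exp(2 y)). *)
    pose s := expR (- (y ^+ 2 - y)); pose t := expR (- y ^+ 2).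
    have s01 : 0 < s < 1 by rewrite expR_gt0 expN1//; nra.
    have ts : 0 < t < s by rewrite expR_gt0 ltr_expR; lra.
    have := lower _ _ _ T0 s01 ts.
    have -> : (s ^+ 2 - t ^+ 2) * expR (2 * y ^+ 2) = expR (2 * y) - 1.
      rewrite mulrBl /s /t -!expRM_natl -!expRD.
      rewrite (_ : 2 * - (y ^+ 2 - y) + 2 * y ^+ 2 = 2 * y); last ring.
      by rewrite (_ : 2 * - y ^+ 2 + 2 * y ^+ 2 = 0) ?expR0//; ring.
    have t1 : t < 1 by case/andP: ts => _ /lt_trans; apply; case/andP: s01.
    have tle : (total_meeting_series t <= B%:E)%E.
      by apply: total_meeting_series_le_expR => //; rewrite ler_expR; lra.
    pose x := expR (y ^+ 2 - y).
    pose m := Num.truncn x.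
    have /andP[mx xm] : m%:R <= x < m.+1%:R by rewrite truncn_itv// expR_ge0.
    have := total_meeting_series_ge m s01; rewrite -/C -/K => h1 h2.
    have {}h2 := le_trans h1 h2.
    have e0 : expR (- (expR (2 * y) - 1)) <= y^-1.
      apply: le_trans (expR_le1_1Dx _) _.
        by rewrite subr_ge0 -[leLHS]expR0 ler_expR; lra.
      have y0 : 0 < y by lra.
      rewrite addrC subrK lef_pV2 ?posrE ?expR_gt0//.
      by have := expR_ge1Dx (2 * y); lra.
    have : ((expR (- (expR (2 * y) - 1)))%:E * total_meeting_series t <= (y^-1 * B)%:E)%E.
      rewrite EFinM; apply: lee_pmul; last exact: tle.
      - by rewrite lee_fin expR_ge0.
      - exact: total_meeting_series_ge0.
      - by rewrite lee_fin; exact: e0.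
    move=> /(leeD2l (F (expR (2 * y ^+ 2)))) /(le_trans h2).
    rewrite -leeBlDr// -EFinB; apply: le_trans; rewrite lee_fin.
    have lnm : y ^+ 2 - y <= ln m.+1%:R.
      by rewrite -[leLHS]expRK ler_ln ?posrE ?expR_gt0// ltW.
    have ms : m%:R * s <= 1.
      apply: (@le_trans _ _ (x * s)); first by rewrite ler_wpM2r// expR_ge0.
      by rewrite /x /s -expRD subrr expR0.
    have yB : y^-1 * B <= 5 * C * y + y.
      rewrite mulrC ler_pdivrMr /B; last lra.
      have -> : (5 * C * y + y) * y = C * (5 * y ^+ 2) + y ^+ 2 by ring.
      by apply: lerD; [apply: ler_wpM2l => //|]; lra.
    have := ler_wpM2l C0 lnm.
    have : 0 <= C * y by rewrite mulr_ge0//; lra.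
    have : 2 * K * 1 <= 2 * K * y by apply: ler_wpM2l; [exact: mulr_ge0|lra].
    move: ms yB; rewrite /A; lra.
  (* Now s^2 T = exp(- 2 y), so the prefactor exceeds 1 by at most 1/y. *)
  pose s := expR (- (y ^+ 2 + y)).
  have s01 : 0 < s < 1 by rewrite expR_gt0 expN1//; nra.
  have h := total_meeting_series_le_expR y14 (lexx _) (andP s01).2.
  apply: (le_trans (upper _ _ T0 s01)).
  have -> : s ^+ 2 * expR (2 * y ^+ 2) = expR (- (2 * y)).
    by rewrite /s -expRM_natl -expRD; congr expR; ring.
  apply: (@le_trans _ _ ((1 + y^-1) * B)%:E).
    rewrite EFinM; apply: lee_pmul; last exact: h.
    - by rewrite lee_fin expR_ge0.
    - exact: total_meeting_series_ge0.
    rewrite lee_fin.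
    have hx : expR (- (2 * y)) <= (1 + 2 * y)^-1 by apply: expR_le1_1Dx; lra.
    have hy : (1 + 2 * y)^-1 <= 1 - (1 + y^-1)^-1.
      have -> : 1 - (1 + y^-1)^-1 = (1 + y)^-1 by field; apply/andP; split; lra.
      by rewrite lef_pV2 ?posrE; lra.
    have y0 : 0 < 1 + y^-1 by rewrite ltr_wpDr// invr_ge0; lra.
    rewrite -[leRHS]invrK -[leLHS]invrK -expRN lef_pV2 ?posrE ?invr_gt0 ?expR_gt0//.
    have := expR_ge1Dx (- expR (- (2 * y))); lra.
  rewrite lee_fin.
  have yB : y^-1 * B <= 5 * C * y + y.
    rewrite mulrC ler_pdivrMr /B; last lra.
    have -> : (5 * C * y + y) * y = C * (5 * y ^+ 2) + y ^+ 2 by ring.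
    by apply: lerD; [apply: ler_wpM2l => //|]; lra.
  have : 0 <= C * (y - 2) by rewrite mulr_ge0//; lra.
  have Ky : 0 <= K * y by rewrite mulr_ge0//; lra.
  have -> : (1 + y^-1) * B = B + y^-1 * B by ring.
  have Cp := C0; move: yB Ky; rewrite /A /B; lra.
pose y T := Num.sqrt (ln T / 2).
have yT : y T @[T --> +oo] --> +oo.
  apply/cvgryPge => M; near=> T.
  have T1 : expR (2 * M ^+ 2) <= T by near: T; apply: nbhs_pinfty_ge; exact: num_real.
  rewrite /y (le_trans (ler_norm M))// -sqrtr_sqr ler_wsqrtr// ler_pdivlMr// mulrC.
  by rewrite -[leLHS]expRK ler_ln ?posrE ?expR_gt0// (lt_le_trans _ T1)// expR_gt0.
have y0T : \forall T \near +oo, 14 <= y T by move/cvgryPge : yT; apply.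
have Ay : (A / 2) * (y T)^-1 @[T --> +oo] --> 0.
  rewrite -[X in _ --> X](mulr0 (A / 2)); apply: cvgMr.
  apply/gtr0_cvgV0 => //; near=> T.
  by apply: (@lt_le_trans _ _ 14) => //; near: T.
apply: (@squeeze_cvge _ _ _ _ (fun T => (C / 2 - (A / 2) * (y T)^-1)%:E) _
   (fun T => (C / 2 + (A / 2) * (y T)^-1)%:E)); last 2 first.
- apply: cvg_EFin; first exact: nearW.
  by rewrite -[X in _ --> X]subr0; apply: cvgB => //; exact: cvg_cst.
- apply: cvg_EFin; first exact: nearW.
  by rewrite -[X in _ --> X]addr0; apply: cvgD => //; exact: cvg_cst.
near=> T.
have T1 : 1 < T by near: T; exact: nbhs_pinfty_gt.
have yT14 : 14 <= y T by near: T.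
have lnT : ln T = 2 * y T ^+ 2.
  by rewrite sqr_sqrtr ?divr_ge0 ?ln_ge0 ?ltW//; field.
have TE : T = expR (2 * y T ^+ 2) by rewrite -lnT lnK// posrE; lra.
have /andP[lo hi] := bounds _ yT14; rewrite -TE in lo hi.
have lnT0 : 0 < ln T by rewrite ln_gt0.
have yy0 : y T != 0 by rewrite gt_eqF//; lra.
rewrite inver (gt_eqF lnT0) lee_pdivlMr// lee_pdivrMr// -!EFinM lnT.
have -> : (C / 2 - A / 2 / y T) * (2 * y T ^+ 2) = C * y T ^+ 2 - A * y T by field.
have -> : (C / 2 + A / 2 / y T) * (2 * y T ^+ 2) = C * y T ^+ 2 + A * y T by field.
by rewrite lo hi.
Unshelve. all: by end_near.
Qed.

End growth.

(** * Fronts of a trajectory *)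

Definition front (Hi Lo : pred (option int)) (c : config) (x : int) :=
  Hi (c x) /\ forall y, x < y -> Lo (c y).

(** A value may be neither [Hi] nor [Lo]. This freedom is used for [Front], which opposes
    nonnegative types to holes, and in [rear_mid_met_leader], where the pair leaves out type c. *)
Definition separating (Hi Lo : pred (option int)) :=
  (forall a b, Hi a -> gt_type b a -> Hi b) /\
  (forall a b, Hi a -> Lo b -> gt_type a b).

Section front.
Variables (Hi Lo : pred (option int)).
Hypothesis HiLo : separating Hi Lo.

Lemma front_unique c x y : front Hi Lo c x -> front Hi Lo c y -> x = y.
Proof.
have excl a : Hi a -> Lo a -> False.
  by move=> h l; have := HiLo.2 _ _ h l; case: a {h l} => //= i; rewrite ltxx.
move=> [hx lx] [hy ly]; have [xy|yx|//] := ltgtP x y.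
  by case: (excl _ hy (lx _ xy)).
by case: (excl _ hx (ly _ yx)).
Qed.

Lemma swap_edge_Hi c x z : z != x -> Hi (c x) -> Hi (swap_edge z c x).
Proof.
move=> zx hx; rewrite /swap_edge; case: ifP => // gt.
rewrite eq_sym (negbTE zx); case: eqP => // xz.
by apply: HiLo.1 hx _; rewrite xz.
Qed.

(** An edge inside the window only permutes its values; others can enter only through the edges at
    [x] and at [b]. *)
Lemma swap_edge_Lo c (x b : int) z : z != x -> z != b ->
  (forall y, x < y <= b -> Lo (c y)) -> forall y, x < y <= b -> Lo (swap_edge z c y).
Proof.
move=> zx zb lo y xyb; rewrite /swap_edge; case: ifP => _; last exact: lo.
case: eqP => [yz|_]; first by apply: lo; move: zx zb => /eqP ? /eqP ?; lia.
by case: eqP => [yz|_]; apply: lo => //; move: zx zb => /eqP ? /eqP ?; lia.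
Qed.

Lemma front_swap_ne c x z : z != x -> front Hi Lo c x -> front Hi Lo (swap_edge z c) x.
Proof.
move=> zx [hi lo]; split; first exact: swap_edge_Hi.
move=> y xy; apply: (@swap_edge_Lo c x (`|y|%N + `|z|%N + 1)%N%:Z z) => //; first lia.
  by move=> u /andP[xu _]; exact: lo.
by rewrite xy/=; lia.
Qed.

Lemma front_swap c x : front Hi Lo c x -> front Hi Lo (swap_edge x c) (x + 1).
Proof.
move=> [hi lo]; have gt : gt_type (c x) (c (x + 1)) by apply: HiLo.2 => //; apply: lo; lia.
split=> [|y xy]; rewrite /swap_edge gt.
  by rewrite eqxx; case: eqP => // ?; exfalso; lia.
by case: eqP => [?|_]; [exfalso; lia|case: eqP => [?|_]; [exfalso; lia|apply: lo; lia]].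
Qed.

End front.

(** * Motion of a front along a trajectory *)

Section trajectory.
Variables (R : realType) (e0 : config) (ring : int -> R -> Prop) (e : R -> config).
Hypothesis traj : tasep_trajectory e0 ring e.

Lemma near_interval (F : set_system R) (FF : Filter F) (c : config) (l r : int) :
  (forall x, \forall s \near F, e s x = c x) ->
  \forall s \near F, forall x, l <= x <= r -> e s x = c x.
Proof.
move=> h; have [n rn] : exists n : nat, r < l + n%:Z.
  by exists `|r - l|.+1%N; lia.
suff : \forall s \near F, forall k, (k < n)%N -> e s (l + k%:Z) = c (l + k%:Z).
  apply: filterS => s hs x /andP[lx xr].
  have -> : x = l + (`|x - l|%N)%:Z by lia.
  by apply: hs; lia.
elim: n {rn} => [|n ih]; first by apply: nearW.
apply: filterS2 ih (h (l + n%:Z)) => s ih hn k.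
by rewrite ltnS leq_eqVlt => /predU1P[->//|]; exact: ih.
Qed.

(* Continuous induction along the trajectory, for a property of finitely many
   sites. *)
Lemma trajectory_invariant (Psi : config -> Prop) (l r : int) (A D : R) :
  (forall c c' : config, (forall x, l <= x <= r -> c x = c' x) -> Psi c -> Psi c') ->
  0 <= A -> A < D ->
  (forall s x c, A < s < D -> ring x s -> Psi c -> Psi (swap_edge x c)) ->
  Psi (e A) ->
  (forall s, A <= s < D -> Psi (e s)) /\
  (forall c : config, (forall x, \forall s \near D^'-, e s x = c x) -> Psi c).
Proof.
move=> local A0 AD swap PA; case: traj => _ rightc leftc.
have left_limit u (c : config) : A < u -> (forall s, A <= s < u -> Psi (e s)) ->
    (forall x, \forall s \near u^'-, e s x = c x) -> Psi c.
  move=> Au Ps near_c; have {}near_c := @near_interval _ _ c l r near_c.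
  have [s [sc As su]] : exists s, [/\ forall x, l <= x <= r -> e s x = c x, A <= s & s < u].
    near (u^'-) => s; exists s; split.
    - near: s; exact: near_c.
    - by near: s; exact: nbhs_left_ge.
    - by near: s; exact: nbhs_left_lt.
  by apply: local sc _; apply: Ps; rewrite As su.
suff PAD s : A <= s < D -> Psi (e s).
  by split=> // c; exact: left_limit.
(* Consider the infimum of the failure times: [Psi] reaches its left limit, survives the possible
   ring there and, by right continuity on the window, extends beyond, so that failures cannot
   accumulate at it. *)
move=> sAD; apply: contrapT => Ps; pose E := [set s | A <= s < D /\ ~ Psi (e s)].
have Es : E s by [].
have lbE : has_lbound E by exists A => u [/andP[]].
have AE : A <= inf E by apply: lb_le_inf; [exists s|move=> u [/andP[]]].
have ED : inf E < D by case/andP: sAD => _; apply: le_lt_trans; exact: ge_inf.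
have PE u : A <= u < inf E -> Psi (e u).
  move=> /andP[Au uE]; apply: contrapT => Pu.
  have : inf E <= u by apply: ge_inf => //; split=> //; rewrite Au (lt_trans uE).
  by rewrite leNgt uE.
have PinfE : Psi (e (inf E)).
  move: AE; rewrite le_eqVlt => /predU1P[<-//|AE].
  have [c [near_c ring_c noring_c]] := leftc _ (le_lt_trans A0 AE).
  have Pc : Psi c by exact: left_limit near_c.
  have [[x rx]|nr] := pselect (exists x, ring x (inf E)).
    by rewrite (ring_c _ rx); apply: swap rx Pc; rewrite AE.
  by rewrite noring_c// => x rx; apply: nr; exists x.
have near_right := @near_interval _ _ (e (inf E)) l r
  (fun x => rightc _ x (le_trans A0 AE)).
have [d /= d0 near_d] := near_right.
have [u [/andP[Au uD] Pu] ud] := inf_adherent d0 (conj (ex_intro _ s Es) lbE).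
have Eu : inf E <= u by apply: ge_inf => //; split=> //; rewrite Au.
apply: Pu; move: Eu.
rewrite le_eqVlt => /predU1P[<-//|Eu].
apply: (local (e (inf E))) => // x xlr; rewrite near_d//=.
by rewrite /ball_ distrC ger0_norm; lra.
Unshelve. all: by end_near. Qed.

(** A silent edge shields the sites on its left from those on its right, which makes induction on a
    finite window possible. *)
Hypothesis far_silent : forall (T : R) (m : int), exists2 b, m <= b &
  forall s, 0 < s <= T -> ~ ring b s.

Section front_motion.
Variables (Hi Lo : pred (option int)).
Hypothesis HiLo : separating Hi Lo.
Local Notation front := (front Hi Lo).

Lemma front_still (A D : R) x : 0 <= A -> A < D -> front (e A) x ->
  (forall s, A < s < D -> ~ ring x s) ->
  (forall s, A <= s < D -> front (e s) x) /\
  (forall c : config, (forall y, \forall s \near D^'-, e s y = c y) -> front c x).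
Proof.
move=> A0 AD [hi lo] silent.
have H y : x < y ->
   let Psi (c : config) := Hi (c x) /\ Lo (c y) in
   (forall s, A <= s < D -> Psi (e s)) /\
   (forall c : config, (forall y, \forall s \near D^'-, e s y = c y) -> Psi c).
  move=> xy Psi; have [b yb sb] := far_silent D y.
  pose Phi (c : config) := Hi (c x) /\ forall y, x < y <= b -> Lo (c y).
  have PhiPsi c : Phi c -> Psi c.
    by move=> [h l]; split=> //; apply: l; rewrite xy yb.
  have [|||h1 h2] := @trajectory_invariant Phi x b A D _ A0 AD.
  - move=> c c' cc' [h l]; split; first by rewrite -cc'//; lia.
    by move=> u xub; rewrite -cc'; [exact: l|lia].
  - move=> s z c sAD rz [h l].
    have zx : z != x by apply/eqP => zx; apply: (silent s) => //; rewrite -zx.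
    have zb : z != b.
      apply/eqP => zb; apply: (sb s); last by rewrite -zb.
      by case/andP: sAD => As sD; rewrite (le_lt_trans A0 As) ltW.
    by split; [exact: (swap_edge_Hi HiLo)|exact: swap_edge_Lo].
  - by split=> // u /andP[xu _]; exact: lo.
  split=> [s sAD|c lc]; apply: PhiPsi; first exact: h1.
  exact: h2.
split=> [s sAD|c lc]; split.
- have [|h _] := H (x + 1); first lia.
  by have [] := h s sAD.
- by move=> y /H[h _]; have [] := h s sAD.
- have [|_ h] := H (x + 1); first lia.
  by have [] := h c lc.
- by move=> y /H[_ h]; have [] := h c lc.
Qed.

Lemma front_step (A D : R) x : 0 <= A -> A < D -> front (e A) x ->
  (forall s, A < s < D -> ~ ring x s) ->
  (ring x D -> front (e D) (x + 1)) /\ (~ ring x D -> front (e D) x).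
Proof.
move=> A0 AD fA silent; have [_ fl] := front_still A0 AD fA silent.
case: traj => _ _ /(_ D (le_lt_trans A0 AD))[c [near_c ring_c noring_c]].
have fc := fl c near_c; split=> rx.
  by rewrite (ring_c _ rx); exact: front_swap.
have [[z rz]|nr] := pselect (exists z, ring z D).
  rewrite (ring_c _ rz); apply: front_swap_ne => //.
  by apply/eqP => zx; apply: rx; rewrite -zx.
by rewrite noring_c// => z rz; apply: nr; exists z.
Qed.

(** The front only moves right, and it cannot cross the silent edge [b]; this gives both persistence
    and a bound uniform in time. *)
Lemma front_exists (A T : R) x0 : 0 <= A -> A <= T -> front (e A) x0 ->
  exists b, forall s, A <= s <= T -> exists2 x, x0 <= x <= b & front (e s) x.
Proof.
move=> A0 AT [hi lo]; have [b xb sb] := far_silent (T + 1) x0.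
exists b => s sAT.
have H b' : b < b' -> (forall s, 0 < s <= T + 1 -> ~ ring b' s) ->
  exists x, [/\ x0 <= x <= b, Hi (e s x) & forall y, x < y <= b' -> Lo (e s y)].
  move=> bb' sb'.
  pose Psi (c : config) :=
    exists x, [/\ x0 <= x <= b, Hi (c x) & forall y, x < y <= b' -> Lo (c y)].
  have [||||h _] := @trajectory_invariant Psi x0 b' A (T + 1) _ A0.
  - move=> c c' cc' [x [xb' h l]]; exists x; split=> //.
      by rewrite -cc'//; lia.
    by move=> u xub; rewrite -cc'; [exact: l|lia].
  - by lra.
  - move=> u z c uAD rz [x [x0b h l]].
    have u0 : 0 < u <= T + 1.
      by case/andP: uAD => Au uD; rewrite (le_lt_trans A0 Au) ltW.
    have zb : z != b by apply/eqP => zb; apply: (sb u) => //; rewrite -zb.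
    have zb' : z != b' by apply/eqP => zb'; apply: (sb' u) => //; rewrite -zb'.
    have [zx|zx] := eqVneq z x; last first.
      by exists x; split=> //; [exact: (swap_edge_Hi HiLo)|exact: swap_edge_Lo].
    exists (x + 1); split; first by move: zb => /eqP ?; lia.
      rewrite /swap_edge zx HiLo.2//; last by apply: l; lia.
      by rewrite eqxx; case: eqP => // ?; exfalso; lia.
    move=> y xy; rewrite /swap_edge zx; case: ifP => _; last by apply: l; lia.
    by case: eqP => [?|_]; [exfalso; lia|case: eqP => [?|_]; [exfalso; lia|apply: l; lia]].
  - by exists x0; split=> //; [lia|move=> y /andP[xy _]; exact: lo].
  by apply: h; lra.
have excl a : Hi a -> Lo a -> False.
  by move=> h l; have := HiLo.2 _ _ h l; case: a {h l} => //= i; rewrite ltxx.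
(* The site found in the window up to [b1] is the front. For [y] further right, a window up to a
   later silent edge [b2] also has such a site, and the two must coincide. *)
have [b1 bb1 sb1] := far_silent (T + 1) (b + 1).
have [|x [xb' hx lx]] := H b1 _ sb1; first lia.
exists x => //; split=> // y xy.
have [b2 yb2 sb2] := far_silent (T + 1) (`|y|%N + `|b|%N + 1)%N%:Z.
have [|x' [xb2 hx' lx']] := H b2 _ sb2; first lia.
have xx' : x' = x.
  have [x'x|xx'|//] := ltgtP x' x.
    by case: (excl _ hx); apply: lx'; lia.
  by case: (excl _ hx'); apply: lx; lia.
by apply: lx'; lia.
Qed.

End front_motion.

End trajectory.

(** * Words and leader changes *)

Definition ge_type (k : int) : pred (option int) :=
  fun a => if a is Some i then k <= i else false.
Definition lt_type (k : int) : pred (option int) := fun a => ~~ ge_type k a.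
Definition is_hole : pred (option int) := fun a => ~~ a.

Lemma separating_ge_lt (k k' : int) : k <= k' -> separating (ge_type k') (lt_type k).
Proof.
move=> kk'; split; case=> [i|] [j|] //=; rewrite /lt_type/=; first lia.
by rewrite -ltNge; lia.
Qed.

Lemma separating_ge_hole (k : int) : separating (ge_type k) is_hole.
Proof. by split; case=> [i|] [j|] //=; lia. Qed.

Section words.
Variable R : realType.
Implicit Types (tau : int -> nat -> \bar R) (c : nat) (w : seq walker).
Local Open Scope ereal_scope.

Definition next_ring tau x (s : \bar R) : \bar R :=
  ereal_inf (range (fun k => if s < tau x k then tau x k else +oo)).

Definition rivals i :=
  match i with Rear => (Mid, Front) | Mid => (Rear, Front) | Front => (Rear, Mid) end.

(* The time at which the walkers have realised the word [w], or [+oo] if their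
   jumps do not follow [w]; simultaneous jumps, a null event, also give [+oo]. *)
Fixpoint word_time tau c w : \bar R :=
  if w is i :: w' then
    let next j := next_ring tau (position c w' j) (word_time tau c w') in
    if next i < mine (next (rivals i).1) (next (rivals i).2) then next i else +oo
  else 0.

Lemma next_ringy tau x : next_ring tau x +oo = +oo.
Proof.
apply/eqP; rewrite -leye_eq; apply: le_ereal_inf_tmp => _ [k _ <-].
by case: ifP => //; rewrite ltNge leey.
Qed.

Lemma word_time_cons_fin tau c i w : word_time tau c (i :: w) < +oo ->
  word_time tau c w < +oo.
Proof.
by rewrite /= !ltey; apply: contraNN => /eqP ->; rewrite !next_ringy; case: (_ < _).
Qed.

Lemma word_time_inj tau c w w' : size w = size w' ->
  word_time tau c w < +oo -> word_time tau c w' < +oo -> w = w'.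
Proof.
elim: w w' => [|i w ih] [|i' w'] //= [sw] /[dup] /word_time_cons_fin fw.
move=> hi /[dup] /word_time_cons_fin fw'.
rewrite -(ih _ sw fw fw') in hi *; move: hi; case: ifP => // hi _.
case: ifP => // hi' _; congr (_ :: _).
move: hi hi'; rewrite !lt_min => /andP[h1 h2] /andP[h1' h2'].
move: i i' h1 h2 h1' h2' => [] [] //= h1 h2 h1' h2'; exfalso;
  by [have := lt_trans h1 h1'; rewrite ltxx | have := lt_trans h1 h2'; rewrite ltxx |
      have := lt_trans h2 h1'; rewrite ltxx | have := lt_trans h2 h2'; rewrite ltxx].
Qed.

End words.

(** * Walkers, meetings and leaders for fixed ring times *)

Section clocks.
Variables (R : realType) (rr : int -> nat -> R).
Hypothesis rr_incr : forall x n, rr x n < rr x n.+1.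
Hypothesis rr_unbounded : forall x M, exists n, M < rr x n.
Hypothesis rr_inj : forall x y n m, rr x n = rr y m -> x = y.
Hypothesis rr_far : forall (T : R) (m : int), exists2 x, m <= x & T < rr x 0.

Let tau x n := (rr x n)%:E.
Let ring x t := exists n, t = rr x n.

Let rr_mono x : {homo rr x : n m / (n <= m)%N >-> n <= m}.
Proof. by apply/nondecreasing_seqP => n; exact/ltW/rr_incr. Qed.

Lemma next_ringP x (s : R) : exists2 r, next_ring tau x s%:E = r%:E &
  [/\ s < r, ring x r & forall u, s < u -> ring x u -> r <= u].
Proof.
have ex : exists n, s < rr x n by exact: rr_unbounded.
pose n := ex_minn ex; have [sn minn] : s < rr x n /\ forall k, s < rr x k -> (n <= k)%N.
  by rewrite /n; case: ex_minnP.
exists (rr x n); last first.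
  by split=> //; [exists n|move=> u su [k uk]; rewrite uk; apply/rr_mono/minn; rewrite -uk].
apply/eqP; rewrite eq_le; apply/andP; split.
  by apply: ereal_inf_lbound; exists n => //=; rewrite lte_fin sn.
apply: le_ereal_inf_tmp => _ [k _ <-]; rewrite lte_fin.
by case: ifP => [sk|_]; [rewrite lee_fin; exact/rr_mono/minn|rewrite leey].
Qed.

Let ring_inj s x y : ring x s -> ring y s -> x = y.
Proof. by move=> [n ->] [m /rr_inj]. Qed.

Let far_silent (T : R) (m : int) : exists2 b, m <= b &
  forall s, 0 < s <= T -> ~ ring b s.
Proof.
have [b mb Tb] := rr_far T m; exists b => // s /andP[_ sT] [n sn].
have := lt_le_trans Tb (rr_mono b (leq0n n)); rewrite -sn.
by rewrite ltNge sT.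
Qed.

Variable e : R -> config.
Hypothesis traj : tasep_trajectory init_config ring e.
Variable c : nat.
Hypothesis c0 : (0 < c)%N.

Local Notation wtime := (word_time tau c).

(* The walkers follow the rightmost sites of type at least c + 1, c and 0. *)
Definition walker_Hi i :=
  match i with Rear => ge_type c.+1%:Z | Mid => ge_type c%:Z | Front => ge_type 0 end.
Definition walker_Lo i :=
  match i with Rear => lt_type c.+1%:Z | Mid => lt_type c%:Z | Front => is_hole end.
Local Notation walker_at i := (front (walker_Hi i) (walker_Lo i)).

Let walker_separating i : separating (walker_Hi i) (walker_Lo i).
Proof.
by case: i; [exact: separating_ge_lt|exact: separating_ge_lt|
  exact: separating_ge_hole].
Qed.

Let e_init : e 0 = init_config. Proof. by case: traj. Qed.

Let walker_start i : walker_at i (e 0) (position c [::] i).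
Proof.
rewrite e_init /front /init_config; case: i => /=; split=> [|y];
  rewrite /lt_type /is_hole /=; try (case: ifP => //=; lia); lia.
Qed.

(** After [A] the edge of the jumping walker rings strictly before those of the two others, so
    [front_step] moves it and leaves them in place. Walkers that share a site have equal next rings,
    and a jump of either then gets time [+oo]. *)
Lemma word_time_walkers w : wtime w = +oo%E \/ exists A, [/\ 0 <= A,
  wtime w = A%:E & forall i, walker_at i (e A) (position c w i)].
Proof.
elim: w => [|i w [fw|[A [A0 wA atA]]]].
- by right; exists 0.
- by left; rewrite /= fw !next_ringy; case: (_ < _)%E.
rewrite /= wA.
have [ri -> [Ari ringi mini]] := next_ringP (position c w i) A.
case: ifP => [lt_i|_]; last by left.
right; exists ri; split=> //; first by rewrite (le_trans A0)// ltW.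
have silent j : j != i -> forall s, A < s <= ri -> ~ ring (position c w j) s.
  move=> ji s /andP[As sri] rs.
  have [rj rjE [Arj ringj minj]] := next_ringP (position c w j) A.
  have : (ri%:E < rj%:E)%E.
    move: lt_i; rewrite lt_min -rjE => /andP[].
    by case: i j ji {rs rjE minj ringj mini atA ringi} => [] [].
  by rewrite lte_fin ltNge (le_trans (minj _ As rs) sri).
move=> j; have [->|ji] := eqVneq j i.
  have [] := front_step traj far_silent (walker_separating i) A0 Ari (atA i).
    by move=> s /andP[As sr] rs; have := mini _ As rs; rewrite leNgt sr.
  by move=> /(_ ringi).
have [] := front_step traj far_silent (walker_separating j) A0 Ari (atA j).
  by move=> s /andP[As sr]; apply: silent => //; rewrite As ltW.
by move=> _; rewrite addr0; apply; apply: silent => //; rewrite Ari lexx.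
Qed.

Local Notation led_above k t := (exists x, front (ge_type k) is_hole (e t) x).

(** The type of the leader never decreases: types at least k against holes form a separating pair,
    whose front persists. *)
Lemma led_above_mono k s t : 0 <= s -> s <= t -> led_above k s -> led_above k t.
Proof.
move=> s0 st [x fx].
have [b /(_ t)[]] := front_exists traj far_silent (separating_ge_hole k) s0 st fx.
  by rewrite st lexx.
by move=> y _ fy; exists y.
Qed.

Let lead_exists t : 0 <= t -> exists x, walker_at Front (e t) x.
Proof.
move=> t0; have [b /(_ t)[]] := front_exists traj far_silent
  (walker_separating Front) (lexx 0) t0 (walker_start Front).
  by rewrite t0 lexx.
by move=> y _ fy; exists y.
Qed.

Lemma leader_typeE t (k : int) : 0 <= t -> leader_type (e t) k -> 0 <= k /\
  exists2 x, walker_at Front (e t) x & e t x = Some k.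
Proof.
move=> t0 [x [ex nx]]; have [y [hy ly]] := lead_exists t0.
have xy : x = y.
  have [xy|yx|//] := ltgtP x y.
    by move: hy; rewrite nx.
  by have := ly _ yx; rewrite ex.
by move: hy ly; rewrite -xy ex => hy ly; split=> //; exists x => //; split=> //; rewrite ex.
Qed.

Lemma led_above_leader_type t (j k : int) : 0 <= t -> leader_type (e t) k ->
  led_above j t -> j <= k.
Proof.
move=> t0 [x [ex nx]] [y [hy ly]].
have [xy|yx|xy] := ltgtP x y.
- by move: hy; rewrite nx.
- by have := ly _ yx; rewrite ex.
- by move: hy; rewrite -xy ex.
Qed.

Lemma leader_type_led_above t (k : int) : leader_type (e t) k -> led_above k t.
Proof.
move=> [x [ex nx]]; exists x; split; first by rewrite ex /=.
by move=> y /nx ->.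
Qed.

(* Once walkers Rear and Mid have met, the walker Mid follows a type above c. *)
Lemma rear_mid_met_leader t s x : 0 <= t -> t <= s ->
  walker_at Rear (e t) x -> walker_at Mid (e t) x -> ~ leader_type (e s) c%:Z.
Proof.
move=> t0 ts [hi _] [_ lo] [y [ey ny]].
have sep : separating (ge_type c.+1%:Z) (lt_type c%:Z) by apply: separating_ge_lt; lia.
have [b /(_ s)[]] := front_exists traj far_silent sep t0 ts (conj hi lo).
  by rewrite ts lexx.
move=> z _ [hz lz]; have [yz|zy|yz] := ltgtP y z.
- by move: hz; rewrite ny.
- by have := lz _ zy; rewrite ey /lt_type /= lexx.
- by move: hz; rewrite -yz ey /=; lia.
Qed.

(** Positions determine the number of jumps. This bounds the length of a word when positions are
    bounded, and gives equal lengths to words with equal final positions. *)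
Lemma position_sum w : position c w Rear + position c w Mid + position c w Front =
  (size w)%:Z - (2 * c + 1)%N%:Z.
Proof.
elim: w => [|i w ih] /=; first lia.
have -> : forall a b d : int, position c w Rear + a + (position c w Mid + b) +
    (position c w Front + d) = (position c w Rear + position c w Mid + position c w Front)
    + (a + b + d) by move=> *; ring.
by rewrite ih; case: i; rewrite /eq_op /=; lia.
Qed.

(** Until [D] the walker [Mid] stays one site behind [Front], so the leader has type below c. At [D]
    it reaches the site of [Front] while [Rear] is strictly behind, so the type there is at least c
    and less than c + 1. *)
Lemma meeting_word_leader n w (D : R) : w \in meeting_words c n ->
  wtime (Mid :: w) = D%:E ->
  [/\ forall s, 0 <= s -> s < D -> ~ led_above c%:Z s,
      led_above c%:Z D, 0 < D, leader_type (e D) c%:Z & leader_change e D].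
Proof.
move=> wm wD; have := wm; rewrite mem_filter => /andP[/eqP gap1].
move=> /(separated_words_separated c0) sw.
have [|[A [A0 wA atA]]] := word_time_walkers w.
  by move=> wy; move: wD; rewrite /= wy !next_ringy; case: (_ < _)%E.
have [wDy|[D' [D0 wD' atD]]] := word_time_walkers (Mid :: w).
  by rewrite wDy in wD.
move: wD'; rewrite wD => -[DD']; rewrite -{}DD' in D0 atD.
have posMF : position c w Front = position c w Mid + 1.
  by move: gap1; rewrite /front_gap; lia.
have posRM : position c w Rear < position c w Mid.
  by move: sw; rewrite /separated /rear_gap => /andP[]; lia.
move: wD; rewrite /= wA.
have [rM rME [ArM _ minM]] := next_ringP (position c w Mid) A.
have [rR rRE [ArR _ minR]] := next_ringP (position c w Rear) A.
have [rF rFE [ArF _ minF]] := next_ringP (position c w Front) A.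
rewrite rME rRE rFE; case: ifP => //; rewrite lt_min !lte_fin => /andP[MR MF] [rMD].
rewrite {}rMD in rME ArM minM MR MF *.
have still i : forall s, A < s < D -> ~ ring (position c w i) s.
  move=> s /andP[As sD] rs; case: i rs => [/(minR _ As)|/(minM _ As)|/(minF _ As)] h.
  - by have := lt_trans (lt_le_trans MR h) sD; rewrite ltxx.
  - by have := le_lt_trans h sD; rewrite ltxx.
  - by have := lt_trans (lt_le_trans MF h) sD; rewrite ltxx.
have stillM := front_still traj far_silent (walker_separating Mid) A0 ArM (atA Mid) (still Mid).
have stillF := front_still traj far_silent (walker_separating Front) A0 ArM (atA Front)
  (still Front).
have notled s : A <= s -> s < D -> ~ led_above c%:Z s.
  move=> As sD [x [hx lx]]; have sAD : A <= s < D by rewrite As.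
  have [hM lM] := stillM.1 s sAD; have [hF lF] := stillF.1 s sAD.
  have [xF|Fx|xF] := ltgtP x (position c w Front).
  - by have := lx _ xF; move: hF; case: (e s _).
  - by have := lF _ Fx; move: hx; case: (e s _).
  - have := lM x; rewrite xF posMF ltrDl ltr01 /= /lt_type => /(_ isT).
    by rewrite -posMF -xF hx.
have leadD : leader_type (e D) c%:Z.
  have [_ lR] : walker_at Rear (e D) (position c w Rear).
    by have := atD Rear; rewrite /= addr0.
  have [_ lF] : walker_at Front (e D) (position c w Front).
    by have := atD Front; rewrite /= addr0.
  have [hM _] : walker_at Mid (e D) (position c w Front).
    by have := atD Mid; rewrite /= posMF.
  exists (position c w Front); split; last first.
    by move=> y /lF; case: (e D y).
  have : lt_type c.+1%:Z (e D (position c w Front)) by apply: lR; rewrite posMF; lia.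
  move: hM; rewrite /lt_type; case: (e D _) => //= j cj.
  by rewrite -ltNge => jc; congr Some; lia.
split=> //; first 1 last.
- exact: leader_type_led_above.
- exact: le_lt_trans ArM.
- have [_ _ /(_ D (le_lt_trans A0 ArM))[c_ [near_c _ _]]] := traj.
  (* The former leader is read off the left limit at [D], where [Mid] is still behind the site of
     [Front]. *)
  have [hF lF] := stillF.2 c_ near_c; have [hM lM] := stillM.2 c_ near_c.
  case E : (c_ (position c w Front)) hF => [k|//] k0.
  exists k, c%:Z; split=> //.
    apply/eqP => kc; have := lM (position c w Front); rewrite posMF ltrDl ltr01.
    by rewrite -posMF E kc /= /lt_type /= lexx => /(_ isT).
  near=> s; exists (position c w Front).
  have [_ lFs] : walker_at Front (e s) (position c w Front).
    apply: stillF.1; apply/andP; split; last by near: s; exact: nbhs_left_lt.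
    by near: s; exact: nbhs_left_ge.
  split; last by move=> y /lFs; case: (e s y).
  by rewrite -E; near: s; exact: near_c.
(* A leader of type at least c before [A] would persist until [A]. *)
move=> s s0 sD led; have [As|sA] := leP A s; first exact: (notled s As sD).
by apply: (notled A (lexx A) ArM); apply: led_above_mono led => //; exact: ltW.
Unshelve. all: by end_near. Qed.

(** Types of leaders are nondecreasing in time, so a leader of type at least c before [s] would
    force the type just before the change to be c itself. *)
Lemma leader_change_led s : 0 < s -> leader_change e s ->
  leader_type (e s) c%:Z -> forall u, 0 <= u -> u < s -> ~ led_above c%:Z u.
Proof.
move=> s0 [k [k' [kk' near_k leadk']]] leadc u u0 us led.
have k'c : k' = c%:Z.
  have [_ [x [_ lx] ex]] := leader_typeE (ltW s0) leadk'.
  have [_ [y [_ ly] ey]] := leader_typeE (ltW s0) leadc.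
  have xy : x = y.
    have [xy|yx|//] := ltgtP x y.
      by have := lx _ xy; rewrite ey.
    by have := ly _ yx; rewrite ex.
  by move: ey; rewrite -xy ex => -[].
have [v [uv vs leadv]] : exists v, [/\ u <= v, v < s & leader_type (e v) k].
  near (s^'-) => v; exists v; split.
  - by near: v; exact: nbhs_left_ge.
  - by near: v; exact: nbhs_left_lt.
  - by near: v; exact: near_k.
have v0 : 0 <= v by rewrite (le_trans u0).
have ck : c%:Z <= k := led_above_leader_type v0 leadv (led_above_mono u0 uv led).
have kc := led_above_leader_type (ltW s0) leadc
  (led_above_mono v0 (ltW vs) (leader_type_led_above leadv)).
by move: kk'; rewrite k'c => /eqP; apply; lia.
Unshelve. all: by end_near. Qed.

Let next_walker w A : separated c w -> exists i r,
  [/\ wtime w = A%:E -> wtime (i :: w) = r%:E, A < r &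
      forall j u, A < u -> ring (position c w j) u -> r <= u /\ (j != i -> r < u)].
Proof.
rewrite /separated /rear_gap /front_gap => /andP[rm mf].
have [rR rRE [ArR ringR minR]] := next_ringP (position c w Rear) A.
have [rM rME [ArM ringM minM]] := next_ringP (position c w Mid) A.
have [rF rFE [ArF ringF minF]] := next_ringP (position c w Front) A.
have RM : rR != rM.
  by apply/eqP => h; move: ringM; rewrite -h => /(ring_inj ringR) ?; lia.
have RF : rR != rF.
  by apply/eqP => h; move: ringF; rewrite -h => /(ring_inj ringR) ?; lia.
have MF : rM != rF.
  by apply/eqP => h; move: ringF; rewrite -h => /(ring_inj ringM) ?; lia.
have [i [r [ri Ar rle]]] : exists i r,
    [/\ r = match i with Rear => rR | Mid => rM | Front => rF end, A < r &
      [/\ r <= rR, r <= rM, r <= rF &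
       [/\ i != Rear -> r < rR, i != Mid -> r < rM & i != Front -> r < rF]]].
  have [RM'|MR'|/eqP] := ltgtP rR rM; last by rewrite (negbTE RM).
    have [RF'|FR'|/eqP] := ltgtP rR rF; last by rewrite (negbTE RF).
      by exists Rear, rR; do !split=> //; rewrite ltW.
    by exists Front, rF; do !split=> //; rewrite ?(lt_trans FR' RM')// ltW// (lt_trans FR').
  have [MF'|FM'|/eqP] := ltgtP rM rF; last by rewrite (negbTE MF).
    by exists Mid, rM; do !split=> //; rewrite ltW.
  by exists Front, rF; do !split=> //; rewrite ?(lt_trans FM' MR')// ltW// (lt_trans FM').
case: rle => leR leM leF [ltR ltM ltF].
exists i, r; split=> //.
- move=> wA; rewrite /= wA lt_min.
  by case: i ri ltR ltM ltF => -> ltR ltM ltF /=; rewrite rRE rME rFE !lte_fin ?ltR ?ltM ?ltF.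
- move=> j u Au ru; case: j ru => [/(minR _ Au)|/(minM _ Au)|/(minF _ Au)] h;
    (split; first exact: le_trans h); move=> ne; apply: lt_le_trans h.
  + by apply: ltR; rewrite eq_sym.
  + by apply: ltM; rewrite eq_sym.
  + by apply: ltF; rewrite eq_sym.
Qed.

Let size_separated n u : u \in separated_words c n -> size u = n.
Proof.
elim: n u => [|n ih] u; first by rewrite inE => /eqP->.
by rewrite mem_filter => /andP[_ /allpairsP[[v i] [vs _ ->]]]; rewrite /= (ih v vs).
Qed.

(** Before [s] the walkers [Mid] and [Front] are apart, and up to [s] so are [Rear] and [Mid]. If no
    meeting occurred at [s], every realised separated word could be prolonged before [s]; but
    positions are bounded up to time [s], hence so is the number of jumps. *)
Lemma leader_change_word s : 0 < s -> leader_change e s ->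
  leader_type (e s) c%:Z ->
  exists n w, w \in meeting_words c n /\ wtime (Mid :: w) = s%:E.
Proof.
move=> s0 change leadc; have notled := leader_change_led s0 change leadc.
apply: contrapT => nomeet.
have apartRM u x : 0 <= u -> u <= s -> walker_at Rear (e u) x -> walker_at Mid (e u) x -> False.
  by move=> u0 us fR fM; exact: (rear_mid_met_leader u0 us fR fM).
have apartMF u x : 0 <= u -> u < s -> walker_at Mid (e u) x -> walker_at Front (e u) x -> False.
  by move=> u0 us [hM _] [_ lF]; apply: (notled u u0 us); exists x.
have metMF x y : walker_at Mid (e s) x -> walker_at Front (e s) y -> x < y -> False.
  move=> [_ lM] fF xy; have [_ [z fz ez]] := leader_typeE (ltW s0) leadc.
  have := lM z; rewrite (front_unique (walker_separating Front) fz fF) => /(_ xy).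
  by rewrite -(front_unique (walker_separating Front) fz fF) ez /= /lt_type /= lexx.
have long n : exists w A, [/\ w \in separated_words c n, A < s & wtime w = A%:E].
  elim: n => [|n [w [A [ws As wA]]]].
    by exists [::], 0; split=> //; rewrite inE.
  have sw := separated_words_separated c0 ws.
  have [wy|[A' [A0 wA' atA]]] := word_time_walkers w; first by rewrite wy in wA.
  move: wA'; rewrite wA => -[AA']; rewrite -{}AA' in A0 atA.
  have [i [r [wr Ar minr]]] := @next_walker w A sw.
  move: wr => /(_ wA) wr.
  have posRM : position c w Rear < position c w Mid.
    by move: sw; rewrite /separated /rear_gap => /andP[]; lia.
  have posMF : position c w Mid < position c w Front.
    by move: sw; rewrite /separated /front_gap => /andP[]; lia.
  have [sr|rs] := ltP s r.
    exfalso; have still j : walker_at j (e s) (position c w j).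
      have [|_] := front_step traj far_silent (walker_separating j) A0 As (atA j).
        by move=> u /andP[Au us] ru; have [] := minr j u Au ru; lra.
      by apply=> rs; have [] := minr j s As rs; lra.
    exact: metMF (still Mid) (still Front) posMF.
  have [wry|[r' [r0 wr' atr]]] := word_time_walkers (i :: w); first by rewrite wry in wr.
  move: wr'; rewrite wr => -[rr']; rewrite -{}rr' in r0 atr.
  have rear : 0 < rear_gap c (i :: w).
    have : rear_gap c (i :: w) != 0.
      apply/eqP => h; apply: (apartRM r (position c (i :: w) Rear)) => //.
      have -> : position c (i :: w) Rear = position c (i :: w) Mid.
        by move: h; rewrite /rear_gap; lia.
      exact: atr.
    rewrite rear_gap_cons; move: posRM; rewrite /rear_gap; case: (i); lia.
  have front0 : 0 <= front_gap c (i :: w).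
    rewrite front_gap_cons; move: posMF; rewrite /front_gap; case: (i); lia.
  move: rs; rewrite le_eqVlt => /predU1P[rs|rs].
    exfalso; rewrite rs in wr r0 atr.
    have [g0|gpos] := eqVneq (front_gap c (i :: w)) 0; last first.
      by apply: metMF (atr Mid) (atr Front) _; move: front0 gpos; rewrite /front_gap; lia.
    apply: nomeet; exists n, w.
    have [iM gw] : i = Mid /\ front_gap c w = 1.
      move: g0 posMF; rewrite front_gap_cons /front_gap.
      by case: (i) => /=; [lia| |lia]; split=> //; lia.
    by rewrite mem_filter gw eqxx ws; split=> //; rewrite -iM.
  exists (i :: w), r; split=> //.
  rewrite mem_filter /separated rear/=; apply/andP; split; last first.
    by apply/allpairsP; exists (w, i); split=> //; case: (i).
  have : front_gap c (i :: w) != 0.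
    apply/eqP => h; apply: (apartMF r (position c (i :: w) Mid)) => //.
    have -> : position c (i :: w) Mid = position c (i :: w) Front.
      by move: h; rewrite /front_gap; lia.
    exact: atr.
  by lia.
have [b hb] : exists b : int, forall i u x, 0 <= u -> u <= s -> walker_at i (e u) x -> x <= b.
  have bound i : exists b : int, forall u x, 0 <= u -> u <= s -> walker_at i (e u) x -> x <= b.
    have [b h] := front_exists traj far_silent (walker_separating i) (lexx 0) (ltW s0)
      (walker_start i).
    exists b => u x u0 us fx; have [|y] := h u; first by rewrite u0.
    by move=> /andP[_ yb] fy; rewrite (front_unique (walker_separating i) fx fy).
  have [b1 h1] := bound Rear; have [b2 h2] := bound Mid; have [b3 h3] := bound Front.
  exists (`|b1|%N + `|b2|%N + `|b3|%N)%N%:Z => -[] u x u0 us fx.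
  - by have := h1 u x u0 us fx; lia.
  - by have := h2 u x u0 us fx; lia.
  - by have := h3 u x u0 us fx; lia.
(* By [position_sum] a word whose three positions are at most [b] has at most 3 |b| + 2 c + 1
   letters. *)
have [w [A [ws As wA]]] := long (3 * `|b| + 2 * c + 2)%N.
have [wy|[A' [A0 wA' atA]]] := word_time_walkers w; first by rewrite wy in wA.
move: wA'; rewrite wA => -[AA']; rewrite -{}AA' in A0 atA.
have := position_sum w; rewrite (size_separated ws).
have := hb _ _ _ A0 (ltW As) (atA Rear); have := hb _ _ _ A0 (ltW As) (atA Mid).
have := hb _ _ _ A0 (ltW As) (atA Front); lia.
Qed.

(** Both meeting times are the first at which a type at least c leads, so they agree. The walkers
    then have the same positions, the words the same length, and [word_time_inj] applies. *)
Lemma meeting_word_unique n n' w w' (D D' : R) :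
  w \in meeting_words c n -> w' \in meeting_words c n' ->
  wtime (Mid :: w) = D%:E -> wtime (Mid :: w') = D'%:E -> n = n' /\ w = w'.
Proof.
move=> wm wm' wD wD'.
have [no led D0 _ _] := meeting_word_leader wm wD.
have [no' led' D0' _ _] := meeting_word_leader wm' wD'.
have DD : D = D'.
  have [DD'|D'D|//] := ltgtP D D'.
    by case: (no' D (ltW D0) DD').
  by case: (no D' (ltW D0') D'D).
subst D'; have pos : forall i, position c (Mid :: w) i = position c (Mid :: w') i.
  have [h|[A [_ h atA]]] := word_time_walkers (Mid :: w); first by rewrite h in wD.
  have [h'|[A' [_ h' atA']]] := word_time_walkers (Mid :: w'); first by rewrite h' in wD'.
  move: h h' atA atA'; rewrite wD wD' => -[<-] [<-] atA atA' i.
  exact (front_unique (walker_separating i) (atA i) (atA' i)).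
have sw : size (Mid :: w) = size (Mid :: w').
  by have := position_sum (Mid :: w); rewrite !pos position_sum; lia.
have [] : Mid :: w = Mid :: w'.
  by apply: (@word_time_inj _ tau c _ _ sw); [rewrite wD ltry|rewrite wD' ltry].
move: wm wm'; rewrite !mem_filter => /andP[_ /size_separated wn] /andP[_ /size_separated wn'].
by move=> ww'; split=> //; rewrite -wn -wn' ww'.
Qed.

Definition new_leader_by (T : R) := exists n w D,
  [/\ w \in meeting_words c n, wtime (Mid :: w) = D%:E & D <= T].

Lemma uniq_meeting_words n : uniq (meeting_words c n).
Proof.
apply: filter_uniq; elim: n => [//|n ih] /=; apply: filter_uniq.
by apply: allpairs_uniq => //= -[v i] [v' i'] _ _ /= [-> ->].
Qed.

Lemma sum_meeting_words (T : R) :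
  (\sum_(0 <= n <oo) \sum_(w <- meeting_words c n)
     (wtime (Mid :: w) <= T%:E)%E%:R%:E)%E = (`[< new_leader_by T >])%:R%:E :> \bar R.
Proof.
case: asboolP => [[n [w [D [wm wD DT]]]]|no]; last first.
  apply: eseries0 => n _ _; rewrite big_seq big1// => w wm.
  case: (boolP (_ <= _)%E) => // wT; exfalso; apply: no.
  have [wy|[D [_ wD _]]] := word_time_walkers (Mid :: w); first by rewrite wy in wT.
  by exists n, w, D; split=> //; rewrite -lee_fin -wD.
rewrite (@nneseriesD1 _ _ n)//; last first.
  by move=> k _; apply: sume_ge0 => u _; rewrite lee_fin.
have only n' w' : w' \in meeting_words c n' -> (wtime (Mid :: w') <= T%:E)%E -> n' = n /\ w' = w.
  move=> wm' wT'.
  have [wy|[D' [_ wD' _]]] := word_time_walkers (Mid :: w'); first by rewrite wy in wT'.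
  by have [-> ->] := meeting_word_unique wm wm' wD wD'.
rewrite eseries0 ?adde0; last first.
  move=> n' _ n'n; rewrite big_seq big1// => w' wm'.
  case: (boolP (_ <= _)%E) => // wT; exfalso.
  by have [n'E _] := only _ _ wm' wT; rewrite n'E eqxx in n'n.
rewrite (bigD1_seq w wm (uniq_meeting_words n)) wD lee_fin DT big_seq_cond big1;
  first by rewrite /= adde0.
move=> w' /andP[wm' w'w]; case: (boolP (_ <= _)%E) => // wT; exfalso.
by have [_ w'E] := only _ _ wm' wT; rewrite w'E eqxx in w'w.
Qed.

End clocks.

Lemma counting_card_eq (R : realType) (T T' : choiceType) (A : set T) (B : set T') :
  (A #= B)%card -> counting A = counting B :> \bar R.
Proof.
move=> AB; rewrite /counting (eq_finite_set AB); case: asboolP => // /finite_setP[n Bn].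
by rewrite (card_fset_set Bn) (card_fset_set (card_eq_trans AB Bn)).
Qed.

(** * Changes of leader counted by words *)

Section leader_changes.
Variables (R : realType) (rr : int -> nat -> R).
Hypothesis rr_incr : forall x n, rr x n < rr x n.+1.
Hypothesis rr_unbounded : forall x M, exists n, M < rr x n.
Hypothesis rr_inj : forall x y n m, rr x n = rr y m -> x = y.
Hypothesis rr_far : forall (T : R) (m : int), exists2 x, m <= x & T < rr x 0.
Variable e : R -> config.
Hypothesis traj : tasep_trajectory init_config (fun x t => exists n, t = rr x n) e.

(** Sending a type to the time at which it takes the lead is a bijection onto the times of change,
    and for each type the double sum of indicators is 0 or 1. *)
Lemma num_leader_changes_words (T : R) : num_leader_changes e T =
  (\sum_(0 <= c <oo) \sum_(0 <= n <oo) \sum_(w <- meeting_words c.+1 n)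
     (word_time (fun x k => (rr x k)%:E) c.+1 (Mid :: w) <= T%:E)%E%:R%:E)%E.
Proof.
under eq_eseriesr do rewrite (sum_meeting_words rr_incr rr_unbounded rr_far traj)//.
pose new c D := exists n w, w \in meeting_words c.+1 n /\
  word_time (fun x k => (rr x k)%:E) c.+1 (Mid :: w) = D%:E.
pose B := [set c : nat | new_leader_by rr c.+1 T].
pose tau c := xget 0 [set D | new c D /\ D <= T].
have tauP c : B c -> new c (tau c) /\ tau c <= T.
  rewrite /tau => -[n [w [D [wm wD DT]]]]; case: xgetP => [_ _ //|/(_ D)[]].
  by split=> //; exists n, w.
have newP c D : new c D -> [/\ 0 < D, leader_type (e D) c.+1%:Z & leader_change e D].
  move=> [n [w [wm wD]]].
  by have [] := meeting_word_leader rr_incr rr_unbounded rr_far traj (ltn0Sn c) wm wD.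
have leader_unique D k k' : leader_type (e D) k -> leader_type (e D) k' -> k = k'.
  move=> [x [ex nx]] [y [ey ny]]; have [xy|yx|xy] := ltgtP x y.
  - by move: ey; rewrite nx.
  - by move: ex; rewrite ny.
  - by move: ex; rewrite xy ey => -[].
transitivity (counting B : \bar R); last first.
  rewrite counting_dirac; apply: eq_eseriesr => c _.
  by rewrite diracE.
rewrite /num_leader_changes; apply: counting_card_eq.
have <- : tau @` B = [set s | 0 < s <= T /\ leader_change e s].
  apply/seteqP; split => [_ [c /tauP[nc cT] <-]|s [/andP[s0 sT] ch]].
    by have [D0 _ ch] := newP _ _ nc; split=> //; rewrite D0.
  have [k [k' [kk' near_k leadk']]] := ch.
  (* The new type exceeds the former leader's type, which is nonnegative. *)
  have [c kc] : exists c : nat, k' = c.+1%:Z.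
    have [v [v0 vs leadv]] : exists v, [/\ 0 <= v, v < s & leader_type (e v) k].
      near (s^'-) => v; exists v; split.
      - by near: v; exact: nbhs_left_ge.
      - by near: v; exact: nbhs_left_lt.
      - by near: v; exact: near_k.
    have [k0 _] := leader_typeE rr_incr rr_far traj (ltn0Sn 0) v0 leadv.
    have kk := led_above_leader_type (ltW s0) leadk'
      (led_above_mono rr_incr rr_far traj v0 (ltW vs) (leader_type_led_above leadv)).
    by exists (`|k'|.-1)%N; move: kk' => /eqP; lia.
  rewrite kc in leadk'.
  have [n [w [wm wD]]] := leader_change_word rr_incr rr_unbounded rr_inj rr_far traj
     (ltn0Sn c) s0 ch leadk'.
  have Bc : B c by exists n, w, s.
  exists c => //; have [[n' [w' [wm' wD']]] _] := tauP _ Bc.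
  have [_ ww'] := meeting_word_unique rr_incr rr_unbounded rr_far traj (ltn0Sn c) wm wm' wD wD'.
  by move: wD'; rewrite -ww' wD => -[].
apply: inj_card_eq => c c' /set_mem /tauP[nc _] /set_mem /tauP[nc' _] cc'.
have [_ lc _] := newP _ _ nc; have [_ lc' _] := newP _ _ nc'.
rewrite cc' in lc; by have [] := leader_unique _ _ _ lc lc'.
Unshelve. all: by end_near. Qed.

End leader_changes.

(** * Memoryless clocks *)

Section density.
Local Open Scope ereal_scope.
Context d (T : measurableType d) (R : realType).
Variables (mu m : {measure set T -> \bar R}) (p : T -> R).
Hypotheses (mp : measurable_fun setT p) (p0 : forall x, (0 <= p x)%R).
Hypothesis mE : forall A, measurable A -> m A = \int[mu]_(x in A) (p x)%:E.

Import HBNNSimple.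

Lemma ge0_integral_density (f : T -> \bar R) :
  measurable_fun setT f -> (forall x, 0 <= f x) ->
  \int[m]_x f x = \int[mu]_x (f x * (p x)%:E).
Proof.
move=> mf f0.
pose f_ := nnsfun_approx measurableT mf.
have cvg_f x : EFin \o f_ ^~ x @ \oo --> f x by exact: cvg_nnsfun_approx.
have mpE : measurable_fun setT (EFin \o p) by exact/measurable_EFinP.
transitivity (limn (fun n => \int[m]_x (f_ n x)%:E)).
  rewrite -monotone_convergence//.
  - by apply: eq_integral => y _; apply/esym/cvg_lim => //; exact: cvg_f.
  - by move=> n; exact/measurable_EFinP/measurable_funP.
  - by move=> n y _; rewrite lee_fin.
  - by move=> y _ n k nk; rewrite lee_fin; exact/lefP/nd_nnsfun_approx.
rewrite [X in limn X](_ : _ = (fun n => \int[mu]_x ((f_ n x)%:E * (p x)%:E))).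
  rewrite -monotone_convergence//; last 3 first.
  - by move=> n; apply: emeasurable_funM => //; exact/measurable_EFinP/measurable_funP.
  - by move=> n y _; rewrite -EFinM lee_fin mulr_ge0.
  - by move=> y _ n k nk; rewrite lee_fin ler_wpM2r//; exact/lefP/nd_nnsfun_approx.
  apply: eq_integral => y _; apply/cvg_lim => //.
  by apply: cvgeZr; [|exact: cvg_f].
apply/funext => n; under eq_integral do rewrite fimfunE -fsumEFin//.
rewrite ge0_integral_fsum//; last 2 first.
- by move=> y; exact/measurable_EFinP/measurable_funM.
- by move=> y x _; rewrite nnfun_muleindic_ge0.
rewrite (eq_integral (fun x => \sum_(k \in range (f_ n))
    (k * \1_(f_ n @^-1` [set k]) x)%:E * (p x)%:E)); last first.
  move=> x _; rewrite [in LHS]fimfunE -fsumEFin// ge0_mule_fsuml// => k.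
  by rewrite nnfun_muleindic_ge0.
rewrite ge0_integral_fsum//; last 2 first.
- move=> y; apply: emeasurable_funM => //.
  exact/measurable_EFinP/measurable_funM.
- by move=> y x _; rewrite mule_ge0 ?nnfun_muleindic_ge0 ?lee_fin.
apply: eq_fsbigr => r rf.
have r0 : (0 <= r)%R by move: rf; rewrite inE => -[x _ <-].
have mfr : measurable (f_ n @^-1` [set r]) by [].
under eq_integral do rewrite EFinM.
rewrite ge0_integralZl//; last exact/measurable_EFinP.
rewrite integral_indic// setIT mE//.
under [RHS]eq_integral do rewrite EFinM -muleA.
rewrite ge0_integralZl//; last 2 first.
- by apply: emeasurable_funM => //; exact/measurable_EFinP.
- by move=> x _; rewrite -EFinM lee_fin mulr_ge0.
congr (_ * _); rewrite integral_mkcond; apply: eq_integral => x _.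
by rewrite patchE indicE -EFinM; case: ifP => _; rewrite ?mul1r ?mul0r.
Qed.

End density.

(** * Exponential waiting times and their Laplace transforms *)

Section exponential.
Variable R : realType.
Local Open Scope ereal_scope.
Local Notation Leb := (@lebesgue_measure R).

Lemma exponential_prob_itvcy (r x : R) : (0 < r)%R -> (0 <= x)%R ->
  exponential_prob r `[x, +oo[ = (expR (- r * x))%:E.
Proof.
move=> r0 x0; rewrite /exponential_prob.
have cont : {within `[x, +oo[%classic, continuous (exponential_pdf r)}.
  apply: (@continuous_subspaceW R^o _ _ [set` `[0%R, +oo[%R]).
    by move=> y; rewrite /= !in_itv/= !andbT; exact: le_trans.
  exact: within_continuous_exponential_pdf.
have cexp : continuous (fun z : R^o => expR (- r * z)).
  move=> z; apply: continuous_comp; last exact: continuous_expR.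
  by apply: continuousM => //; apply: (@continuousN _ R^o); exact: cst_continuous.
rewrite (@ge0_continuous_FTC2y _ _ (fun y => (- expR (- r * y))%R) _ 0%R)//.
- by rewrite sub0e EFinN oppeK.
- by move=> y _; apply: exponential_pdf_ge0; exact: ltW.
- rewrite -oppr0; apply: cvgN.
  rewrite (_ : (fun y => expR (- r * y)) =
               (fun z => expR (- z)) \o (fun z => r * z))%R; last first.
    by apply: eq_fun => y; rewrite mulNr.
  apply: (@cvg_comp _ _ _ _ _ _ (pinfty_nbhs R)); last exact: cvgr_expR.
  exact: gt0_cvgMry.
- by apply: cvgN; apply/cvg_at_right_filter; exact: cexp.
- move=> y; rewrite in_itv/= andbT => xy; apply: derive1_exponential_pdf.
  by rewrite in_itv/= andbT (le_lt_trans x0).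
Qed.

Lemma measurable_exponential_pdfE (r : R) (A : set R) :
  measurable_fun A (EFin \o exponential_pdf r).
Proof.
by apply/measurable_EFinP/measurable_funTS; exact: measurable_exponential_pdf.
Qed.

Lemma exponential_prob_itvoy (r x : R) : (0 < r)%R -> (0 <= x)%R ->
  exponential_prob r `]x, +oo[ = (expR (- r * x))%:E.
Proof.
move=> r0 x0; rewrite -exponential_prob_itvcy// /exponential_prob.
by apply: integral_itv_obnd_cbnd; exact: measurable_exponential_pdfE.
Qed.

(** The value 0 at [+oo] makes unrealised words contribute nothing to the expectations; word times
    are never [-oo]. *)
Definition laplace (mu : R) (x : \bar R) : \bar R :=
  if x is r%:E then (expR (- mu * r))%:E else 0.

Lemma laplace_ge0 mu x : 0 <= laplace mu x.
Proof. by case: x => [r| |] //=; rewrite lee_fin expR_ge0. Qed.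

(** Killing at rate mu turns the density of rate 1 into that of rate 1 + mu, up to a constant. *)
Lemma laplace_pdf (mu S u : R) : (0 < mu)%R ->
  ((1 + mu) * (expR (- mu * (S + u)) * exponential_pdf 1 u) =
   expR (- mu * S) * exponential_pdf (1 + mu) u)%R.
Proof.
move=> mu0; have [u0|u0] := leP 0%R u; last first.
  by rewrite !lt0_exponential_pdf// !mulr0.
rewrite !exponential_pdfE// mul1r [RHS]mulrCA; congr (_ * _)%R.
by rewrite -!expRD; congr expR; ring.
Qed.

Let pdf_ge0 (r u : R) : (0 < r)%R -> 0 <= (exponential_pdf r u)%:E.
Proof. by move=> r0; rewrite lee_fin exponential_pdf_ge0// ltW. Qed.

Lemma exponential_probE (r : R) (A : set R) : measurable A ->
  exponential_prob r A = \int[Leb]_u ((\1_A u)%:E * (exponential_pdf r u)%:E).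
Proof.
move=> mA; rewrite /exponential_prob integral_mkcond; apply: eq_integral => u _.
by rewrite patchE indicE; case: ifP => _; rewrite ?mul1e ?mul0e.
Qed.

(* Lack of memory: S is the last ring before the date A, S + u the next one, and
   B the next ring of the two other edges.  The three terms are the Laplace
   transforms of the jump if it occurs at this edge, of the next jump, and of
   the date A. *)
Lemma exponential_memoryless (mu S A : R) (B : \bar R) :
  (0 < mu)%R -> (S <= A)%R -> A%:E <= B ->
  \int[exponential_prob 1]_u
    (mu%:E * (if (A < S + u)%R && ((S + u)%:E < B) then laplace mu (S + u)%:E else 0)
     + (if (A < S + u)%R then laplace mu (mine (S + u)%:E B) else 0)) =
  \int[exponential_prob 1]_u (if (A < S + u)%R then laplace mu A%:E else 0).
Proof.
move=> mu0 SA AB.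
pose U := [set u | (A < S + u)%R /\ (S + u)%:E < B].
pose V := [set u | (A < S + u)%R /\ B <= (S + u)%:E].
have UV0 : U `&` V = set0.
  by apply/seteqP; split=> // u [[_ uB] [_]]; rewrite leNgt uB.
have UVE : U `|` V = `](A - S)%R, +oo[%classic.
  apply/seteqP; split=> u; rewrite /= in_itv/= andbT ltrBlDl.
    by case=> -[].
  by move=> Au; have [|] := ltP (S + u)%:E B; [left|right].
have [mU [mV VE]] : measurable U /\ measurable V /\
    forall r, (0 < r)%R -> (expR (- mu * S))%:E * exponential_prob (r + mu) V =
    laplace mu B * exponential_prob r V.
  case: B AB @U @V UV0 UVE => [b| |] //; rewrite ?lee_fin => AB U V UV0 UVE.
  have mV : measurable V.
    rewrite (_ : V = `](A - S)%R, +oo[%classic `&` `[(b - S)%R, +oo[%classic);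
      first exact: measurableI.
    apply/seteqP; split => u; rewrite /V /= !in_itv/= !andbT lee_fin;
      by rewrite ltrBlDl lerBlDl.
  split.
    rewrite (_ : U = `](A - S)%R, +oo[%classic `&` `]-oo, (b - S)%R[%classic);
      first exact: measurableI.
    apply/seteqP; split => u; rewrite /U /= !in_itv/= !andbT lte_fin;
      by rewrite ltrBlDl ltrBrDl.
  split=> // r r0.
  have VE r' : (0 < r')%R -> exponential_prob r' V = (expR (- r' * (b - S)))%:E.
    move=> r'0; move: AB; rewrite le_eqVlt => /predU1P[AB|AB].
      rewrite -AB -exponential_prob_itvoy ?subr_ge0//; congr exponential_prob.
      apply/seteqP; split => u; rewrite /V /= !in_itv/= !andbT lee_fin -AB ltrBlDl.
        by case.
      by move=> h; split=> //; exact: ltW.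
    rewrite -exponential_prob_itvcy// ?subr_ge0 ?(le_trans SA) ?(ltW AB)//.
    congr exponential_prob.
    apply/seteqP; split => u; rewrite /V /= !in_itv/= !andbT lee_fin lerBlDl.
      by case.
    by move=> h; split=> //; rewrite (lt_le_trans AB).
  by rewrite !VE// ?addr_gt0// -!EFinM -!expRD; congr (expR _)%:E; ring.
- have V0 : V = set0 by apply/seteqP; split=> // u [_].
  have mV : measurable V by rewrite V0.
  split; first by move: UVE; rewrite V0 setU0 => ->.
  by split=> // r r0; rewrite V0 /exponential_prob !integral_set0 !mule0.
have m1mu : (0 < 1 + mu)%R by rewrite addr_gt0.
have step r : (0 < r)%R -> measurable_fun setT (fun u : R => (exponential_pdf r u)%:E).
  by move=> r0; exact: measurable_exponential_pdfE.
have mind (W : set R) : measurable W -> measurable_fun setT (fun u : R => (\1_W u)%:E : \bar R).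
  by move=> mW; apply/measurable_EFinP; exact: measurable_indic.
have msum (W1 W2 : set R) (k1 k2 r1 r2 : R) : measurable W1 -> measurable W2 ->
    (0 <= k1)%R -> (0 <= k2)%R -> (0 < r1)%R -> (0 < r2)%R ->
    \int[Leb]_u (k1%:E * ((\1_W1 u)%:E * (exponential_pdf r1 u)%:E) +
                 k2%:E * ((\1_W2 u)%:E * (exponential_pdf r2 u)%:E)) =
    k1%:E * exponential_prob r1 W1 + k2%:E * exponential_prob r2 W2.
  move=> mW1 mW2 k10 k20 r10 r20.
  have h W r : measurable W -> (0 < r)%R ->
      measurable_fun setT (fun u : R => (\1_W u)%:E * (exponential_pdf r u)%:E).
    by move=> mW r0; apply: emeasurable_funM; [exact: mind|exact: step].
  have h0 (W : set R) r u : (0 < r)%R -> 0 <= (\1_W u)%:E * (exponential_pdf r u)%:E.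
    by move=> r0; rewrite mule_ge0// lee_fin ?exponential_pdf_ge0// ltW.
  rewrite ge0_integralD//; last 4 first.
  - by move=> u _; rewrite mule_ge0 ?h0.
  - by apply: measurable_funeM; exact: h.
  - by move=> u _; rewrite mule_ge0 ?h0.
  - by apply: measurable_funeM; exact: h.
  rewrite !ge0_integralZl//; last 4 first.
  - by exact: h.
  - by move=> u _; exact: h0.
  - by exact: h.
  - by move=> u _; exact: h0.
  by rewrite -!exponential_probE.
have dens (f : R -> \bar R) : measurable_fun setT f -> (forall u, 0 <= f u) ->
    \int[exponential_prob 1]_u f u = \int[Leb]_u (f u * (exponential_pdf 1 u)%:E).
  move=> mf f0; apply: ge0_integral_density => //; first exact: measurable_exponential_pdf.
  by move=> u; rewrite exponential_pdf_ge0.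
pose lB := fine (laplace mu B).
have lBE : laplace mu B = lB%:E by rewrite /lB; case: (B).
have lB0 : (0 <= lB)%R by rewrite -lee_fin -lBE laplace_ge0.
have mlap : measurable_fun setT (fun u : R => laplace mu (S + u)%:E).
  apply/measurable_EFinP; apply: measurableT_comp => //.
  by apply: measurable_funM => //; exact: measurable_funD.
(* On [U] this edge rings first and the integrand is mu plus 1 times the same transform; on [V] only
   its second term is left, with the constant value at [B]. *)
pose f u := (1 + mu)%:E * ((\1_U u)%:E * laplace mu (S + u)%:E) + lB%:E * (\1_V u)%:E.
transitivity (\int[exponential_prob 1]_u f u).
  apply: eq_integral => [|u _]; first exact: ltr01.
  rewrite /f !indicE; have [Au|uA] := boolP (A < S + u)%R; last first.
    have nU : ~ U u by case=> h; rewrite h in uA.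
    have nV : ~ V u by case=> h; rewrite h in uA.
    by rewrite !memNset//= mul0e !mule0.
  have [uB|Bu] /= := ltP (S + u)%:E B.
    rewrite (mem_set (_ : U u))// memNset; last by case=> _; rewrite leNgt uB.
    by rewrite mule0 adde0 mul1e -!EFinM -EFinD mulrDl mul1r addrC.
  rewrite memNset; last by case=> _; rewrite ltNge Bu.
  by rewrite (mem_set (_ : V u))// mul0e !mule0 !add0e lBE mule1.
have f0 u : 0 <= f u.
  by rewrite adde_ge0// !mule_ge0 ?laplace_ge0 ?lee_fin// ltW.
rewrite dens//; last first.
  apply: emeasurable_funD; apply: measurable_funeM; last exact: mind.
  by apply: emeasurable_funM => //; exact: mind.
transitivity (\int[Leb]_u ((expR (- mu * S))%:E * ((\1_U u)%:E * (exponential_pdf (1 + mu) u)%:E) +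
                 lB%:E * ((\1_V u)%:E * (exponential_pdf 1 u)%:E))).
  apply: eq_integral => u _; rewrite /f /= -!(EFinM, EFinD); congr EFin.
  by rewrite mulrDl -!mulrA [in RHS]mulrCA -laplace_pdf//; ring.
have prob_ge0 r (W : set R) : (0 < r)%R -> 0 <= exponential_prob r W.
  by move=> r0; apply: integral_ge0 => u _; rewrite pdf_ge0.
rewrite msum ?expR_ge0// -lBE -VE// -ge0_muleDr ?prob_ge0//.
(* After the change of rate both contributions are masses for the law of rate 1 + mu, and [U] and
   [V] partition the half-line beyond [A - S]. *)
have -> : exponential_prob (1 + mu) U + exponential_prob (1 + mu) V =
    exponential_prob (1 + mu) `](A - S)%R, +oo[.
  rewrite -UVE /exponential_prob ge0_integral_setU//.
  - exact: measurable_exponential_pdfE.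
  - by move=> u _; rewrite pdf_ge0.
  - by apply/disj_setPS; rewrite UV0.
rewrite exponential_prob_itvoy ?subr_ge0// -EFinM -expRD.
transitivity (\int[exponential_prob 1]_u
    ((expR (- mu * A))%:E * (\1_`](A - S)%R, +oo[%classic u)%:E)); last first.
  apply: eq_integral => [|u _]; first exact: ltr01.
  rewrite indicE mem_setE in_itv/= andbT ltrBlDl.
  by case: ifP => _; rewrite ?mule1 ?mule0.
rewrite dens; last 2 first.
- by apply: measurable_funeM; exact: mind.
- by move=> u; rewrite -EFinM lee_fin mulr_ge0 ?expR_ge0.
under eq_integral do rewrite -muleA.
rewrite ge0_integralZl//; last 2 first.
- by apply: emeasurable_funM; [exact: mind|exact: step].
- by move=> u _; rewrite mule_ge0// pdf_ge0.
rewrite -exponential_probE// exponential_prob_itvoy ?subr_ge0//.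
by rewrite -EFinM -expRD; congr (expR _)%:E; ring.
Qed.

End exponential.

(** * Resampling one variable of an independent family *)

Section resampling.
Context d (T : measurableType d) (R : realType) (P : probability T R) (I : eqType).
Variables (X : I -> {RV P >-> R}) (i0 : I).
Hypothesis indep : mutually_independent X.

Definition cylinder (s : seq I) (A : I -> set R) : set T :=
  [set w | forall i, i \in s -> A i (X i w)].

(** A pi-system that generates the information carried by all the variables except [X i0]. *)
Definition cylinders_avoiding : set_system T := [set C | exists s A,
  [/\ uniq s, i0 \notin s, forall i, measurable (A i) & C = cylinder s A]].

Lemma cylinder_cons i s A : cylinder (i :: s) A = X i @^-1` A i `&` cylinder s A.
Proof.
apply/seteqP; split=> [w h|w [h1 h2] j].
  by split=> [|j js]; apply: h; rewrite inE ?eqxx ?js ?orbT.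
by rewrite inE => /predU1P[->//|]; exact: h2.
Qed.

Lemma measurable_cylinder s A : (forall i, measurable (A i)) -> measurable (cylinder s A).
Proof.
move=> mA; elim: s => [|i s ih].
  by rewrite (_ : cylinder _ _ = setT)//; apply/seteqP; split.
rewrite cylinder_cons; apply: measurableI => //.
by rewrite -[_ @^-1` _]setTI; exact: measurable_funPT.
Qed.

Lemma sub_cylinders_avoiding : cylinders_avoiding `<=` measurable.
Proof. by move=> _ [s [A [_ _ mA ->]]]; exact: measurable_cylinder. Qed.

Lemma setI_closed_cylinders_avoiding : setI_closed cylinders_avoiding.
Proof.
move=> _ _ [s [A [us i0s mA ->]]] [s' [A' [us' i0s' mA' ->]]].
exists (undup (s ++ s')), (fun i => (if i \in s then A i else setT) `&`
  (if i \in s' then A' i else setT)); split.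
- exact: undup_uniq.
- by rewrite mem_undup mem_cat negb_or i0s.
- by move=> i; apply: measurableI; case: ifP.
apply/seteqP; split=> [w [h h'] i _|w h].
  by split; case: ifP => // im; [exact: h|exact: h'].
split=> i im; have := h i; rewrite mem_undup mem_cat im ?orbT => /(_ isT)[].
  by [].
by [].
Qed.

(** As functions of [C], both sides are finite measures, and mutual independence makes them agree on
    the generating cylinders. *)
Lemma indep_cylinders_avoiding (C : set T) (B : set R) :
  <<s cylinders_avoiding >> C -> measurable B ->
  (P (C `&` X i0 @^-1` B) = P C * P (X i0 @^-1` B))%E.
Proof.
move=> sC mB.
have mXB : measurable (X i0 @^-1` B).
  by rewrite -[_ @^-1` _]setTI; exact: measurable_funPT.
have PXB0 : 0 <= fine (P (X i0 @^-1` B)) by exact: fine_ge0.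
have PXBE : (fine (P (X i0 @^-1` B)))%:E = P (X i0 @^-1` B) by rewrite fineK// fin_num_measure.
pose m1 := mrestr P mXB; pose m2 := mscale (NngNum PXB0) P.
have gen C' : cylinders_avoiding C' -> m1 C' = m2 C'.
  move=> [s [A [us i0s mA ->]]]; rewrite /m1 /m2 /mrestr /mscale/= PXBE.
  pose A' i := if i == i0 then B else A i.
  have mA' i : measurable (A' i) by rewrite /A'; case: ifP.
  have eqA i : i \in s -> A' i = A i.
    by move=> js; rewrite /A'; case: eqP => // ij; rewrite -ij js in i0s.
  have -> : cylinder s A = cylinder s A'.
    by apply/seteqP; split=> w h i im; have := h i im; rewrite eqA.
  have A'i0 : A' i0 = B by rewrite /A' eqxx.
  rewrite setIC -{1}A'i0 -cylinder_cons /cylinder indep//=; last by rewrite i0s.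
  by rewrite big_cons A'i0 indep.
rewrite -[RHS]muleC -PXBE.
apply: (@g_sigma_algebra_measure_unique _ _ _ _ sub_cylinders_avoiding (fun=> setT) _ _ m1 m2
  setI_closed_cylinders_avoiding gen _ _ sC).
- move=> _; exists [::], (fun=> setT); split=> //.
  by apply/seteqP; split.
- by rewrite bigcup_const//; exists 0%N.
- move=> _; rewrite /m1/= /mrestr setTI.
  by rewrite (le_lt_trans (probability_le1 _ _))// ltry.
Qed.
End resampling.

Section independent_product.
Local Open Scope ereal_scope.
Context d d' d'' (T : measurableType d) (T' : measurableType d') (U : measurableType d'').
Variables (R : realType) (P : probability T R) (Q : probability U R).
Variables (p : {mfun T >-> T'}) (X : {mfun T >-> U}).
Hypothesis indep : forall A B, measurable A -> measurable B ->
  P (p @^-1` A `&` X @^-1` B) = P (p @^-1` A) * Q B.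

Let pX (w : T) := (p w, X w).
Let mpX : measurable_fun setT pX.
Proof. by apply: measurable_fun_pair. Qed.
HB.instance Definition _ := @isMeasurableFun.Build _ _ _ _ pX mpX.

(** By independence the pair has the product law, and Tonelli integrates the second coordinate
    first. *)
Lemma ge0_integral_resample (f : T' * U -> \bar R) :
  measurable_fun setT f -> (forall z, 0 <= f z) ->
  \int[P]_w f (p w, X w) = \int[P]_w \int[Q]_u f (p w, u).
Proof.
move=> mf f0.
have h : \int[pushforward P pX]_z f z = \int[P]_w f (p w, X w).
  by rewrite ge0_integral_pushforward.
have eqm A : measurable A -> (distribution P p \x Q) A = pushforward P pX A.
  by apply: product_measure_unique => // B C mB mC; exact: indep.
rewrite -h -(@eq_measure_integral _ _ _ setT _ (distribution P p \x Q)); last first.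
  by move=> A mA _; exact: eqm.
rewrite fubini_tonelli1// ge0_integral_pushforward//.
  exact: measurable_fun_fubini_tonelli_F.
by move=> z _; apply: integral_ge0.
Qed.
End independent_product.

Section measurability.
Local Open Scope ereal_scope.
Context d (T : measurableType d) (R : realType).

Lemma measurable_laplace (mu : R) : measurable_fun setT (laplace mu).
Proof.
rewrite (_ : laplace mu = fun x => if (-oo < x) && (x < +oo) then
    (expR (- mu * fine x))%:E else 0); last by apply/funext => -[r| |]//=; rewrite ltNyr ltry.
apply: measurable_fun_ifT => //.
  by apply: measurable_and; exact: measurable_fun_lte.
apply/measurable_EFinP; apply: measurableT_comp => //.
apply: measurable_funM => //.
Qed.

Lemma measurable_laplace_comp (mu : R) (h : T -> \bar R) : measurable_fun setT h ->
  measurable_fun setT (fun w => laplace mu (h w)).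
Proof. by move=> mh; exact: (measurableT_comp (measurable_laplace mu) mh). Qed.

Lemma measurable_next_ring (tau : T -> nat -> \bar R) (s : T -> \bar R) x :
  (forall k, measurable_fun setT (tau ^~ k)) -> measurable_fun setT s ->
  measurable_fun setT (fun w => next_ring (fun _ => tau w) x (s w)).
Proof.
move=> mtau ms.
pose h (k : nat) w := if s w < tau w k then tau w k else +oo.
rewrite (_ : (fun w => _) = (fun w => einfs (h ^~ w) 0%N)).
  apply: measurable_fun_einfs => k; apply: measurable_fun_ifT => //.
  exact: measurable_fun_lte.
apply/funext => w; rewrite /einfs /next_ring /=; congr ereal_inf.
by apply/seteqP; split=> _ [k _ <-]; exists k.
Qed.

Lemma measurable_word_time (tau : T -> int -> nat -> \bar R) c w :
  (forall y k, measurable_fun setT (fun t => tau t y k)) ->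
  measurable_fun setT (fun t => word_time (tau t) c w).
Proof.
move=> mtau; elim: w => [|i w ih]; first exact: measurable_cst.
have mnext j : measurable_fun setT
    (fun t => next_ring (tau t) (position c w j) (word_time (tau t) c w)).
  exact: (@measurable_next_ring (fun t => tau t (position c w j)) _ (position c w j)).
rewrite /=; apply: measurable_fun_ifT => //.
by apply: measurable_fun_lte => //; exact: measurable_mine.
Qed.
End measurability.

(** * Word times depend only on earlier rings *)

Section causality.
Local Open Scope ereal_scope.
Variable R : realType.
Implicit Types (tau : int -> nat -> \bar R) (s r u : \bar R).

Lemma next_ring_ge tau x s : s <= next_ring tau x s.
Proof.
apply: le_ereal_inf_tmp => _ [k _ <-].
by case: ifP => [/ltW|_]//; rewrite leey.
Qed.

Lemma next_ring_lt tau x s u : next_ring tau x s < u ->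
  exists2 k, s < tau x k & tau x k < u.
Proof.
move=> /ereal_inf_lt[_ [k _ <-]]; case: ifP => [sk ku|_]; first by exists k.
by rewrite ltNge leey.
Qed.

Lemma next_ring_le tau x s k : s < tau x k -> next_ring tau x s <= tau x k.
Proof. by move=> sk; apply: ereal_inf_lbound; exists k => //=; rewrite sk. Qed.

Lemma word_time_ge0 tau c w : 0 <= word_time tau c w.
Proof.
elim: w => [|i w ih] //=; case: ifP => _; last by rewrite leey.
exact: le_trans (next_ring_ge _ _ _).
Qed.

Lemma word_time_cons_le tau c i w : word_time tau c w <= word_time tau c (i :: w).
Proof. by rewrite /=; case: ifP => _; [exact: next_ring_ge|rewrite leey]. Qed.

(** The disjunction makes the relation symmetric: neither family has a ring before [r] that the
    other lacks. With [word_time_causal] this is a pathwise form of the stopping-time property. *)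
Definition agree_below r tau tau' := forall y k,
  (tau y k < r) || (tau' y k < r) -> tau y k = tau' y k.

Lemma agree_below_sym r tau tau' : agree_below r tau tau' -> agree_below r tau' tau.
Proof. by move=> h y k; rewrite orbC => /h. Qed.

Lemma next_ring_causal r tau tau' x s : agree_below r tau tau' ->
  next_ring tau x s < r -> next_ring tau' x s = next_ring tau x s.
Proof.
move=> ag; suff le t t' : agree_below r t t' -> next_ring t x s < r ->
    next_ring t' x s <= next_ring t x s.
  move=> nr; have le1 := le _ _ ag nr; apply/eqP; rewrite eq_le le1/=.
  by apply: le; [exact: agree_below_sym|exact: le_lt_trans nr].
move=> {}ag nr; rewrite leNgt; apply/negP => nn'.
have /next_ring_lt[k sk] : next_ring t x s < mine (next_ring t' x s) r.
  by rewrite lt_min nn'.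
rewrite lt_min => /andP[kn kr]; move: kn; rewrite ag ?kr// ltNge => /negP; apply.
by apply: next_ring_le; rewrite -ag// kr.
Qed.

Lemma word_time_causal r tau tau' c w : agree_below r tau tau' ->
  word_time tau c w < r -> word_time tau' c w = word_time tau c w.
Proof.
move=> ag; elim: w => [//|i w ih] wr; have := wr.
have {}ih := ih (le_lt_trans (word_time_cons_le _ _ i _) wr).
rewrite /= ih; case: ifP => [|_]; last by rewrite ltNge leey.
move=> lti nir; rewrite (next_ring_causal ag nir); case: ifP => // /negP[].
move: lti; rewrite !lt_min.
have lt j : next_ring tau (position c w i) (word_time tau c w) <
    next_ring tau (position c w j) (word_time tau c w) ->
    next_ring tau (position c w i) (word_time tau c w) <
    next_ring tau' (position c w j) (word_time tau c w).
  move=> ij; rewrite ltNge; apply/negP => ji.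
  move: ij; rewrite (next_ring_causal (agree_below_sym ag) (le_lt_trans ji nir)).
  by rewrite ltNge ji.
by move=> /andP[/lt-> /lt->].
Qed.

Lemma eq_next_ring tau tau' x s : tau x =1 tau' x ->
  next_ring tau x s = next_ring tau' x s.
Proof.
move=> h; rewrite /next_ring (_ : (fun k => if s < tau x k then tau x k else +oo) =
    (fun k => if s < tau' x k then tau' x k else +oo))//.
by apply/funext => k; rewrite h.
Qed.
End causality.

(** * Regularity of the clocks *)

Section clocks.
Local Open Scope ereal_scope.
Context d (T : measurableType d) (R : realType) (P : probability T R).
Variable xi : int * nat -> {RV P >-> R}.
Hypothesis clocks : exponential_clocks xi.

Local Notation avoiding i := (g_sigma_algebraType (cylinders_avoiding xi i)).

Lemma measurable_avoiding i j : j != i ->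
  measurable_fun setT (xi j : avoiding i -> R).
Proof.
move=> ji _ B mB; rewrite setTI; apply: sub_sigma_algebra.
exists [:: j], (fun=> B); split => //; first by rewrite inE eq_sym.
apply/seteqP; split=> [w h k|w]; last by apply; rewrite inE.
by rewrite inE => /eqP ->.
Qed.

(** The identity, seen as a variable with values in the coarser measurable space. Fixing all the
    clocks but [xi i] amounts to fixing its value. *)
Let to_avoiding i (w : T) : avoiding i := w.
Let measurable_to_avoiding i : measurable_fun setT (to_avoiding i).
Proof.
move=> _ B mB; rewrite setTI.
move: mB; apply: smallest_sub; last exact: sub_cylinders_avoiding.
split => [|A|F]; [exact: measurable0| |].
  by move=> mA; rewrite setTD; exact: measurableC.
by move=> mF; apply: bigcupT_measurable => k; exact: mF.
Qed.
HB.instance Definition _ i := @isMeasurableFun.Build _ _ _ _ (to_avoiding i)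
  (@measurable_to_avoiding i).

Let to_line i (w : T) : measurableTypeR R := xi i w.
Let measurable_to_line i : measurable_fun setT (to_line i).
Proof. by move=> _ B mB; exact: (@measurable_funP _ _ _ _ _ (xi i) measurableT B mB). Qed.
HB.instance Definition _ i := @isMeasurableFun.Build _ _ _ _ (to_line i)
  (@measurable_to_line i).

Lemma measurable_pair_clock i :
  measurable_fun setT (fun w => (w, xi i w) : avoiding i * measurableTypeR R).
Proof.
exact: (measurable_fun_pair (@measurable_to_avoiding i) (@measurable_to_line i)).
Qed.

Lemma ge0_integral_resample_clock i (f : avoiding i * measurableTypeR R -> \bar R) :
  measurable_fun setT f -> (forall z, 0 <= f z) ->
  \int[P]_w f (w, xi i w) = \int[P]_w \int[exponential_prob 1]_u f (w, u).
Proof.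
move=> mf f0.
rewrite (@ge0_integral_resample _ _ _ _ _ _ _ P
  (exponential_distribution_exponential_prob__canonical__probability_measure_Probability (@ltr01 R))
  (to_avoiding i) (to_line i))//.
move=> A B mA mB; rewrite indep_cylinders_avoiding//; last by case: clocks.
by congr (_ * _); case: clocks => _ h; exact: (h i B mB).
Qed.

Definition arrival x n w : R := (\sum_(k < n) xi (x, k : nat) w)%R.

Lemma arrivalS x n w : arrival x n.+1 w = (arrival x n w + xi (x, n) w)%R.
Proof. by rewrite /arrival big_ord_recr. Qed.

Lemma measurable_arrival_avoiding x n y k : (y != x) || (k <= n)%N ->
  measurable_fun setT (arrival y k : avoiding (x, n) -> R).
Proof.
elim: k => [_|k ih ykn].
  rewrite (_ : arrival y 0 = cst 0%R)//.
  by apply/funext => w; rewrite /arrival big_ord0.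
rewrite (_ : arrival y k.+1 = fun w => (arrival y k w + xi (y, k) w)%R); last first.
  by apply/funext => w; rewrite arrivalS.
apply: measurable_funD; first by apply: ih; case/orP: ykn => [->//|/ltnW->]; rewrite orbT.
apply: measurable_avoiding; rewrite xpair_eqE negb_and.
by case/orP: ykn => [->//|]; rewrite ltn_neqAle => /andP[->]; rewrite orbT.
Qed.

Lemma measurable_arrival x n : measurable_fun setT (arrival x n).
Proof.
elim: n => [|n ih].
  rewrite (_ : arrival x 0 = cst 0%R)//.
  by apply/funext => w; rewrite /arrival big_ord0.
rewrite (_ : arrival x n.+1 = fun w => (arrival x n w + xi (x, n) w)%R); last first.
  by apply/funext => w; rewrite arrivalS.
exact: measurable_funD.
Qed.

Lemma clock_gt i (x : R) : (0 <= x)%R -> P (xi i @^-1` `]x, +oo[) = (expR (- x))%:E.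
Proof.
move=> x0; case: clocks => _ /(_ i `]x, +oo[%classic); rewrite /distribution /pushforward => ->//.
by rewrite exponential_prob_itvoy// mulN1r.
Qed.

Lemma clock_le i (x : R) : (0 <= x)%R -> P (xi i @^-1` `]-oo, x]) = 1 - (expR (- x))%:E.
Proof.
move=> x0; rewrite -(clock_gt i x0) -probability_setC; last first.
  by rewrite -[_ @^-1` _]setTI; exact: measurable_funPT.
congr (P _); apply/seteqP; split=> w; rewrite /= !in_itv/= andbT leNgt; by move=> /negP.
Qed.

Lemma ae_forall_countable (J : countType) (H : J -> T -> Prop) :
  (forall j, {ae P, forall w, H j w}) -> {ae P, forall w j, H j w}.
Proof.
move=> h; have : {ae P, forall w k, if unpickle k is Some j then H j w else True}.
  by apply: ae_foralln => k; case: unpickle => [j|]; [exact: h|apply: aeW].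
by apply: filterS => w + j => /(_ (pickle j)); rewrite pickleK.
Qed.

(** The injection [f] runs either along the waiting times of one edge, so that its rings are
    unbounded, or along the first waiting times of distinct edges, so that some far edge is
    silent. *)
Lemma ae_exists_clock_gt (f : nat -> int * nat) (x : R) : injective f -> (0 <= x)%R ->
  {ae P, forall w, exists k, (x < xi (f k) w)%R}.
Proof.
move=> finj x0; pose q : R := (1 - expR (- x))%R.
have q01 : (0 <= q < 1)%R by rewrite subr_ge0 expR_le1 oppr_le0 x0/= gtrBl expR_gt0.
pose C j := [set w | forall i, i \in map f (iota 0 j) -> `]-oo, x]%classic (xi i w)].
have mC j : measurable (C j).
  by apply: (@measurable_cylinder _ _ _ _ _ xi _ (fun=> `]-oo, x]%classic)).
have PC j : P (C j) = (q ^+ j)%:E.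
  case: clocks => indep _; rewrite /C (indep _ (fun=> `]-oo, x]%classic))//; last first.
    by rewrite map_inj_uniq// iota_uniq.
  under eq_bigr do rewrite clock_le//.
  rewrite big_const_seq count_predT size_map size_iota -EFinB -/q.
  by elim: j => //= j ->; rewrite exprS EFinM.
exists (\bigcap_j C j); split.
- exact: bigcapT_measurable.
- apply/eqP; rewrite eq_le measure_ge0 andbT; apply/lee_addgt0Pr => e e0; rewrite add0e.
  have [j qj] : exists j, (q ^+ j <= e)%R.
    have /cvgrPdist_le/(_ _ e0)[j _ /(_ j (leqnn _))] :
        (fun n : nat => q ^+ n)%R @ \oo --> (0 : R)%R.
      by apply: cvg_expr; case/andP: q01 => q0 q1; rewrite ger0_norm.
    by rewrite sub0r normrN => h; exists j; rewrite (le_trans (ler_norm _)).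
  apply: (@le_trans _ _ (P (C j))); last by rewrite PC lee_fin.
  by apply: le_measure; rewrite ?inE//; [exact: bigcapT_measurable|exact: bigcap_inf].
- move=> w /= nw j _ _ /mapP[k _ ->] /=; rewrite in_itv/= leNgt; apply/negP => h.
  by apply: nw; exists k.
Qed.

Lemma exponential_prob_set1 (a : R) : exponential_prob 1 [set a] = 0.
Proof. by rewrite /exponential_prob integral_set1. Qed.

(** With all the other clocks fixed, equality forces [xi (x, n)] to take one given value, which an
    exponential law does not charge. *)
Lemma ae_arrival_neq x y n m : x != y ->
  {ae P, forall w, arrival x n.+1 w <> arrival y m.+1 w}.
Proof.
move=> xy; pose A := [set z : avoiding (x, n) * measurableTypeR R |
  (arrival x n z.1 + z.2 == arrival y m.+1 z.1)%R].
have m1 y' k : (y' != x) || (k <= n)%N -> measurable_fun setT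
    (fun z : avoiding (x, n) * measurableTypeR R => arrival y' k z.1).
  by move=> h; exact: (measurableT_comp (measurable_arrival_avoiding h)).
have m2 : measurable_fun setT (fun z : avoiding (x, n) * measurableTypeR R => z.2 : R).
  by move=> _ B mB; exact: (@measurable_snd _ _ _ (measurableTypeR R) measurableT B mB).
have mA : measurable A.
  rewrite -[A]setTI.
  have : measurable_fun setT (fun z : avoiding (x, n) * measurableTypeR R =>
      (arrival x n z.1 + z.2 == arrival y m.+1 z.1)%R).
    apply: measurable_fun_eqr; first by apply: measurable_funD => //; apply: m1; rewrite leqnn orbT.
    by apply: m1; rewrite eq_sym xy.
  by move=> /(_ measurableT [set true]); exact.
have mA1 : measurable_fun setT (fun z => (\1_A z)%:E : \bar R).
  by apply/measurable_EFinP; exact: measurable_indic.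
have A0 z : 0 <= (\1_A z)%:E :> \bar R by rewrite lee_fin.
have := ge0_integral_resample_clock mA1 A0; rewrite [X in _ = X]integral0_eq; last first.
  move=> w _; pose a : R := (arrival y m.+1 w - arrival x n w)%R.
  transitivity (\int[exponential_prob 1]_u (\1_([set a] : set R) u)%:E : \bar R).
    apply: eq_integral => [|u _]; first exact: ltr01.
    rewrite !indicE /A; congr (_%:R)%:E; congr nat_of_bool.
    apply/idP/idP; rewrite !inE/=; first by move=> /eqP; rewrite /a => <-; rewrite addrC addKr.
    by move=> ->; rewrite /a addrC subrK.
  have m1a : measurable ([set a] : set (measurableTypeR R)) by exact: (@measurable_set1 R).
  by rewrite integral_indic// setIT; exact: exponential_prob_set1.
pose N := [set w | arrival x n.+1 w == arrival y m.+1 w].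
have mN : measurable N.
  rewrite -[N]setTI.
  have : measurable_fun setT (fun w => arrival x n.+1 w == arrival y m.+1 w).
    by apply: measurable_fun_eqr; exact: measurable_arrival.
  by move=> /(_ measurableT [set true]); exact.
have AN w : \1_A (w, xi (x, n) w) = \1_N w :> R.
  by rewrite !indicE; congr (nat_of_bool _)%:R; apply/idP/idP;
    rewrite !in_setE /N /A/= (arrivalS x n).
under eq_integral do rewrite AN.
rewrite integral_indic// setIT => N0; exists N; split=> //.
by move=> w /= /contrapT/eqP.
Qed.

(** The pathwise conditions under which leader changes are counted by words. [arrival x 0] is the
    origin of time, so rings are the [arrival x n.+1]; the last condition provides the silent
    edges. *)
Definition regular_clocks (w : T) := [/\ forall i, (0 < xi i w)%R,
  forall x M, exists n, (M < arrival x n.+1 w)%R,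
  forall x y n m, arrival x n.+1 w = arrival y m.+1 w -> x = y &
  forall M (m : int), exists2 x, (m <= x)%R & (M < arrival x 1 w)%R].

Lemma regular_arrival_homo w x n m : regular_clocks w -> (n <= m)%N ->
  (arrival x n w <= arrival x m w)%R.
Proof.
case=> gt0 _ _ _ /subnKC <-; elim: (m - n)%N => [|k ih]; first by rewrite addn0.
by rewrite addnS arrivalS (le_trans ih)// lerDl ltW.
Qed.

Lemma ae_regular_clocks : {ae P, forall w, regular_clocks w}.
Proof.
have gt0 : {ae P, forall w i, (0 < xi i w)%R}.
  apply: ae_forall_countable => i.
  exists (xi i @^-1` `]-oo, 0%R]); split.
  - by rewrite -[_ @^-1` _]setTI; exact: measurable_funPT.
  - by rewrite clock_le// oppr0 expR0 subee.
  - by move=> w /= /negP; rewrite in_itv/= -leNgt.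
have unb : {ae P, forall w (xm : int * nat), exists k, (1 < xi (xm.1, (xm.2 + k)%N) w)%R}.
  apply: ae_forall_countable => -[x m] /=.
  apply: (@ae_exists_clock_gt (fun k => (x, (m + k)%N))) => //.
  by move=> k l [/addnI].
have far : {ae P, forall w (mN : int * nat), exists k,
    (mN.2%:R < xi (mN.1 + k%:Z, 0%N)%R w)%R}.
  apply: ae_forall_countable => -[m N] /=.
  apply: (@ae_exists_clock_gt (fun k => (m + k%:Z, 0%N)%R)) => //.
  by move=> k l [/addrI[]].
have neq : {ae P, forall w (j : int * int * nat * nat), j.1.1.1 != j.1.1.2 ->
    arrival j.1.1.1 j.1.2.+1 w <> arrival j.1.1.2 j.2.+1 w}.
  apply: ae_forall_countable => -[[[x y] n] m] /=.
  have [->|xy] := eqVneq x y; first exact: aeW.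
  by apply: filterS (ae_arrival_neq n m xy) => w + _.
apply: filter_app neq; apply: filter_app far; apply: filter_app unb.
move: gt0; apply: filterS => w gt0 unb far neq; split=> //.
- have mono x n m : (n <= m)%N -> (arrival x n w <= arrival x m w)%R.
    move=> /subnKC <-; elim: (m - n)%N => [|k ih]; first by rewrite addn0.
    by rewrite addnS arrivalS (le_trans ih)// lerDl ltW.
  have big x N : exists n, (N%:R <= arrival x n w)%R.
    elim: N => [|N [n Nn]]; first by exists 0%N; rewrite /arrival big_ord0.
    have [k /= k1] := unb (x, n); exists (n + k).+1.
    rewrite arrivalS -natr1 lerD ?(ltW k1)//.
    by rewrite (le_trans Nn)// mono// leq_addr.
  move=> x M; have [n nM] := big x (Num.truncn `|M|).+1; exists n.
  rewrite (lt_le_trans _ (mono _ _ _ (leqnSn n)))// (lt_le_trans _ nM)//.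
  by rewrite (le_lt_trans (ler_norm _))// truncnS_gt.
- move=> x y n m e; apply/eqP/negPn/negP => xy.
  exact: (neq (x, y, n, m)).
- move=> M m; have [k kM] := far (m, (Num.truncn `|M|).+1); exists (m + k%:Z)%R.
    by rewrite lerDl.
  rewrite arrivalS /arrival big_ord0 add0r (lt_trans _ kM)//.
  by rewrite (le_lt_trans (ler_norm _))// truncnS_gt.
Qed.

End clocks.

(** * The law of a word *)

Lemma nneseries_single (R : realType) (g : nat -> \bar R) n :
  (forall k, k != n -> g k = 0%E) -> (\sum_(0 <= k <oo) g k = g n)%E.
Proof.
move=> g0; apply: lim_near_cst => //; exists n.+1 => // m /= nm.
rewrite (bigD1_seq n) ?iota_uniq ?mem_index_iota//= big1 ?adde0//.
Qed.

Section word_law.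
Local Open Scope ereal_scope.
Context d (T : measurableType d) (R : realType) (P : probability T R).
Variable xi : int * nat -> {RV P >-> R}.
Hypothesis clocks : exponential_clocks xi.
Variable c : nat.

Local Notation avoiding i := (g_sigma_algebraType (cylinders_avoiding xi i)).
Local Notation arrival := (arrival xi).

Definition ring_times (w : T) y k : \bar R := (arrival y k.+1 w)%:E.
Local Notation wtime wd w := (word_time (ring_times w) c wd).
Local Notation next wd w i := (next_ring (ring_times w) (position c wd i) (wtime wd w)).

Lemma measurable_ring_times y k : measurable_fun setT (fun w => ring_times w y k).
Proof. by apply/measurable_EFinP; exact: measurable_arrival. Qed.

Lemma measurable_wtime wd : measurable_fun setT (fun w => wtime wd w).
Proof. by apply: measurable_word_time => y k; exact: measurable_ring_times. Qed.

Lemma measurable_next wd i : measurable_fun setT (fun w => next wd w i).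
Proof.
apply: (@measurable_next_ring _ _ _ (fun t => ring_times t (position c wd i)) _ (position c wd i)).
  by move=> k; exact: measurable_ring_times.
exact: measurable_wtime.
Qed.

(* Erasing the rings of [x] from the [n]-th on does not change what happens
   before that ring, and leaves ring times that do not depend on [xi (x, n)]. *)
Definition frozen x n (w : avoiding (x, n)) y k : \bar R :=
  if (y == x) && (n <= k)%N then +oo else ring_times w y k.

Lemma measurable_frozen x n y k : measurable_fun setT (fun w => @frozen x n w y k).
Proof.
rewrite /frozen; case: (boolP ((y == x) && (n <= k)%N)) => h; first exact: measurable_cst.
apply/measurable_EFinP; apply: measurable_arrival_avoiding.
by rewrite ltnNge -negb_and.
Qed.

Variables (wd : seq walker) (mu : R).
Hypothesis mu0 : (0 < mu)%R.
Hypothesis distinct : forall i, let x := position c wd in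
  x i != x (rivals i).1 /\ x i != x (rivals i).2.

Definition next_jump w := mine (next wd w Rear) (mine (next wd w Mid) (next wd w Front)).

Lemma next_jumpE w i : next_jump w =
  mine (next wd w i) (mine (next wd w (rivals i).1) (next wd w (rivals i).2)).
Proof.
case: i => //=; first by rewrite /next_jump minCA.
by rewrite /next_jump minA [in LHS]minC.
Qed.

Lemma measurable_next_jump : measurable_fun setT next_jump.
Proof.
by apply: measurable_mine; [|apply: measurable_mine]; exact: measurable_next.
Qed.

Section frozen_clock.
Variables (i : walker) (n : nat).
Let x := position c wd i.
Let A (w : avoiding (x, n)) := word_time (frozen w) c wd.
Let B (w : avoiding (x, n)) := mine (next_ring (frozen w) (position c wd (rivals i).1) (A w))
  (next_ring (frozen w) (position c wd (rivals i).2) (A w)).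
(** The waiting time [xi (x, n)] is the one under way at the word time. Apart from [z.2], everything
    here is measurable with respect to the other clocks, so [exponential_memoryless] applies after
    resampling. *)
Let before (z : avoiding (x, n) * measurableTypeR R) :=
  ((arrival x n z.1)%:E <= A z.1) && (A z.1 < (arrival x n z.1 + z.2)%:E).
Let f z := if before z then
  mu%:E * (if (arrival x n z.1 + z.2)%:E < B z.1 then
           laplace mu (arrival x n z.1 + z.2)%:E else 0)
  + laplace mu (mine (arrival x n z.1 + z.2)%:E (B z.1)) else 0.
Let g z := if before z then laplace mu (A z.1) else 0.

Let mA : measurable_fun setT A.
Proof. by apply: measurable_word_time => y k; exact: measurable_frozen. Qed.

Let mB : measurable_fun setT B.
Proof.
by apply: measurable_mine;
  (apply: (@measurable_next_ring _ _ _ (fun t => frozen t (position c wd _)) _ (position c wd _))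
     => // k; exact: measurable_frozen).
Qed.

Let mz1 d' (U : measurableType d') (h : avoiding (x, n) -> U) : measurable_fun setT h ->
  measurable_fun setT (fun z : avoiding (x, n) * measurableTypeR R => h z.1).
Proof. by move=> mh; exact: (measurableT_comp mh). Qed.

Let marrival : measurable_fun setT (arrival x n : avoiding (x, n) -> R).
Proof. by apply: measurable_arrival_avoiding; rewrite leqnn orbT. Qed.

Let mring : measurable_fun setT (fun z : avoiding (x, n) * measurableTypeR R =>
  (arrival x n z.1 + z.2)%:E : \bar R).
Proof.
apply/measurable_EFinP; apply: measurable_funD; first exact: mz1.
by move=> _ C mC; exact: (@measurable_snd _ _ _ (measurableTypeR R) measurableT C mC).
Qed.

Let mbefore : measurable_fun setT before.
Proof.
apply: measurable_and.
  by apply: measurable_fun_lee; [apply/measurable_EFinP; exact: mz1|exact: mz1].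
by apply: measurable_fun_lte => //; exact: mz1.
Qed.

Let mf : measurable_fun setT f.
Proof.
apply: measurable_fun_ifT => //; apply: emeasurable_funD.
  apply: measurable_funeM; apply: measurable_fun_ifT => //.
  - by apply: measurable_fun_lte => //; exact: mz1.
  - exact: measurable_laplace_comp.
by apply: measurable_laplace_comp; apply: measurable_mine => //; exact: mz1.
Qed.

Let mg : measurable_fun setT g.
Proof. by apply: measurable_fun_ifT => //; apply: measurable_laplace_comp; exact: mz1. Qed.

Let f0 z : 0 <= f z.
Proof.
rewrite /f; case: ifP => // _; rewrite adde_ge0 ?laplace_ge0// mule_ge0//.
  by rewrite lee_fin ltW.
by case: ifP => // _; rewrite laplace_ge0.
Qed.

Let g0 z : 0 <= g z.
Proof. by rewrite /g; case: ifP => // _; rewrite laplace_ge0. Qed.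

Let integral_fg : \int[P]_w f (w, xi (x, n) w) = \int[P]_w g (w, xi (x, n) w).
Proof.
rewrite (ge0_integral_resample_clock clocks mf f0).
rewrite (ge0_integral_resample_clock clocks mg g0).
apply: eq_integral => w _; rewrite /f /g /before /=.
have AB : A w <= B w by rewrite /B le_min !next_ring_ge.
have [SA|] := boolP ((arrival x n w)%:E <= A w); last first.
  by move=> /negbTE nSA; rewrite !integral0_eq// => u _; rewrite nSA.
have A0 : 0 <= A w by exact: word_time_ge0.
case: (A w) AB SA A0 => [a| |] // AB SA _.
rewrite -(exponential_memoryless mu0 SA AB).
apply: eq_integral => [|u _]; first exact: ltr01.
by rewrite /= lte_fin; case: ifP => // _; rewrite mule0 add0e.
Qed.

Definition last_ring w :=
  ((arrival x n w)%:E <= wtime wd w) && (wtime wd w < ring_times w x n).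

Section regular.
Variable w : T.
Hypothesis reg : regular_clocks xi w.

Let agree : agree_below (ring_times w x n) (@frozen x n w) (ring_times w).
Proof.
move=> y k; rewrite /frozen; case: ifPn => // /andP[/eqP -> nk].
rewrite [+oo < _]ltNge leey/= ltNge lee_fin regular_arrival_homo//.
Qed.

Let beforeE : before (w, xi (x, n) w) = last_ring w.
Proof.
rewrite /before /last_ring /= -arrivalS -/(ring_times w x n).
have [Ar|rA] := ltP (A w) (ring_times w x n).
  by rewrite (word_time_causal agree Ar) -/(A w) Ar.
rewrite andbF; have [Wr|] := ltP (wtime wd w) (ring_times w x n); last by rewrite andbF.
by move: rA; rewrite /A (word_time_causal (agree_below_sym agree) Wr) leNgt Wr.
Qed.

Let AE : last_ring w -> A w = wtime wd w.
Proof. by case/andP => _; exact: word_time_causal (agree_below_sym agree). Qed.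

Let next_frozen j : x != position c wd j -> last_ring w ->
  next_ring (@frozen x n w) (position c wd j) (A w) = next wd w j.
Proof.
move=> xj lw; rewrite AE//; apply: eq_next_ring => k.
by rewrite /frozen eq_sym (negbTE xj).
Qed.

Let BE : last_ring w -> B w = mine (next wd w (rivals i).1) (next wd w (rivals i).2).
Proof. by move=> lw; have [x1 x2] := distinct i; rewrite /B !next_frozen. Qed.

Let nextE : last_ring w -> next wd w i = ring_times w x n.
Proof.
case/andP => SW Wr; apply/eqP; rewrite eq_le next_ring_le//=.
apply: le_ereal_inf_tmp => _ [k _ <-]; case: ifP => [Wk|_]; last by rewrite leey.
have := le_lt_trans SW Wk; rewrite lte_fin ltNge => kn.
rewrite lee_fin regular_arrival_homo// ltnS leqNgt; apply: contra kn => kn.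
by rewrite regular_arrival_homo.
Qed.

Lemma regular_f : f (w, xi (x, n) w) = if last_ring w then
  mu%:E * laplace mu (wtime (i :: wd) w) + laplace mu (next_jump w) else 0.
Proof.
rewrite /f beforeE; case: ifP => // lw; rewrite /= -arrivalS -/(ring_times w x n).
rewrite BE// (next_jumpE w i) -nextE//.
by case: ifP; rewrite ?nextE.
Qed.

Lemma regular_g : g (w, xi (x, n) w) = if last_ring w then laplace mu (wtime wd w) else 0.
Proof. by rewrite /g beforeE; case: ifP => // lw; rewrite AE. Qed.

End regular.

Lemma measurable_last_ring : measurable_fun setT last_ring.
Proof.
apply: measurable_and.
  apply: measurable_fun_lee; last exact: measurable_wtime.
  by apply/measurable_EFinP; exact: measurable_arrival.
by apply: measurable_fun_lte; [exact: measurable_wtime|exact: measurable_ring_times].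
Qed.

Lemma integral_last_ring :
  \int[P]_w (if last_ring w then
    mu%:E * laplace mu (wtime (i :: wd) w) + laplace mu (next_jump w) else 0) =
  \int[P]_w (if last_ring w then laplace mu (wtime wd w) else 0).
Proof.
transitivity (\int[P]_w f (w, xi (x, n) w)).
  apply: ae_eq_integral => //.
  - apply: measurable_fun_ifT => //; first exact: measurable_last_ring.
    apply: emeasurable_funD; last by apply: measurable_laplace_comp; exact: measurable_next_jump.
    by apply: measurable_funeM; apply: measurable_laplace_comp; exact: measurable_wtime.
  - by apply: (measurableT_comp mf) => /=; exact: measurable_pair_clock.
  - by move: (ae_regular_clocks clocks); apply: filterS => w reg _; rewrite -regular_f.
rewrite integral_fg; apply: ae_eq_integral => //.
- by apply: (measurableT_comp mg) => /=; exact: measurable_pair_clock.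
- apply: measurable_fun_ifT => //; first exact: measurable_last_ring.
  by apply: measurable_laplace_comp; exact: measurable_wtime.
- by move: (ae_regular_clocks clocks); apply: filterS => w reg _; rewrite -regular_g.
Qed.

End frozen_clock.

(** Almost surely, when the word is realised, exactly one waiting time of the edge of [i] is under
    way at that moment. *)
Lemma integral_sum_last_ring i (h : T -> \bar R) : measurable_fun setT h ->
  (forall w, 0 <= h w) -> (forall w, wtime wd w = +oo -> h w = 0) ->
  \int[P]_w h w = \sum_(0 <= n <oo) \int[P]_w (if last_ring i n w then h w else 0).
Proof.
move=> mh h0 hy.
have mif n : measurable_fun setT (fun w => if last_ring i n w then h w else 0).
  by apply: measurable_fun_ifT => //; exact: measurable_last_ring.
have if0 n w : 0 <= (if last_ring i n w then h w else 0) by case: ifP.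
rewrite -integral_nneseries//.
apply: ae_eq_integral => //; first exact: ge0_emeasurable_sum.
move: (ae_regular_clocks clocks); apply: filterS => w reg _; have [_ unb _ _] := reg.
have [Wy|Wfin] := eqVneq (wtime wd w) +oo.
  by rewrite hy// eseries0// => n _ _; case: ifP.
pose x := position c wd i; pose a := fine (wtime wd w).
have WE : wtime wd w = a%:E by rewrite fineK// ge0_fin_numE ?word_time_ge0// ltey.
have a0 : (0 <= a)%R by rewrite -lee_fin -WE word_time_ge0.
have [n an minn] := ex_minnP (unb x a).
have lastE k : last_ring i k w = (arrival x k w <= a < arrival x k.+1 w)%R.
  by rewrite /last_ring /ring_times WE lee_fin lte_fin.
rewrite (@nneseries_single _ _ n) => [|k kn]; rewrite lastE.
  rewrite an andbT; case: n an minn => [|n] an minn; first by rewrite /arrival big_ord0 a0.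
  by rewrite leNgt; case: ltP => // an'; have := minn _ an'; rewrite ltnn.
case: ifP => // /andP[ka ak]; case/eqP: kn; apply/eqP; rewrite eqn_leq minn// andbT.
rewrite leqNgt; apply/negP => nk; move: an; rewrite ltNge => /negP; apply.
by rewrite (le_trans _ ka)// regular_arrival_homo.
Qed.

Lemma integral_next_jump i :
  \int[P]_w (mu%:E * laplace mu (wtime (i :: wd) w) + laplace mu (next_jump w)) =
  \int[P]_w laplace mu (wtime wd w).
Proof.
have ml j := measurable_laplace_comp mu (@measurable_wtime j).
have nexty w : wtime wd w = +oo -> forall j, next wd w j = +oo.
  by move=> -> j; exact: next_ringy.
rewrite (integral_sum_last_ring i)//; last 3 first.
- apply: emeasurable_funD; first by apply: measurable_funeM; exact: ml.
  by apply: measurable_laplace_comp => //; exact: measurable_next_jump.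
- by move=> w; rewrite adde_ge0 ?mule_ge0 ?laplace_ge0// lee_fin ltW.
- move=> w /nexty ny; rewrite /next_jump !ny /= !ny.
  by rewrite !minxx /= ?ltxx mule0 add0e.
have l0 w : wtime wd w = +oo -> laplace mu (wtime wd w) = 0 by move=> ->.
rewrite [RHS](integral_sum_last_ring i (ml wd) (fun w => laplace_ge0 mu (wtime wd w)) l0).
by apply: eq_eseriesr => n _; exact: integral_last_ring.
Qed.

(** The walkers stand at distinct edges, so their next rings differ and exactly one of the three
    extensions is realised, at the first of these rings. *)
Lemma regular_sum_laplace w : regular_clocks xi w ->
  \sum_(i <- [:: Rear; Mid; Front]) laplace mu (wtime (i :: wd) w) = laplace mu (next_jump w).
Proof.
case=> gt0 unb inj _; rewrite !big_cons big_nil adde0.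
have [Wy|Wfin] := eqVneq (wtime wd w) +oo.
  by rewrite /next_jump /= Wy !next_ringy !minxx /= ?ltxx !adde0.
pose a := fine (wtime wd w).
have WE : wtime wd w = a%:E by rewrite fineK// ge0_fin_numE ?word_time_ge0// ltey.
have incr x n : (arrival x n.+1 w < arrival x n.+2 w)%R by rewrite [ltRHS]arrivalS ltrDl.
have nextE i : exists2 r, next wd w i = r%:E & exists n, r = arrival (position c wd i) n.+1 w.
  have [r re [_ rr _]] := next_ringP incr unb (position c wd i) a.
  by exists r => //; rewrite WE.
have [r1 E1 R1] := nextE Rear; have [r2 E2 R2] := nextE Mid; have [r3 E3 R3] := nextE Front.
have [d12 d13] := distinct Rear; have [_ d23] := distinct Mid.
have neq i j r r' : position c wd i != position c wd j ->
    (exists n, r = arrival (position c wd i) n.+1 w) ->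
    (exists n, r' = arrival (position c wd j) n.+1 w) -> r != r'.
  by move=> ij [n ->] [m ->]; apply: contra ij => /eqP /inj ->.
have n12 : r1 != r2 by exact: neq R1 R2.
have n13 : r1 != r3 by exact: neq R1 R3.
have n23 : r2 != r3 by exact: neq R2 R3.
rewrite /next_jump /= E1 E2 E3 !lt_min !lte_fin -!EFin_min /Num.min.
move: n12 n13 n23; case: (ltgtP r1 r2) => // h12; case: (ltgtP r1 r3) => // h13;
  case: (ltgtP r2 r3) => // h23 _ _ _ /=; rewrite ?adde0 ?add0e ?h12 ?h13 ?h23//=;
  first [by rewrite ltNge (ltW h12)|by rewrite ltNge (ltW h13)|
    by exfalso; move: h12 h13 h23; lra].
Qed.

(* The three equations [mu E_i + D = e] and [E_Rear + E_Mid + E_Front = D]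
   determine each [E_i]. *)
Lemma integral_laplace_cons i (e : R) : \int[P]_w laplace mu (wtime wd w) = e%:E ->
  \int[P]_w laplace mu (wtime (i :: wd) w) = (e / (3 + mu))%:E.
Proof.
move=> We.
have ml j := measurable_laplace_comp mu (@measurable_wtime j).
pose E j := \int[P]_w laplace mu (wtime (j :: wd) w); pose D := \int[P]_w laplace mu (next_jump w).
have mD : measurable_fun setT (fun w => laplace mu (next_jump w)).
  by apply: measurable_laplace_comp => //; exact: measurable_next_jump.
have E0 j : 0 <= E j by apply: integral_ge0 => w _; exact: laplace_ge0.
have D0 : 0 <= D by apply: integral_ge0 => w _; exact: laplace_ge0.
have ED j : mu%:E * E j + D = e%:E.
  rewrite -We -(integral_next_jump j) ge0_integralD//.
  - rewrite ge0_integralZl//; first by move=> w _; rewrite laplace_ge0.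
    by rewrite lee_fin ltW.
  - by move=> w _; rewrite mule_ge0 ?laplace_ge0// lee_fin ltW.
  - by apply: measurable_funeM.
  - by move=> w _; rewrite laplace_ge0.
have sumE : E Rear + (E Mid + E Front) = D.
  have -> : D = \int[P]_w \sum_(j <- [:: Rear; Mid; Front]) laplace mu (wtime (j :: wd) w).
    apply: ae_eq_integral => //; first exact: emeasurable_sum.
    by move: (ae_regular_clocks clocks); apply: filterS => w reg _; rewrite regular_sum_laplace.
  rewrite ge0_integral_sum// => [|j w _]; last exact: laplace_ge0.
  by rewrite !big_cons big_nil adde0 /E.
rewrite -/(E i); clearbody E D.
have Efin j : E j \is a fin_num.
  rewrite ge0_fin_numE//; rewrite ltey; apply/eqP => Ey.
  by have := ED j; rewrite Ey gt0_muley ?lte_fin// addye// gt_eqF// (lt_le_trans _ D0)// ltNyr.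
have Dfin : D \is a fin_num by rewrite -sumE fin_numD Efin/= fin_numD !Efin.
have {}ED j : (mu * fine (E j) + fine D = e)%R.
  by apply: EFin_inj; rewrite EFinD EFinM !fineK.
have {}sumE : (fine (E Rear) + (fine (E Mid) + fine (E Front)) = fine D)%R.
  by apply: EFin_inj; rewrite !EFinD !fineK.
rewrite -(fineK (Efin i)); congr EFin.
have := ED i; have := ED Rear; have := ED Mid; have := ED Front.
move: mu0 sumE; move: (fine (E i)) (fine (E Rear)) (fine (E Mid)) (fine (E Front)) (fine D).
move=> x a b c' y m0 s h1 h2 h3 h4.
have xa : x = a by apply: (mulfI (lt0r_neq0 m0)); lra.
have xb : x = b by apply: (mulfI (lt0r_neq0 m0)); lra.
have xc : x = c' by apply: (mulfI (lt0r_neq0 m0)); lra.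
have m30 : (3 + mu)%R != 0%R by apply: lt0r_neq0; move: m0; lra.
by rewrite -h4 -s -xa -xb -xc; field.
Qed.

End word_law.

(** * The expected number of leader changes *)

Section nonmeasurable.
Local Open Scope ereal_scope.
Context d (T : measurableType d) (R : realType) (mu : {measure set T -> \bar R}).
Import HBNNSimple.

Lemma nonmeasurable_ge0_le_integral (f g : T -> \bar R) :
  (forall x, 0 <= f x) -> (forall x, f x <= g x) -> \int[mu]_x f x <= \int[mu]_x g x.
Proof.
move=> f0 fg; have g0 x : 0 <= g x by exact: le_trans (f0 x) (fg x).
rewrite !ge0_integralTE//; apply: ereal_sup_le => _ [h hf <-].
by exists h => // x; exact: le_trans (fg x).
Qed.

(** The number of leader changes is identified with a measurable count only outside a null set. Its
    integral is still a supremum over simple functions below it, and these can be compared almost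
    everywhere. *)
Lemma nonmeasurable_ae_eq_integral (f g : T -> \bar R) :
  (forall x, 0 <= f x) -> measurable_fun setT g -> (forall x, 0 <= g x) ->
  {ae mu, forall x, f x = g x} -> \int[mu]_x f x = \int[mu]_x g x.
Proof.
move=> f0 mg g0 [N [mN N0 fgN]]; apply/eqP; rewrite eq_le; apply/andP; split.
  rewrite (ge0_integralTE _ f0); apply: ge_ereal_sup => _ [h hf <-].
  rewrite -integralT_nnsfun; apply: ae_ge0_le_integral => //.
  - by move=> x _; rewrite lee_fin.
  - by apply/measurable_EFinP.
  - exists N; split=> // x /= nhg; apply: fgN => /= fgx; apply: nhg => _.
    by rewrite -fgx; exact: hf.
(* Cut to 0 on the null set, [g] lies below [f] everywhere. *)
rewrite (_ : \int[mu]_x g x = \int[mu]_x (g \_ (~` N)) x).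
  apply: nonmeasurable_ge0_le_integral => x; rewrite patchE; case: ifPn => //.
  rewrite inE /= => nx; apply: contrapT => fg; apply: nx; apply: fgN => fgx; apply: fg.
  by rewrite fgx.
apply: ae_eq_integral => //.
  by apply/(measurable_restrictT _ _).1; [exact: measurableC|exact: measurable_funTS].
exists N; split=> // x /= h; apply: contrapT => nx; apply: h => _.
by rewrite patchE mem_set.
Qed.
End nonmeasurable.

(** The exponential Chebyshev bound, which yields the upper estimate of the mean. *)
Lemma indicator_le_laplace (R : realType) (mu t : R) (x : \bar R) : 0 < mu -> (0 <= x)%E ->
  (((x <= t%:E)%E)%:R%:E <= (expR (mu * t))%:E * laplace mu x)%E.
Proof.
move=> mu0; case: x => [r| |] //= _; last by rewrite mule0.
rewrite -EFinM !lee_fin; case: (leP r t) => rt; last by rewrite mulr_ge0 ?expR_ge0.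
by rewrite -expRD mulNr -mulrBr -[leLHS]expR0 ler_expR mulr_ge0 ?subr_ge0// ltW.
Qed.

(** Past [t], the factor exp(- (mu - nu) x) is at most its value at [t]; the rest is the transform
    at the smaller rate [nu]. *)
Lemma laplace_le_indicator (R : realType) (mu nu t : R) (x : \bar R) :
  0 < nu < mu -> (0 <= x)%E ->
  (laplace mu x <= ((x <= t%:E)%E)%:R%:E + (expR (- ((mu - nu) * t)))%:E * laplace nu x)%E.
Proof.
move=> /andP[nu0 numu]; case: x => [r| |] //=; last by rewrite mule0 adde0.
rewrite -EFinM -EFinD !lee_fin => r0; case: (leP r t) => rt.
  rewrite -[leLHS]addr0 lerD ?mulr_ge0 ?expR_ge0//.
  by rewrite -[leRHS]expR0 ler_expR mulNr oppr_le0 mulr_ge0// ltW// (lt_trans nu0).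
rewrite add0r -expRD ler_expR.
have : 0 <= (mu - nu) * (r - t) by rewrite mulr_ge0// subr_ge0 ltW.
by lra.
Qed.

Section mean.
Local Open Scope ereal_scope.
Context d (T : measurableType d) (R : realType) (P : probability T R).
Variable xi : int * nat -> {RV P >-> R}.
Hypothesis clocks : exponential_clocks xi.
Local Notation wtime c wd w := (word_time (ring_times xi w) c wd).

Lemma separated_distinct c wd i : separated c wd ->
  let x := position c wd in x i != x (rivals i).1 /\ x i != x (rivals i).2.
Proof.
rewrite /separated /rear_gap /front_gap !subr_gt0 => /andP[rm mf].
have rf := lt_trans rm mf.
by case: i => /=; split; apply/negP => /eqP e; move: rm mf rf; rewrite e ltxx.
Qed.

Lemma integral_laplace_separated c mu n wd : (0 < c)%N -> (0 < mu)%R ->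
  wd \in separated_words c n ->
  \int[P]_w laplace mu (wtime c wd w) = ((3 + mu)^-1 ^+ n)%:E.
Proof.
move=> c0 mu0; elim: n wd => [|n ih] wd.
  rewrite inE => /eqP -> /=; rewrite expr0 mulr0 expR0.
  by rewrite integral_cst//= mul1e probability_setT.
rewrite mem_filter => /andP[_ /allpairsP[[wd' i] /= [mwd' _ ->]]].
rewrite (integral_laplace_cons clocks mu0 _ i (ih _ mwd')); first by rewrite exprSr.
by move=> j; apply: separated_distinct; exact: separated_words_separated mwd'.
Qed.

Lemma integral_laplace_meeting c mu n wd : (0 < c)%N -> (0 < mu)%R ->
  wd \in meeting_words c n ->
  \int[P]_w laplace mu (wtime c (Mid :: wd) w) = ((3 + mu)^-1 ^+ n.+1)%:E.
Proof.
move=> c0 mu0; rewrite mem_filter => /andP[_ mwd].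
rewrite (integral_laplace_cons clocks mu0 _ Mid (integral_laplace_separated c0 mu0 mwd)).
  by rewrite exprSr.
by move=> j; apply: separated_distinct; exact: separated_words_separated mwd.
Qed.

Lemma sum_laplace_meeting c mu n : (0 < c)%N -> (0 < mu)%R ->
  \sum_(wd <- meeting_words c n) \int[P]_w laplace mu (wtime c (Mid :: wd) w) =
  (meeting_weight c (3 + mu)^-1 n)%:E.
Proof.
move=> c0 mu0; rewrite (eq_big_seq (fun=> ((3 + mu)^-1 ^+ n.+1)%:E)); last first.
  by move=> wd mwd; exact: integral_laplace_meeting.
rewrite /meeting_weight; elim: (meeting_words c n) => [|wd s ih].
  by rewrite big_nil mulr0.
rewrite big_cons ih -EFinD; congr EFin; move: (_ ^+ n.+1)%R => q.
by rewrite /= -natr1 mulrDr mulr1 addrC.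
Qed.

Definition early (t : R) c wd w : \bar R := ((wtime c (Mid :: wd) w <= t%:E)%E)%:R%:E.

Lemma measurable_early t c wd : measurable_fun setT (early t c wd).
Proof.
rewrite (_ : early t c wd = fun w => if wtime c (Mid :: wd) w <= t%:E then 1 else 0).
  apply: measurable_fun_ifT => //; apply: measurable_fun_lee => //.
  exact: measurable_wtime.
by apply/funext => w; rewrite /early; case: ifP.
Qed.

Lemma early_ge0 t c wd w : 0 <= early t c wd w. Proof. by rewrite lee_fin. Qed.

Definition early_count t w : \bar R :=
  \sum_(0 <= c <oo) \sum_(0 <= n <oo) \sum_(wd <- meeting_words c.+1 n) early t c.+1 wd w.

Lemma measurable_early_count t : measurable_fun setT (early_count t).
Proof.
apply: ge0_emeasurable_sum => [c w _ _|c _].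
  by apply: nneseries_ge0 => n _ _; apply: sume_ge0 => wd _; exact: early_ge0.
apply: ge0_emeasurable_sum => [n w _ _|n _].
  by apply: sume_ge0 => wd _; exact: early_ge0.
by apply: emeasurable_sum => wd; exact: measurable_early.
Qed.

Lemma early_count_ge0 t w : 0 <= early_count t w.
Proof.
apply: nneseries_ge0 => c _ _; apply: nneseries_ge0 => n _ _.
by apply: sume_ge0 => wd _; exact: early_ge0.
Qed.

Lemma integral_early_count t : \int[P]_w early_count t w =
  \sum_(0 <= c <oo) \sum_(0 <= n <oo) \sum_(wd <- meeting_words c.+1 n)
    \int[P]_w early t c.+1 wd w.
Proof.
have m1 c n : measurable_fun setT (fun w => \sum_(wd <- meeting_words c.+1 n) early t c.+1 wd w).
  by apply: emeasurable_sum => wd; exact: measurable_early.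
have n1 c n w : 0 <= \sum_(wd <- meeting_words c.+1 n) early t c.+1 wd w.
  by apply: sume_ge0 => wd _; exact: early_ge0.
rewrite integral_nneseries//; last 2 first.
- by move=> c; apply: ge0_emeasurable_sum.
- by move=> c w _; apply: nneseries_ge0.
apply: eq_eseriesr => c _; rewrite integral_nneseries//.
apply: eq_eseriesr => n _; rewrite ge0_integral_sum//.
  by move=> wd; exact: measurable_early.
by move=> wd w _; exact: early_ge0.
Qed.

Lemma integral_early_le t mu n c wd : (0 < mu)%R -> (0 < c)%N -> wd \in meeting_words c n ->
  \int[P]_w early t c wd w <= (expR (mu * t))%:E *
    \int[P]_w laplace mu (wtime c (Mid :: wd) w).
Proof.
move=> mu0 c0 mwd; have ml : measurable_fun setT (fun w => laplace mu (wtime c (Mid :: wd) w)).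
  by apply: measurable_laplace_comp; exact: measurable_wtime.
have e0 : 0 <= (expR (mu * t))%:E by rewrite lee_fin expR_ge0.
rewrite -ge0_integralZl//; last by move=> w _; exact: laplace_ge0.
apply: nonmeasurable_ge0_le_integral => w; first exact: early_ge0.
by apply: indicator_le_laplace => //; exact: word_time_ge0.
Qed.

Lemma integral_laplace_le_early t mu nu c wd : (0 < nu < mu)%R ->
  \int[P]_w laplace mu (wtime c (Mid :: wd) w) <= \int[P]_w early t c wd w +
    (expR (- ((mu - nu) * t)))%:E * \int[P]_w laplace nu (wtime c (Mid :: wd) w).
Proof.
move=> numu; have ml : measurable_fun setT (fun w => laplace nu (wtime c (Mid :: wd) w)).
  by apply: measurable_laplace_comp; exact: measurable_wtime.
have e0 : 0 <= (expR (- ((mu - nu) * t)))%:E by rewrite lee_fin expR_ge0.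
rewrite -ge0_integralZl//; last by move=> w _; exact: laplace_ge0.
rewrite -ge0_integralD//; last 4 first.
- by move=> w _; exact: early_ge0.
- exact: measurable_early.
- by move=> w _; rewrite mule_ge0 ?laplace_ge0.
- exact: measurable_funeM.
apply: nonmeasurable_ge0_le_integral => w; first exact: laplace_ge0.
by apply: laplace_le_indicator => //; exact: word_time_ge0.
Qed.

Lemma mean_early_count_le t s : (0 < s)%R -> \int[P]_w early_count t w <=
  (expR (s ^+ 2 * t))%:E * total_meeting_series s.
Proof.
move=> s0; have mu0 : (0 < s ^+ 2)%R by rewrite exprn_gt0.
rewrite integral_early_count /total_meeting_series -nneseriesZl//; last first.
  by move=> c _; exact: meeting_series_ge0.
apply: lee_nneseries => [c _ _|c _].
  apply: nneseries_ge0 => n _ _; apply: sume_ge0 => wd _.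
  by apply: integral_ge0 => w _; exact: early_ge0.
rewrite /meeting_series -nneseriesZl//; last first.
  move=> n _; rewrite lee_fin; apply: meeting_weight_ge0.
  by rewrite invr_ge0 addr_ge0// ltW.
apply: lee_nneseries => [n _ _|n _].
  by apply: sume_ge0 => wd _; apply: integral_ge0 => w _; exact: early_ge0.
rewrite -sum_laplace_meeting// ge0_sume_distrr; last first.
  by move=> wd _; apply: integral_ge0 => w _; exact: laplace_ge0.
rewrite big_seq [leRHS]big_seq; apply: lee_sum => wd mwd.
exact: integral_early_le mwd.
Qed.

Lemma total_meeting_series_le_mean t s r : (0 < r < s)%R -> total_meeting_series s <=
  \int[P]_w early_count t w +
  (expR (- ((s ^+ 2 - r ^+ 2) * t)))%:E * total_meeting_series r.
Proof.
move=> /andP[r0 rs]; have s0 := lt_trans r0 rs.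
have mu0 : (0 < s ^+ 2)%R by rewrite exprn_gt0.
have nu0 : (0 < r ^+ 2)%R by rewrite exprn_gt0.
have numu : (0 < r ^+ 2 < s ^+ 2)%R by rewrite nu0/= ltr_pXn2r// nnegrE ltW.
have e0 c wd : 0 <= \int[P]_w early t c wd w by apply: integral_ge0 => w _; exact: early_ge0.
have w0 c n x : (0 <= x)%R -> 0 <= (meeting_weight c (3 + x)^-1 n)%:E :> \bar R.
  by move=> x0; rewrite lee_fin meeting_weight_ge0// invr_ge0 addr_ge0.
rewrite integral_early_count /total_meeting_series -nneseriesZl//; last first.
  by move=> c _; exact: meeting_series_ge0.
rewrite -nneseriesD//; last 2 first.
- by move=> c _ _; apply: nneseries_ge0 => n _ _; apply: sume_ge0.
- by move=> c _ _; rewrite mule_ge0 ?meeting_series_ge0// lee_fin expR_ge0.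
apply: lee_nneseries => [c _ _|c _]; first exact: meeting_series_ge0.
rewrite /meeting_series -nneseriesZl//; last by move=> n _; rewrite w0// ltW.
rewrite -nneseriesD//; last 2 first.
- by move=> n _ _; apply: sume_ge0.
- by move=> n _ _; rewrite mule_ge0 ?w0// ?(ltW nu0)// lee_fin expR_ge0.
apply: lee_nneseries => [n _ _|n _]; first by rewrite w0// ltW.
rewrite -!sum_laplace_meeting// ge0_sume_distrr; last first.
  by move=> wd _; apply: integral_ge0 => w _; exact: laplace_ge0.
by rewrite -big_split; apply: lee_sum => wd _; exact: integral_laplace_le_early.
Qed.

Lemma ae_num_leader_changes (eta : R -> T -> config) t :
  {ae P, forall w, tasep_trajectory init_config (rings xi w) (fun t => eta t w)} ->
  {ae P, forall w, num_leader_changes (fun s => eta s w) t = early_count t w}.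
Proof.
move: (ae_regular_clocks clocks); apply: filterS2 => w [gt0 unb inj far] traj.
have incr x n : (arrival xi x n.+1 w < arrival xi x n.+2 w)%R by rewrite [ltRHS]arrivalS ltrDl.
exact: (num_leader_changes_words incr unb inj far traj).
Qed.

End mean.

Theorem theorem1p2 (d : measure_display) (T : measurableType d) (R : realType)
    (P : probability T R) (xi : int * nat -> {RV P >-> R})
    (eta : R -> T -> config)
    (Heta : multitype_tasep init_config xi eta) :
  ((\int[P]_w num_leader_changes (fun s => eta s w) t) / (ln t)%:E)%E
    @[t --> +oo] --> (3 * Num.sqrt 3 / (4 * pi))%:E.
Proof.
have [clocks _ traj] := Heta.
have meanE t : (\int[P]_w num_leader_changes (fun s => eta s w) t =
    \int[P]_w early_count xi t w)%E.
  apply: nonmeasurable_ae_eq_integral.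
  - by move=> w; exact: measure_ge0.
  - exact: measurable_early_count.
  - by move=> w; exact: early_count_ge0.
  - exact: ae_num_leader_changes.
have -> : 3 * Num.sqrt 3 / (4 * pi) = leader_rate R / 2 :> R.
  by rewrite /leader_rate; move: (pi : R) (pi_gt0 R) => p p0; field; rewrite gt_eqF.
apply: (log_growth (F := fun t => \int[P]_w num_leader_changes (fun s => eta s w) t)%E).
  by move=> t s _ /andP[s0 _]; rewrite meanE; exact: mean_early_count_le.
by move=> t s r _ _ rs; rewrite meanE; exact: total_meeting_series_le_mean.
Qed.
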